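(* Let $2\le k<n$, $\Omega\subset\mathbb{R}^n$ open, $V$ a distribution of $k$-planes on $\Omega$ spanned by $v=v_1\wedge\dots\wedge v_k$ with $v_i$ $C^1$ vectorfields. Let $T=v\mu$ be a normal $k$-current on $\Omega$ tangent to $V$ ($\mu$ a finite signed measure) with $\partial T=\tau'\mu'$ ($\mu'$ finite positive), and let $\mu'=\mu'_a+\mu'_s$ be the Lebesgue decomposition of $\mu'$ with respect to $|\mu|$. Then (i) $\mathrm{span}(\tau'(x))\subset V(x)$ for $\mu'_s$-a.e. $x$; (ii) $\mathrm{span}(\tau'(x))+V(x)=\widehat V(x)$ for $\mu'_a$-a.e. $x$.
   Context: A normal current has $T$ and $\partial T$ of finite mass. For an $h$-vector $u$, $\mathrm{span}(u)$ is the smallest subspace $Z$ of $\mathbb{R}^n$ with $u\in\Lambda_h(Z)$. $[w,w']=\mathrm{d}w(w')-\mathrm{d}w'(w)$ is the Lie bracket. $\widehat V(x):=V(x)+\mathrm{span}\{[w,w'](x): w,w'\ C^1\text{ vectorfields on }\Omega\text{ with } w(y),w'(y)\in V(y)\ \forall y\}$. $|\mu|$ is the total variation of $\mu$. *)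

(* Defs.v *)
From HB Require Import structures.
From mathcomp Require Import all_boot all_order all_algebra.
From mathcomp Require Import all_classical all_reals all_analysis.
Set Implicit Arguments. Unset Strict Implicit. Unset Printing Implicit Defensive.
Import Order.TTheory GRing.Theory Num.Theory numFieldNormedType.Exports.
Local Open Scope classical_set_scope.
Local Open Scope ring_scope.

Section Defs.
Variables (R : realType) (n : nat).

Notation vec := 'rV[R]_n.

Definition borel := g_sigma_algebraType (@open vec).

Definition ebase (j : 'I_n) : vec := delta_mx 0 j.
Definition partial {V : normedModType R} (j : 'I_n) (f : vec -> V) : vec -> V :=
  fun x => 'D_(ebase j) f x.
Definition iter_partial (s : seq 'I_n) (f : vec -> R) : vec -> R :=
  foldr (fun j g => partial j g) f s.

Definition smooth (f : vec -> R) : Prop :=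
  forall s : seq 'I_n,
    continuous (iter_partial s f) /\
    forall (j : 'I_n) (x : vec), derivable (iter_partial s f) x (ebase j).

Definition C1_on (Om : set vec) (w : vec -> vec) : Prop :=
  (forall x, Om x -> forall j, derivable w x (ebase j)) /\
  (forall j, {in Om, continuous (partial j w)}).

(* multivectors / multicovectors in coordinates w.r.t. e_I, I subset of {0..n-1}
   (I ordered increasingly) *)
Definition mvec := {ffun {set 'I_n} -> R}.

Definition is_hvec (h : nat) (u : mvec) : Prop :=
  forall I : {set 'I_n}, #|I| != h -> u I = 0.

(* wedge product v_0 /\ ... /\ v_{h-1}: coordinate I is the minor on columns I *)
Definition wedge (h : nat) (vs : 'I_h -> vec) : mvec :=
  [ffun I : {set 'I_n} => if #|I| == h then
     \det (\matrix_(i < h, j < h) nth 0 [seq vs i 0 c | c <- enum I] j)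
   else 0].

Definition pairing (h : nat) (w u : mvec) : R :=
  \sum_(I : {set 'I_n} | #|I| == h) w I * u I.

Definition mvnorm (u : mvec) : R := Num.sqrt (\sum_(I : {set 'I_n}) u I ^+ 2).

Definition extd (om : vec -> mvec) : vec -> mvec :=
  fun x => [ffun J : {set 'I_n} =>
    \sum_(j in J) (-1) ^+ (index j (enum J)) *
       partial j (fun y => om y (J :\ j)) x].

Definition test_form (Om : set vec) (h : nat) (om : vec -> mvec) : Prop :=
  (forall x, is_hvec h (om x)) /\
  (forall I, smooth (fun x => om x I)) /\
  compact (closure [set x | om x != 0]) /\ closure [set x | om x != 0] `<=` Om.

Definition subspace {V : lmodType R} (Z : set V) : Prop :=
  Z 0 /\ (forall x y, Z x -> Z y -> Z (x + y)) /\
  (forall (a : R) x, Z x -> Z (a *: x)).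

Definition lspan {V : lmodType R} (S : set V) : set V :=
  [set x | exists (m : nat) (c : 'I_m -> R) (y : 'I_m -> V),
     (forall i, S (y i)) /\ x = \sum_(i < m) c i *: y i].

Definition sumset {V : lmodType R} (A B : set V) : set V :=
  [set x | exists a b, A a /\ B b /\ x = a + b].

Definition Lambda (h : nat) (Z : set vec) : set mvec :=
  lspan [set wedge vs | vs in [set vs : 'I_h -> vec | forall i, Z (vs i)]].

Definition mvspan (h : nat) (u : mvec) : set vec :=
  [set x | forall Z : set vec, subspace Z -> Lambda h Z u -> Z x].

Definition lie (w w' : vec -> vec) : vec -> vec :=
  fun x => 'D_(w' x) w x - 'D_(w x) w' x.

Definition Vhat (Om : set vec) (V : vec -> set vec) (x : vec) : set vec :=
  sumset (V x) (lspan [set z | exists w w' : vec -> vec,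
     (C1_on Om w /\ forall y, Om y -> V y (w y)) /\
     (C1_on Om w' /\ forall y, Om y -> V y (w' y)) /\ z = lie w w' x]).

(* total variation |nu| of a (finite) signed measure, via a Hahn decomposition
   (independent of the choice) *)
Definition charge_tv (nu : {charge set borel -> \bar R}) :
    {measure set borel -> \bar R} :=
  charge_variation (projT2 (cid (projT2 (cid (Hahn_decomposition nu))))).

Definition signed_integral (nu : {charge set borel -> \bar R})
    (f : borel -> R) : \bar R :=
  let H := projT2 (cid (projT2 (cid (Hahn_decomposition nu)))) in
  (\int[jordan_pos H]_x (f x)%:E - \int[jordan_neg H]_x (f x)%:E)%E.

Definition msingular (m1 m2 : set borel -> \bar R) : Prop :=
  exists A : set borel, measurable A /\ m2 A = 0%E /\ m1 (~` A) = 0%E.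

End Defs.

(* Main.v *)
Require Import Defs.
From HB Require Import structures.
From mathcomp Require Import all_boot all_order all_algebra.
From mathcomp Require Import all_classical all_reals all_analysis.
From mathcomp Require Import measurable_realfun perm ring lra.
Set Implicit Arguments. Unset Strict Implicit. Unset Printing Implicit Defensive.
Import Order.TTheory GRing.Theory Num.Theory numFieldNormedType.Exports.
Local Open Scope classical_set_scope.
Local Open Scope ring_scope.

(** For a C^1 form [al] of degree 1 annihilating [V], contracting [v] with [al]
    gives 0.  Testing the identity [<T, d om> = <dT, om>] on [om = f al /\ dx_I]
    therefore loses the derivatives of [f], and letting [f] increase to the
    indicator of a box yields an equality of measures
      [(contraction of v with d al) mu = (contraction of tau' with al) mu'].
    C^1 coefficients are not admissible in test forms, so [al] is first
    approximated in C^1 on a box by Bernstein polynomials.  On the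
    [mu]-null part of [mu'] the right-hand contraction vanishes for all
    such [al], that is [span tau' <= V].  On the absolutely continuous part both
    contractions are proportional, with a nonzero factor coming from
    the Radon-Nikodym derivative.  The contraction of [v] with [d al] vanishes iff
    [d al] vanishes on [V], and [al [w, w'] = - d al (w, w')] for [w], [w'] tangent
    to [V]; so [span tau' + V] and [Vhat] have the same annihilator.  The rows
    of [det (M M^T)] times the orthogonal projection onto the kernel of [M] (whose
    rows span [V]) supply enough forms [al] to test with. *)

(** * Minors and simple multivectors *)

(** Subspaces are compared through their annihilators: [mvspan] is an intersection over subspaces,
    whereas killing [span u] amounts to the vanishing of an interior product, a finite linear system
    that measures can test. Hence every almost everywhere claim concerns finitely many scalar
    functions, indexed by a row of the projection and a set [I]. The derivatives of the cutoff must
    disappear before the limit is taken, since they blow up at the faces of the box; this forces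
    [al] to annihilate [V], and it is why the second conclusion sees [span tau'] only modulo [V]. On
    compact boxes the coefficients are bounded, hence integrable. Open boxes are stable under
    intersection, and those with rational corners exhaust [Om], so the exceptional sets can be
    united. As [mu] is signed, densities are taken separately on the two pieces of a Hahn
    decomposition, of [mu'] with respect to the part of [mu] living there. Such a density vanishes
    only on a [mu']-null set, which is where the nonzero factor comes from. *)

Section Minors.
Context {R : comNzRingType} {n : nat}.
Implicit Types (h : nat) (s : seq 'I_n).

(** Columns are listed by a sequence instead of a set, so that a repeated column gives 0 and a
    reordering gives a sign; along [enum I] the determinant is the coordinate [I] of a wedge product
    ([wedgeE]). *)
Definition colseq {h} (M : 'M[R]_(h, n)) s : 'M[R]_h :=
  \matrix_(i < h, j < h) nth 0 [seq M i c | c <- s] j.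

Definition minor {h} (M : 'M[R]_(h, n)) s : R := \det (colseq M s).

Lemma colseqE h (M : 'M[R]_(h, n)) s x0 (i j : 'I_h) :
  size s = h -> colseq M s i j = M i (nth x0 s j).
Proof. by move=> sh; rewrite mxE (nth_map x0) // sh. Qed.

Lemma minor_swap h (M : 'M[R]_(h, n)) s1 a b s2 :
  size (s1 ++ a :: b :: s2) = h ->
  minor M (s1 ++ a :: b :: s2) = - minor M (s1 ++ b :: a :: s2).
Proof.
move=> sh; have sh' : size (s1 ++ b :: a :: s2) = h by rewrite -sh !size_cat.
have h1 : (size s1 < h)%N by rewrite -sh size_cat /= addnS ltnS leq_addr.
have h2 : ((size s1).+1 < h)%N by rewrite -sh size_cat /= !addnS !ltnS leq_addr.
pose i1 := Ordinal h1; pose i2 := Ordinal h2.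
rewrite /minor.
have -> : \det (colseq M (s1 ++ a :: b :: s2)) =
   \det (col_perm (tperm i1 i2) (colseq M (s1 ++ b :: a :: s2))) => [|].
  congr (\det _); apply/matrixP => i j; rewrite [RHS]mxE !(@colseqE _ _ _ a) //; congr (M i _).
  rewrite !nth_cat; case: tpermP => [->|->|] /=.
  - by rewrite ltnn subnn ltnNge leqnSn /= subSnn.
  - by rewrite ltnn subnn ltnNge leqnSn /= subSnn.
  move=> /eqP; rewrite -val_eqE /= => /eqP n1 /eqP; rewrite -val_eqE /= => /eqP n2.
  case: ltnP => // le; have : (1 < j - size s1)%N.
    by rewrite ltn_subRL addn1 ltn_neqAle eq_sym; apply/andP; split;
       [exact/eqP | rewrite ltn_neqAle le andbT eq_sym; exact/eqP].
  by case: (j - size s1)%N => [|[|m]].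
rewrite col_permE det_mulmx det_perm odd_permV odd_tperm.
have -> : i1 != i2 by rewrite -val_eqE /= neq_ltn leqnn.
by rewrite expr1 mulrN1.
Qed.

Lemma minor_not_uniq h (M : 'M[R]_(h, n)) s :
  size s = h -> ~~ uniq s -> minor M s = 0.
Proof.
move=> sh; case: s sh => // x0 s0; set s := x0 :: s0 => sh /(uniqPn x0)[i [j [ij jh eij]]].
have hj : (j < h)%N by rewrite -sh.
have hi : (i < h)%N by apply: ltn_trans hj.
rewrite /minor -det_tr.
apply: (@determinant_alternate _ _ _ (Ordinal hi) (Ordinal hj)) => [|l].
  by rewrite -val_eqE /= neq_ltn ij.
rewrite [LHS]mxE [RHS]mxE !(@colseqE _ _ _ x0) //.
  by congr (M l _); exact: eij.
Qed.

Lemma minor_move h (M : 'M[R]_(h, n)) s0 j s1 s2 :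
  size (s0 ++ j :: s1 ++ s2) = h ->
  minor M (s0 ++ j :: s1 ++ s2) = (-1) ^+ size s1 * minor M (s0 ++ s1 ++ j :: s2).
Proof.
elim: s1 s0 => [|a s1 IH] s0 sh; first by rewrite expr0 mul1r.
rewrite /= minor_swap // -cat_rcons IH ?cat_rcons /=.
  by rewrite exprS mulN1r mulNr.
by rewrite -sh !size_cat /=.
Qed.

(** Explains the signs in [extd] and [contr]: [enum] follows the order of the indices, so [index j]
    counts the elements of [K] that [j] must cross to reach the front. *)
Lemma enum_setU1 (j : 'I_n) (K : {set 'I_n}) : j \notin K ->
  exists s1 s2, [/\ enum (j |: K) = s1 ++ j :: s2, enum K = s1 ++ s2
    & index j (enum (j |: K)) = size s1].
Proof.
move=> jK; have jin : j \in enum (j |: K) by rewrite mem_enum setU11.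
have un := enum_uniq (j |: K).
have eK : enum K = seq.filter (predC1 j) (enum (j |: K)).
  rewrite [in RHS]/enum_mem -filter_predI; apply: eq_filter => x /=.
  by rewrite !inE; case: eqVneq => //= ->; exact/negbTE.
case/splitPr: jin un eK => s1 s2 un eK.
exists s1, s2; split=> //.
- rewrite eK filter_cat /= eqxx /=; move: un; rewrite cat_uniq /=.
  case/and3P=> _; rewrite negb_or => /andP[j1 _] /andP[j2 _].
  by congr cat; apply/all_filterP; apply/allP => x xs /=; apply: contraTneq xs => ->.
- move: un; rewrite cat_uniq /= => /and3P[_]; rewrite negb_or => /andP[j1 _] _.
  by rewrite index_cat (negbTE j1) /= eqxx addn0.
Qed.

End Minors.

Section MinorExpansion.
Context {R : comNzRingType} {n : nat}.
Implicit Types (h : nat) (s : seq 'I_n).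

(** The prefix [s0] leaves room for a column already placed in front, as needed when two indices are
    inserted one after the other. *)
Lemma minor_insert h (M : 'M[R]_(h, n)) s0 j (K : {set 'I_n}) :
  j \notin K -> (size s0 + #|K|.+1)%N = h ->
  minor M (s0 ++ j :: enum K) =
  (-1) ^+ index j (enum (j |: K)) * minor M (s0 ++ enum (j |: K)).
Proof.
move=> jK sh; have [s1 [s2 [e1 e2 ->]]] := enum_setU1 jK.
rewrite e1 e2 minor_move // size_cat /= -sh; congr (_ + _.+1)%N.
by rewrite -e2 -cardE.
Qed.

Lemma minor_col1 h (M : 'M[R]_(h.+1, n)) s : size s = h ->
  exists kappa : 'I_h.+1 -> R,
    forall c, minor M (c :: s) = \sum_i M i c * kappa i.
Proof.
move=> sh; case: n M s sh => [|m] M s sh.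
  by exists (fun=> 0) => -[].
(* Column [ord0] is a placeholder: cofactors along column 0 delete it, so they do not depend on
   [c]. *)
exists (fun i => cofactor (colseq M (ord0 :: s)) i ord0) => c.
rewrite /minor (expand_det_col _ ord0); apply: eq_bigr => i _; rewrite mxE /=.
congr (_ * ((-1) ^+ _ * \det _)); apply/matrixP => a b.
by rewrite !mxE /=.
Qed.

Lemma minor_mull h (G : 'M[R]_h) (M : 'M[R]_(h, n)) s : size s = h ->
  minor (G *m M) s = \det G * minor M s.
Proof.
move=> sh; rewrite /minor -det_mulmx; congr (\det _); apply/matrixP => i j.
case: n M s sh => [|m] M s sh.
  by case: s sh => [sh|[]//]; have := ltn_ord i; rewrite -[X in (_ < X)%N]sh.
rewrite (@colseqE _ _ _ _ _ ord0) // !mxE; apply: eq_bigr => l _.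
by rewrite (@colseqE _ _ _ _ _ ord0).
Qed.

(** The columns [J] of [M] form the identity matrix, so taking [c = J i] in [minor_col1] identifies
    the cofactors. *)
Lemma minor_basis h (M : 'M[R]_(h.+1, n)) (J : 'I_h.+1 -> 'I_n) s c :
  (forall i i', M i (J i') = (i == i')%:R) -> size s = h ->
  minor M (c :: s) = \sum_i M i c * minor M (J i :: s).
Proof.
move=> MJ /(minor_col1 M)[kappa E]; rewrite E; apply: eq_bigr => i _.
rewrite E (bigD1 i) //= big1 => [|i' ne]; last by rewrite MJ (negbTE ne) mul0r.
by rewrite MJ eqxx mul1r addr0.
Qed.

Lemma minor_basis2 h (M : 'M[R]_(h.+2, n)) (J : 'I_h.+2 -> 'I_n) s j c :
  (forall i i', M i (J i') = (i == i')%:R) -> size s = h ->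
  minor M (j :: c :: s) =
  \sum_i \sum_i' M i j * M i' c * minor M (J i :: J i' :: s).
Proof.
move=> MJ sh; rewrite (@minor_basis _ _ J) /= ?sh //; apply: eq_bigr => i _.
rewrite (@minor_swap _ _ _ _ [::]) /= ?sh // (@minor_basis _ _ J) /= ?sh //.
rewrite -sumrN mulr_sumr; apply: eq_bigr => i' _.
by rewrite -mulrN -(@minor_swap _ _ _ _ [::]) /= ?sh // mulrA.
Qed.

End MinorExpansion.

(** * Two-forms restricted to the row space of a matrix *)

Section Alternating.
Context {R : realFieldType} {n : nat}.

(** Row reduction: [J] picks independent columns and [G] inverts the square block that they form. *)
Lemma row_free_basis_cols k (M : 'M[R]_(k, n)) : row_free M ->
  exists (J : 'I_k -> 'I_n) (G : 'M[R]_k), G \in unitmx /\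
    forall i i', (G *m M) i (J i') = (i == i')%:R.
Proof.
move=> fM; have fM' : row_full M^T by rewrite /row_full mxrank_tr; exact: fM.
exists (fullrankfun fM'); pose N := rowsub (fullrankfun fM') M^T.
have uN : N \in unitmx by rewrite -row_full_unit; exact: fullrowsub_full.
exists (invmx N^T); split=> [|i i'].
  by rewrite unitmx_inv unitmx_tr.
transitivity ((invmx N^T *m N^T) i i'); last by rewrite mulVmx ?unitmx_tr // mxE.
by rewrite !mxE; apply: eq_bigr => l _; rewrite !mxE.
Qed.

Lemma minor_cols_neq0 k (M : 'M[R]_(k, n)) (J : 'I_k -> 'I_n) s :
  (forall i i', M i (J i') = (i == i')%:R) -> perm_eq s (codom J) ->
  minor M s != 0.
Proof.
move=> MJ pe; have ss : size s = k by rewrite (perm_size pe) size_codom card_ord.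
have [x0|] := pickP (fun x : 'I_n => true); last first.
  move=> n0; case: k M J MJ pe ss => [|k] M J MJ pe ss; last by have := n0 (J ord0).
  by rewrite /minor det_mx00 oner_neq0.
(* The block is a permutation matrix; multiplying by the transpose gives the identity without naming
   the permutation. *)
move=> _; have: \det (colseq M s *m (colseq M s)^T) != 0.
  suff -> : colseq M s *m (colseq M s)^T = 1%:M by rewrite det1 oner_neq0.
  apply/matrixP => i i'; rewrite !mxE.
  under eq_bigr do rewrite [_^T _ _]mxE !(@colseqE _ _ _ _ _ x0) //.
  rewrite -(big_mkord xpredT (fun j => M i (nth x0 s j) * M i' (nth x0 s j))).
  transitivity (\sum_(c <- s) M i c * M i' c); first by rewrite (big_nth x0) ss.
  rewrite (perm_big _ pe) /=.
  rewrite /codom /image_mem big_map big_enum /= (bigD1 i) //= !MJ eqxx mul1r.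
  rewrite big1 ?addr0 ?[i' == i]eq_sym // => l li.
  by rewrite !MJ [i == l]eq_sym (negbTE li) mul0r.
by rewrite det_mulmx mulf_eq0 negb_or => /andP[].
Qed.

Lemma basis_cols_inj k (M : 'M[R]_(k, n)) (J : 'I_k -> 'I_n) :
  (forall i i', M i (J i') = (i == i')%:R) -> injective J.
Proof.
move=> MJ i i' e; have := MJ i i'; rewrite -e MJ eqxx.
by case: eqP => // _ /eqP; rewrite oner_eq0.
Qed.

(** The sums are the coordinates of the interior product of the wedge of the rows with the two-form
    of coefficients [A], and the matrix on the right is this form evaluated on the rows. The wedge
    has top degree on the row space, so contracting it loses nothing of a two-form there; row
    reduction makes this explicit. *)
Lemma minor_antisym_sum h (M : 'M[R]_(h.+2, n)) (A : 'M[R]_n) : row_free M ->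
  (forall I : {set 'I_n}, #|I| = h ->
     \sum_j \sum_c A j c * minor M (j :: c :: enum I) = 0) <->
  M *m (A - A^T) *m M^T = 0.
Proof.
move=> /row_free_basis_cols[J [G [uG MJ]]].
set M' := G *m M in MJ.
pose Q := M' *m A *m M'^T.
pose m (I : {set 'I_n}) i i' := minor M' (J i :: J i' :: enum I).
have mC (I : {set _}) i i' : #|I| = h -> m I i i' = - m I i' i.
  by move=> cI; rewrite /m (@minor_swap _ _ _ _ [::]) //= -cardE cI.
have Qsum (I : {set _}) : #|I| = h ->
  \det G * (\sum_j \sum_c A j c * minor M (j :: c :: enum I)) =
  \sum_i \sum_i' Q i i' * m I i i'.
  move=> cI; have sI : size (enum I) = h by rewrite -cardE.
  rewrite mulr_sumr.
  transitivity (\sum_j \sum_c \sum_i \sum_i' A j c * (M' i j * M' i' c * m I i i')).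
    apply: eq_bigr => j _; rewrite mulr_sumr; apply: eq_bigr => c _.
    rewrite mulrCA -minor_mull /= ?sI // (@minor_basis2 _ _ _ _ J) //.
    by rewrite mulr_sumr; apply: eq_bigr => i _; rewrite mulr_sumr.
  rewrite (eq_bigr _ (fun j _ => exchange_big _ _ _ _ _ _)) exchange_big /=.
  apply: eq_bigr => i _.
  rewrite (eq_bigr _ (fun j _ => exchange_big _ _ _ _ _ _)) exchange_big /=.
  apply: eq_bigr => i' _; rewrite mxE mulr_suml exchange_big /=.
  apply: eq_bigr => c _; rewrite !mxE !mulr_suml; apply: eq_bigr => j _.
  by ring.
have dG : \det G != 0 by rewrite -unitfE -unitmxE.
have Qanti : Q - Q^T = G *m (M *m (A - A^T) *m M^T) *m G^T.
  rewrite /Q /M' !trmx_mul !trmxK mulmxBr mulmxBl mulmxBr mulmxBl !mulmxA.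
  by [].
split=> [S0|anti I cI].
  suff Q0 : Q - Q^T = 0.
    have uGT : G^T \in unitmx by rewrite unitmx_tr.
    have : invmx G *m (Q - Q^T) *m invmx G^T = 0 by rewrite Q0 mulmx0 mul0mx.
    by rewrite Qanti !mulmxA mulVmx // mul1mx -mulmxA mulmxV // mulmx1.
  apply/matrixP => p q.
  rewrite [LHS]mxE [X in _ + X]mxE [X in _ - X]mxE [RHS]mxE.
  have [->|pq] := eqVneq p q; first by rewrite subrr.
  (* For this [I] only the pairs [(p, q)] and [(q, p)] survive in the sum, any other pair repeating
     a column. The two minors are opposite, which isolates [Q p q - Q q p]. *)
  pose I := J @: ~: [set p; q].
  have Ji := basis_cols_inj MJ.
  have cI : #|I| = h.
    rewrite card_imset // cardsCs finset.setCK cards2 pq card_ord.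
    by rewrite subSS subSS subn0.
  have := Qsum _ cI; rewrite S0 // mulr0 (bigD1 p) //= (bigD1 q) //= => E.
  have Jin i : (J i \in I) = (i != p) && (i != q).
    by rewrite mem_imset // !inE negb_or.
  have mI i i' : [|| (i != p) && (i != q), (i' != p) && (i' != q) | i == i'] ->
      m I i i' = 0.
    move=> H; apply: minor_not_uniq; first by rewrite /= -cardE cI.
    rewrite /= inE !mem_enum !Jin (inj_eq Ji) !negb_and !negb_or !negbK.
    by rewrite negb_and !negbK; case/or3P: H => ->; rewrite ?orbT.
  move: E; rewrite [X in _ + X + _]big1 => [|j nq]; last first.
    rewrite mI ?mulr0 //.
    have [->|jp] := eqVneq j p; first by rewrite eqxx !orbT.
    by rewrite nq !orbT.
  rewrite addr0 (bigD1 q) 1?eq_sym //= (bigD1 p) 1?eq_sym //=.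
  rewrite [X in _ + (_ + X + _)]big1 => [|j np]; last first.
    rewrite mI ?mulr0 //.
    have [->|jq] := eqVneq j q; first by rewrite eqxx !orbT.
    by rewrite np !orbT.
  rewrite addr0 [X in _ + (_ + X)]big1 => [|j /andP[i1 i2]]; last first.
    by apply: big1 => l _; rewrite mI ?mulr0 // i1 i2.
  rewrite addr0 (mC I q p) // mulrN -mulrBl => /esym/eqP.
  rewrite mulf_eq0 => /orP[/eqP //|].
  rewrite /m (negbTE (minor_cols_neq0 MJ _)) //.
  have un : uniq (J p :: J q :: enum I).
    by rewrite /= enum_uniq andbT inE !mem_enum !Jin (inj_eq Ji) !eqxx (negbTE pq) !andbF.
  apply: uniq_perm => //; first exact/injectiveP.
  move=> x; apply/idP/idP.
    rewrite !inE mem_enum => /orP[/eqP->|/orP[/eqP->|/imsetP[i _ ->]]]; exact: codom_f.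
  move=> /codomP[i ->]; rewrite !inE mem_enum Jin !(inj_eq Ji).
  by case: eqP => //= _; case: eqP.
apply: (mulfI dG); rewrite mulr0 Qsum //.
have QT i i' : Q i i' = Q i' i.
  move: Qanti; rewrite anti mulmx0 mul0mx => /matrixP/(_ i i'); rewrite !mxE.
  by move/eqP; rewrite subr_eq0 => /eqP.
(* [Q] is symmetric and [m I] antisymmetric, so exchanging the two indices shows that the sum is its
   own opposite. *)
set S := LHS; have : S = - S.
  rewrite /S [in RHS]exchange_big /= -sumrN; apply: eq_bigr => i _.
  by rewrite -sumrN; apply: eq_bigr => i' _; rewrite QT mC // mulrN.
by move/eqP; rewrite -addr_eq0 -mulr2n mulrn_eq0 /= => /eqP.
Qed.

End Alternating.

(** * Interior products, spans and annihilators *)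

Section Contraction.
Context {R : realType} {n : nat}.
Notation vec := 'rV[R]_n.
Notation mvec := (mvec R n).

Definition dot (a z : vec) : R := \sum_c a 0 c * z 0 c.

Lemma dotC a z : dot a z = dot z a.
Proof. by apply: eq_bigr => c _; rewrite mulrC. Qed.

Lemma dot0l z : dot 0 z = 0.
Proof. by rewrite /dot big1 // => c _; rewrite mxE mul0r. Qed.

Lemma dotDl a b z : dot (a + b) z = dot a z + dot b z.
Proof. by rewrite -big_split; apply: eq_bigr => c _; rewrite mxE mulrDl. Qed.

Lemma dotZl r a z : dot (r *: a) z = r * dot a z.
Proof. by rewrite mulr_sumr; apply: eq_bigr => c _; rewrite mxE mulrA. Qed.

Lemma dotDr a y z : dot a (y + z) = dot a y + dot a z.
Proof. by rewrite ![dot a _]dotC dotDl. Qed.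

Lemma dotZr r a z : dot a (r *: z) = r * dot a z.
Proof. by rewrite ![dot a _]dotC dotZl. Qed.

Lemma dot_sumr a (I : finType) (F : I -> vec) :
  dot a (\sum_i F i) = \sum_i dot a (F i).
Proof.
apply: (big_morph (dot a)); first exact: dotDr.
by rewrite dotC dot0l.
Qed.

Lemma lspan_sum {V : lmodType R} (S : set V) (I : finType) (a : I -> R) (y : I -> V) :
  (forall i, S (y i)) -> lspan S (\sum_i a i *: y i).
Proof.
move=> Sy; exists #|I|, (a \o enum_val), (y \o enum_val); split; first by move=> i; exact: Sy.
by rewrite (reindex _ (onW_bij _ (enum_val_bij I))).
Qed.

Lemma lspan_min {V : lmodType R} (S Z : set V) :
  Defs.subspace Z -> S `<=` Z -> lspan S `<=` Z.
Proof.
move=> [Z0 [ZD ZZ]] SZ _ [m [c [y [Sy ->]]]].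
by elim/big_ind: _ => // i _; apply: ZZ; exact: SZ.
Qed.

Lemma subset_lspan {V : lmodType R} (S : set V) : S `<=` lspan S.
Proof.
move=> x Sx; exists 1%N, (fun=> 1), (fun=> x); split=> //.
by rewrite big_ord1 scale1r.
Qed.

Lemma lspan_subspace {V : lmodType R} (S : set V) : Defs.subspace (lspan S).
Proof.
split; first by exists 0%N, (fun=> 0), (fun=> 0); split; [case | rewrite big_ord0].
split=> [_ _ [m1 [c1 [y1 [S1 ->]]]] [m2 [c2 [y2 [S2 ->]]]]|a _ [m [c [y [Sy ->]]]]].
  exists (m1 + m2)%N, (fun i => match fintype.split i with inl j => c1 j | inr j => c2 j end),
     (fun i => match fintype.split i with inl j => y1 j | inr j => y2 j end).
  split; first by move=> i; case: (fintype.split i).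
  rewrite big_split_ord /=; congr (_ + _); apply: eq_bigr => i _.
    by rewrite (unsplitK (inl i)).
  by rewrite (unsplitK (inr i)).
exists m, (fun i => a * c i), y; split=> //.
by rewrite scaler_sumr; apply: eq_bigr => i _; rewrite scalerA.
Qed.

Lemma sumset_subspace {V : lmodType R} (A B : set V) :
  Defs.subspace A -> Defs.subspace B -> Defs.subspace (sumset A B).
Proof.
move=> [A0 [AD AZ]] [B0 [BD BZ]]; split; first by exists 0, 0; rewrite addr0.
split=> [_ _ [a1 [b1 [A1 [B1 ->]]]] [a2 [b2 [A2 [B2 ->]]]]|c _ [a [b [Aa [Bb ->]]]]].
  by exists (a1 + a2), (b1 + b2); split; [exact: AD|split; [exact: BD|rewrite addrACA]].
by exists (c *: a), (c *: b); split; [exact: AZ|split; [exact: BZ|rewrite scalerDr]].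
Qed.

Lemma subspace_mulmx (Z : set vec) m (D : 'rV[R]_m) (A : 'M[R]_(m, n)) :
  Defs.subspace Z -> (forall i, Z (row i A)) -> Z (D *m A).
Proof.
move=> [Z0 [ZD ZZ]] ZA; rewrite mulmx_sum_row.
by elim/big_ind: _ => // i _; apply: ZZ; exact: ZA.
Qed.

(** Rows taken from [Z] with the largest possible rank span [Z], since stacking one more vector of
    [Z] cannot raise the rank. This brings an arbitrary set-theoretic subspace within reach of
    matrix rank theory. *)
Lemma subspace_matrix (Z : set vec) : Defs.subspace Z ->
  exists A : 'M[R]_n, forall z, Z z <-> (z <= A)%MS.
Proof.
move=> sZ; pose P r := `[< exists A : 'M[R]_n, (forall i, Z (row i A)) /\ \rank A = r >].
have P0 : exists r, P r.
  exists 0%N; apply/asboolP; exists 0; split; last exact: mxrank0.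
  by move=> i; rewrite row0; case: sZ.
have Pn r : P r -> (r <= n)%N by case/asboolP => A [_ <-]; exact: rank_leq_row.
case: (ex_maxnP P0 Pn) => r /asboolP[A [ZA rA]] rmax.
exists A => z; split=> [Zz|/submxP[D ->]]; last exact: subspace_mulmx.
have /asboolP/rmax : exists B : 'M[R]_n,
    (forall i, Z (row i B)) /\ \rank B = \rank (A + z)%MS.
  exists (A + z)%MS; split=> // i.
  have : (row i (A + z)%MS <= col_mx A z)%MS by rewrite -addsmxE row_sub.
  case/submxP => D ->; apply: subspace_mulmx => // j.
  case: (split_ordP j) => l ->; first by rewrite rowKu.
  by rewrite rowKd [l]ord1 row_id.
rewrite -rA => le.
apply: submx_trans (addsmxSr A z) _.
by rewrite -(mxrank_leqif_sup (addsmxSl A z)) // eqn_leq le mxrankS // addsmxSl.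
Qed.

(** Some column of the cokernel matrix detects [y]. Such functionals are the tool for comparing
    spans throughout. *)
Lemma subspace_separation (Z : set vec) y : Defs.subspace Z -> ~ Z y ->
  exists a, (forall z, Z z -> dot a z = 0) /\ dot a y != 0.
Proof.
move=> /subspace_matrix[A ZA] /ZA/negP; rewrite submxE => yA.
have [j yj] : exists j, (y *m cokermx A) 0 j != 0.
  apply: contrapT => /forallNP H; move/negP: yA; apply; apply/eqP/rowP => j.
  by have /negP/negPn/eqP -> := H j; rewrite mxE.
exists (col j (cokermx A))^T; have dE z : dot (col j (cokermx A))^T z = (z *m cokermx A) 0 j.
  by rewrite dotC mxE; apply: eq_bigr => c _; rewrite !mxE.
split=> [z /ZA|]; last by rewrite dE.
by rewrite submxE dE => /eqP ->; rewrite mxE.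
Qed.

(** The pairing of [dx_c /\ dx_I] with [u], that is, the coordinate [I] of the interior product of
    [u] with [dx_c]. *)
Definition contr (u : mvec) (c : 'I_n) (I : {set 'I_n}) : R :=
  if c \in I then 0 else (-1) ^+ index c (enum (c |: I)) * u (c |: I).

(** Covectors with zero interior product against [u]; in degree [h.+1], [mvspan_annih] and
    [annih_mvspan] identify them as the annihilator of [span u]. *)
Definition annih (h : nat) (u : mvec) : set vec :=
  [set a | forall I : {set 'I_n}, #|I| = h -> \sum_c a 0 c * contr u c I = 0].

Lemma annih_subspace h u : Defs.subspace (annih h u).
Proof.
split; first by move=> I _; apply: big1 => c _; rewrite mxE mul0r.
split=> [a b ha hb I cI|r a ha I cI].
  under eq_bigr do rewrite mxE mulrDl.
  by rewrite big_split /= ha // hb // addr0.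
under eq_bigr do rewrite mxE -mulrA.
by rewrite -mulr_sumr ha // mulr0.
Qed.

Lemma wedgeE h (ws : 'I_h -> vec) (I : {set 'I_n}) : wedge ws I =
  if #|I| == h then minor (\matrix_i ws i) (enum I) else 0.
Proof.
rewrite ffunE; case: eqP => // _; congr (\det _); apply/matrixP => i j.
rewrite !mxE; congr (nth _ _ _); apply: eq_map => c.
by rewrite mxE.
Qed.

(** Pulling [c] to the front of the minor absorbs the sign of [contr], and the default value 0 for
    [c] in [I] agrees with a repeated column. *)
Lemma contr_wedge h (ws : 'I_h.+1 -> vec) c (I : {set 'I_n}) : #|I| = h ->
  contr (wedge ws) c I = minor (\matrix_i ws i) (c :: enum I).
Proof.
move=> cI; rewrite /contr; case: ifPn => cinI.
  by rewrite minor_not_uniq //= -?cardE ?cI // mem_enum cinI.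
by rewrite wedgeE cardsU1 cinI cI eqxx -(@minor_insert _ _ _ _ [::]) //= cI.
Qed.

Lemma mvecZE (a : R) (u : mvec) I : (a *: u) I = a * u I.
Proof. by rewrite ffunE. Qed.

Lemma contr_sum (J : finType) (a : J -> R) (us : J -> mvec) c I :
  contr (\sum_j a j *: us j) c I = \sum_j a j * contr (us j) c I.
Proof.
rewrite /contr; case: ifP => _; first by rewrite big1 // => j _; rewrite mulr0.
rewrite sum_ffunE mulr_sumr; apply: eq_bigr => j _.
by rewrite ffunE mulrCA.
Qed.

(** By linearity of a minor in its first column, contracting a wedge with [a] produces only
    multiples of [dot a] on its factors, which lie in [Z]. *)
Lemma Lambda_annih h (Z : set vec) u a :
  (forall z, Z z -> dot a z = 0) -> Lambda h.+1 Z u -> annih h u a.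
Proof.
move=> aZ [m [c [y [yZ ->]]]] I cI.
under eq_bigr do rewrite contr_sum mulr_sumr.
rewrite exchange_big /= big1 // => i _.
case: (yZ i) => ws Zws <-.
have sI : size (enum I) = h by rewrite -cardE.
have [kappa E] := minor_col1 (\matrix_i ws i) sI.
under eq_bigr do rewrite contr_wedge // E mulr_sumr mulr_sumr.
rewrite exchange_big /= big1 // => l _.
transitivity (c i * kappa l * dot a (ws l)); last by rewrite aZ // mulr0.
by rewrite mulr_sumr; apply: eq_bigr => j _; rewrite mxE; ring.
Qed.

Definition cvec h (K : {set 'I_n}) (x0 : 'I_n) (i : 'I_h) : 'I_n :=
  nth x0 (enum K) i.

Lemma minor_cvec h (K L : {set 'I_n}) x0 : #|K| = h -> #|L| = h ->
  minor (\matrix_(i < h) (delta_mx 0 (cvec K x0 i) : vec)) (enum L) = (K == L)%:R.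
Proof.
move=> cK cL; have sL : size (enum L) = h by rewrite -cardE.
have [<-|KL] := eqVneq.
  rewrite /minor; have -> : colseq (\matrix_(i < h) (delta_mx 0 (cvec K x0 i) : vec)) (enum K) = 1%:M.
    apply/matrixP => i j; rewrite (@colseqE _ _ _ _ _ x0) -?cardE // !mxE eqxx /= /cvec.
    by rewrite nth_uniq ?enum_uniq -?cardE ?cK // eq_sym.
  by rewrite det1.
have [c cL' cK'] : exists2 c, c \in L & c \notin K.
  apply/subsetPn; apply: contra KL => LK.
  by rewrite eq_sym eqEcard LK cK cL leqnn.
have ih : (index c (enum L) < h)%N by rewrite -sL index_mem mem_enum.
rewrite /minor (expand_det_col _ (Ordinal ih)) big1 // => i _.
rewrite (@colseqE _ _ _ _ _ x0) // !mxE /= nth_index ?mem_enum // /cvec.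
case: eqP => [ec|_]; last by rewrite mul0r.
by case/negP: cK'; rewrite [X in X \in K]ec -mem_enum mem_nth // -cardE cK.
Qed.

Lemma hvec_Lambda h u : is_hvec h u -> Lambda h [set: vec] u.
Proof.
(* Without coordinates there is no default index for [cvec], so [n = 0] is settled by hand. *)
move=> hu; have [x0 _|n0] := pickP (fun x : 'I_n => true); last first.
  case: h hu => [|h] hu; last first.
    suff -> : u = 0 by exists 0%N, (fun=> 0), (fun=> 0); split; [case|rewrite big_ord0].
    apply/ffunP => I; have -> : I = finset.set0 by apply/setP => x; have := n0 x.
    by rewrite hu ?ffunE // cards0.
  have -> : u = \sum_(i < 1) u finset.set0 *: wedge (fun i : 'I_0 => 0 : vec).
    apply/ffunP => I; rewrite big_ord1 mvecZE wedgeE.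
    have -> : I = finset.set0 by apply/setP => x; have := n0 x.
    by rewrite cards0 eqxx /minor det_mx00 mulr1.
  by apply: lspan_sum => i; exists (fun=> 0).
pose a (K : {set 'I_n}) := if #|K| == h then u K else 0.
have -> : u = \sum_K a K *: wedge (fun i : 'I_h => delta_mx 0 (cvec K x0 i) : vec).
  apply/ffunP => L; rewrite sum_ffunE (bigD1 L) //= big1 => [|K KL].
    rewrite mvecZE wedgeE addr0 /a; case: eqP => [cL|/eqP cL].
      by rewrite minor_cvec // eqxx mulr1.
    by rewrite hu // mul0r.
  rewrite mvecZE wedgeE /a; case: eqP => [cK|_]; last by rewrite mul0r.
  case: eqP => [cL|_]; last by rewrite mulr0.
  by rewrite minor_cvec // (negbTE KL) mulr0.
by apply: lspan_sum => K; exists (fun i => delta_mx 0 (cvec K x0 i)).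
Qed.

(** Choose [c0] with [a 0 c0 != 0] and project each basis vector to the kernel of [a] along [e c0].
    Wedging the projected vectors with the coefficients of [u] at the sets avoiding [c0] gives back
    [u]: those coordinates are unchanged by the projection, and the contraction equations determine
    the others from them. *)
Lemma annih_Lambda h u a : is_hvec h.+1 u -> annih h u a ->
  Lambda h.+1 [set z | dot a z = 0] u.
Proof.
move=> hu ha; have [->|/eqP] := eqVneq a 0.
  have -> : [set z | dot 0 z = 0] = setT by apply/seteqP; split=> z //= _; rewrite dot0l.
  exact: hvec_Lambda.
move=> /eqP/matrix0Pn[i0 [c0]]; rewrite [i0]ord1 => ac0 {i0}.
pose b c := a 0 c / a 0 c0.
pose e c : vec := delta_mx 0 c.
pose W (K : {set 'I_n}) (i : 'I_h.+1) : vec := e (cvec K c0 i) - b (cvec K c0 i) *: e c0.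
pose w (K : {set 'I_n}) := if (#|K| == h.+1) && (c0 \notin K) then u K else 0.
have hb : forall I : {set 'I_n}, #|I| = h -> \sum_c b c * contr u c I = 0.
  move=> I cI; apply: (mulfI ac0); rewrite mulr0 mulr_sumr -[RHS](ha I cI).
  by apply: eq_bigr => c _; rewrite /b; field.
suff -> : u = \sum_K w K *: wedge (W K).
  apply: lspan_sum => K; exists (W K) => // i.
  have de c : dot a (e c) = a 0 c.
    rewrite /dot (bigD1 c) //= mxE !eqxx mulr1 big1 ?addr0 // => c' cc'.
    by rewrite mxE (negbTE cc') andbF mulr0.
  rewrite /= /W dotDr -scaleNr dotZr !de /b; by field.
have Wcol (K : {set _}) (L : seq _) : #|K| = h.+1 -> c0 \notin K -> c0 \notin L -> size L = h.+1 ->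
    minor (\matrix_i W K i) L = minor (\matrix_(i < h.+1) e (cvec K c0 i)) L.
  move=> cK c0K c0L sL; rewrite /minor; congr (\det _); apply/matrixP => i j.
  rewrite !(@colseqE _ _ _ _ _ c0) // !mxE !eqxx /=.
  suff -> : (nth c0 L j == c0) = false by rewrite mulr0 subr0.
  by apply/negbTE; apply: contraNneq c0L => <-; rewrite mem_nth // sL.
apply/ffunP => L; rewrite sum_ffunE.
have [cL|cL] := eqVneq #|L| h.+1; last first.
  rewrite hu // big1 // => K _.
  by rewrite mvecZE wedgeE (negbTE cL) mulr0.
have [c0L|c0L] := boolP (c0 \in L); last first.
  rewrite (bigD1 L) //= big1 => [|K KL]; rewrite mvecZE wedgeE cL eqxx /w.
    rewrite cL eqxx c0L /= addr0 Wcol ?minor_cvec ?eqxx ?mulr1 -?cardE //.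
    by rewrite mem_enum.
  case: ifP => [/andP[/eqP cK c0K]|]; last by rewrite mul0r.
  rewrite Wcol ?minor_cvec ?eqxx -?cardE // ?mem_enum //.
  by rewrite eq_sym in KL; rewrite eq_sym (negbTE KL) mulr0.
(* Coordinates through [c0]: the contraction equation at [I] expresses [u L] by coordinates avoiding
   [c0], and column [c0] of [W K], with entries [- b], reproduces the same combination. *)
pose I := L :\ c0.
have LI : L = c0 |: I by rewrite finset.setD1K.
have c0I : c0 \notin I by rewrite finset.setD11.
have cI : #|I| = h by move: cL; rewrite (cardsD1 c0) c0L add1n => -[].
have sI : size (enum I) = h by rewrite -cardE.
set sg := (-1) ^+ index c0 (enum (c0 |: I)) : R.
have sg2 : sg * sg = 1 by rewrite -expr2 sqrr_sign.
have WL (K : {set _}) : #|K| = h.+1 -> c0 \notin K -> wedge (W K) L =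
    - sg * \sum_(c | c != c0) b c * minor (\matrix_(i < h.+1) e (cvec K c0 i)) (c :: enum I).
  move=> cK c0K; rewrite wedgeE cL eqxx LI.
  have := @minor_insert _ _ _ (\matrix_i W K i) [::] c0 I c0I.
  rewrite /= cI -/sg => /(_ erefl) E.
  rewrite -[minor _ _]mul1r -sg2 -mulrA -E mulNr -mulrN; congr (_ * _).
  have [kappa Ek] := minor_col1 (\matrix_i W K i) sI.
  rewrite Ek.
  have Kc0 (i : 'I_h.+1) : cvec K c0 i != c0.
    by apply: contraNneq c0K => <-; rewrite -mem_enum mem_nth // -cardE cK.
  transitivity (- \sum_(i < h.+1) b (cvec K c0 i) * kappa i).
    rewrite -sumrN; apply: eq_bigr => i _.
    by rewrite !mxE !eqxx [c0 == _]eq_sym (negbTE (Kc0 i)) mulr1 sub0r mulNr.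
  congr (- _); transitivity (\sum_(c | c != c0) \sum_(i < h.+1)
      b c * ((c == cvec K c0 i)%:R * kappa i)); last first.
    apply: eq_bigr => c cc0; rewrite -mulr_sumr; congr (_ * _).
    rewrite -Wcol /= ?sI // ?Ek; last first.
      by rewrite inE negb_or eq_sym cc0 mem_enum.
    by apply: eq_bigr => i _; rewrite !mxE !eqxx /= (negbTE cc0) mulr0 subr0.
  rewrite exchange_big /=; apply: eq_bigr => i _.
  rewrite (bigD1 (cvec K c0 i)) //= eqxx mul1r big1 ?addr0 // => c /andP[_ ne].
  by rewrite (negbTE ne) mul0r mulr0.
transitivity (- sg * \sum_(c | c != c0) b c * contr u c I); last first.
  under [RHS]eq_bigr => K _.
    rewrite mvecZE.
    over.
  transitivity (\sum_K - sg * \sum_(c | c != c0)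
     b c * (w K * minor (\matrix_(i < h.+1) e (cvec K c0 i)) (c :: enum I))); last first.
    apply: eq_bigr => K _; rewrite /w; case: ifP => [/andP[/eqP cK c0K]|_]; last first.
      by rewrite mul0r big1 ?mulr0 // => c _; rewrite mul0r mulr0.
    rewrite WL // [RHS]mulrCA [in RHS]mulr_sumr; congr (_ * _).
    by apply: eq_bigr => c _; rewrite mulrCA.
  rewrite -mulr_sumr; congr (_ * _); rewrite exchange_big /=; apply: eq_bigr => c cc0.
  rewrite -mulr_sumr; congr (_ * _).
  rewrite /contr; case: ifPn => cinI.
    rewrite big1 // => K _; rewrite minor_not_uniq ?mulr0 //= ?sI //.
    by rewrite mem_enum cinI.
  have cJ : #|c |: I| = h.+1 by rewrite cardsU1 cinI cI.
  under eq_bigr => K _.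
    rewrite (@minor_insert _ _ _ _ [::]) //= ?cI //.
    over.
  rewrite (bigD1 (c |: I)) //= big1 ?addr0 => [|K KJ].
    rewrite minor_cvec // eqxx mulr1 /w cJ eqxx /= inE negb_or c0I andbT.
    by rewrite inE eq_sym cc0 mulrC.
  rewrite /w; case: ifP => [/andP[/eqP cK _]|_]; last by rewrite mul0r.
  by rewrite minor_cvec // (negbTE KJ) !mulr0.
have := hb I cI; rewrite (bigD1 c0) //= => /eqP; rewrite addr_eq0 => /eqP E.
rewrite mulNr -mulrN -E /b divff // mul1r /contr (negbTE c0I) mulrA -/sg sg2 mul1r.
by rewrite -LI.
Qed.

Lemma mvspan_annih h u y a : is_hvec h.+1 u -> mvspan h.+1 u y ->
  annih h u a -> dot a y = 0.
Proof.
move=> hu uy ha; apply: (uy [set z | dot a z = 0]); last exact: annih_Lambda.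
split; first by rewrite /= dotC dot0l.
split=> [x z /= hx hz|r x /= hx]; first by rewrite dotDr hx hz addr0.
by rewrite dotZr hx mulr0.
Qed.

(** Bidual argument: a vector [y] separating [a] from [annih h u] lies in the span, for otherwise a
    functional killing some [Z] that carries [u] but not [y] would be an element of [annih h u] that
    is nonzero at [y]. *)
Lemma annih_mvspan h u a : (forall y, mvspan h.+1 u y -> dot a y = 0) -> annih h u a.
Proof.
move=> H; apply: contrapT => /(subspace_separation (annih_subspace h u))[y [yN]].
rewrite dotC H ?eqxx // => Z sZ uZ; apply: contrapT.
move=> /(subspace_separation sZ)[b [bZ]].
by rewrite dotC yN ?eqxx //; exact: Lambda_annih uZ.
Qed.

Lemma mvspan_subspace h (u : mvec) : Defs.subspace (mvspan h u).
Proof.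
split; first by move=> Z [].
split=> [x y hx hy Z sZ uZ|a x hx Z sZ uZ].
  by case: (sZ) => _ [ZD _]; apply: ZD; [exact: hx|exact: hy].
by case: (sZ) => _ [_ ZZ]; apply: ZZ; exact: hx.
Qed.

End Contraction.

(** * Both conclusions as linear algebra at a fixed point *)

Section Pointwise.
Context {R : realType} {n h : nat}.
Notation vec := 'rV[R]_n.
Variables (vs : 'I_h.+2 -> vec) (tau : mvec R n) (P : 'M[R]_n) (d : R).
Let M := \matrix_i vs i.
Let V := lspan [set vs i | i in [set: 'I_h.+2]].
Hypotheses (hM : row_free M) (htau : is_hvec h.+1 tau).
Hypotheses (MP : M *m P^T = 0) (d0 : d != 0).
Variable (X : 'M[R]_(h.+2)).
Hypothesis (PE : P = d%:M - M^T *m X *m M).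

Lemma lspan_rows_mem y : (y <= M)%MS -> V y.
Proof.
case/submxP => D ->; rewrite mulmx_sum_row.
by apply: lspan_sum => i; rewrite rowK; exists i.
Qed.

Lemma dot_mulmx (a : vec) (y : vec) : dot a y = (y *m a^T) 0 0.
Proof. by rewrite dotC mxE; apply: eq_bigr => c _; rewrite mxE. Qed.

(** [P] differs from [d] times the identity by a matrix factoring through [M], so [y *m P^T = 0]
    puts [d *: y], hence [y], in the row space of [M]. *)
Lemma kernel_V y : (forall a, dot (row a P) y = 0) -> V y.
Proof.
move=> H; apply: lspan_rows_mem.
have Py : y *m P^T = 0.
  apply/rowP => a; rewrite [RHS]mxE -[RHS](H a) /dot mxE; apply: eq_bigr => c _.
  by rewrite !mxE mulrC.
have : y *m (d%:M - (M^T *m X *m M)^T) = 0.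
  by rewrite -[RHS]Py PE [in RHS]raddfB /= tr_scalar_mx.
rewrite mulmxBr mul_mx_scalar => /eqP; rewrite subr_eq0 => /eqP E.
have -> : y = d^-1 *: (d *: y) by rewrite scalerA mulVf // scale1r.
by rewrite E !trmx_mul trmxK !mulmxA scalemxAl submxMl.
Qed.

(** Why the rows of [P] are enough test forms: a covector killing [V] is recovered, up to [d], as a
    combination of them. *)
Lemma V_annihP (g : vec) : (forall y, V y -> dot g y = 0) -> g *m P = d *: g.
Proof.
move=> gV; rewrite PE mulmxBr mul_mx_scalar.
suff -> : g *m (M^T *m X *m M) = 0 by rewrite subr0.
rewrite !mulmxA; suff -> : g *m M^T = 0 by rewrite !mul0mx.
apply/rowP => i; rewrite [RHS]mxE -[RHS](gV (vs i)); last by apply: subset_lspan; exists i.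
by rewrite mxE; apply: eq_bigr => c _; rewrite !mxE.
Qed.

Lemma P_annihV (g : vec) y : V y -> dot (g *m P) y = 0.
Proof.
case=> m [c [z [zV ->]]]; rewrite dot_sumr big1 // => i _; rewrite dotZr.
case: (zV i) => l _ <-; rewrite dot_mulmx trmx_mul mulmxA.
have -> : vs l = row l M by rewrite rowK.
by rewrite -row_mul MP row0 mul0mx mxE mulr0.
Qed.

Lemma mvspan_sub_V :
  (forall a (I : {set 'I_n}), #|I| = h -> \sum_c P a c * contr tau c I = 0) ->
  mvspan h.+1 tau `<=` V.
Proof.
move=> H y ty; apply: kernel_V => a; apply: mvspan_annih htau ty _ => I cI.
by rewrite -[RHS](H a I cI); apply: eq_bigr => c _; rewrite mxE.
Qed.

Variables (A : 'I_n -> 'M[R]_n) (Br : set vec) (t : R).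
Let AA (g : vec) := \sum_a g 0 a *: A a.
Hypothesis hBr : forall z, Br z -> exists u u', V u /\ V u' /\
  forall g : vec, dot (g *m P) z = (u *m (AA g - (AA g)^T) *m u'^T) 0 0.
Hypothesis hBrV : forall p q, exists2 z, Br z & forall g : vec,
  dot (g *m P) z = (vs p *m (AA g - (AA g)^T) *m (vs q)^T) 0 0.
Hypothesis t0 : t != 0.
Hypothesis hAt : forall a (I : {set 'I_n}), #|I| = h ->
  \sum_c P a c * contr tau c I =
  t * \sum_j \sum_c A a j c * minor M (j :: c :: enum I).

(** [A a] will hold the partial derivatives of row [a] of [P], so [AA g] is the Jacobian of the form
    [g *m P], and the right-hand side says that its exterior derivative vanishes on [V]. The factor
    [t] is the proportionality of the two contractions. *)
Lemma annih_antisym g :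
  annih h tau (g *m P) <-> M *m (AA g - (AA g)^T) *m M^T = 0.
Proof.
rewrite -minor_antisym_sum //.
have E (I : {set 'I_n}) : #|I| = h -> \sum_c (g *m P) 0 c * contr tau c I =
   t * \sum_j \sum_c AA g j c * minor M (j :: c :: enum I).
  move=> cI; transitivity (\sum_a g 0 a * \sum_c P a c * contr tau c I).
    under [RHS]eq_bigr do rewrite mulr_sumr.
    rewrite exchange_big /=; apply: eq_bigr => c _; rewrite mxE mulr_suml.
    by apply: eq_bigr => a _; rewrite mulrA.
  under eq_bigr do rewrite hAt // mulrCA.
  rewrite -mulr_sumr; congr (_ * _).
  under eq_bigr do rewrite mulr_sumr.
  rewrite exchange_big /=; apply: eq_bigr => j _.
  under eq_bigr do rewrite mulr_sumr.
  rewrite exchange_big /=; apply: eq_bigr => c _.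
  by rewrite /AA summxE mulr_suml; apply: eq_bigr => a _; rewrite mxE mulrA.
split=> H I cI; last by rewrite E // H // mulr0.
by apply: (mulfI t0); rewrite mulr0 -E // H.
Qed.

(** No covector separates one side from the other: if [g] kills [V], then [g *m P = d *: g], and by
    [annih_antisym] it kills [span tau] exactly when the exterior derivative of [g *m P] vanishes on
    [V], that is, when it kills the brackets. *)
Lemma mvspan_V_eq : sumset (mvspan h.+1 tau) V = sumset V (lspan Br).
Proof.
have sV : Defs.subspace V by exact: lspan_subspace.
have sB : Defs.subspace (lspan Br) by exact: lspan_subspace.
have sT := mvspan_subspace h.+1 tau.
have s1 := sumset_subspace sT sV; have s2 := sumset_subspace sV sB.
have VB z : V z -> sumset V (lspan Br) z.
  by move=> Vz; exists z, 0; rewrite addr0; case: sB.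
have BB z : lspan Br z -> sumset V (lspan Br) z.
  by move=> Bz; exists 0, z; rewrite add0r; case: sV.
have VT z : V z -> sumset (mvspan h.+1 tau) V z.
  by move=> Vz; exists 0, z; rewrite add0r; case: sT.
have TT z : mvspan h.+1 tau z -> sumset (mvspan h.+1 tau) V z.
  by move=> Bz; exists z, 0; rewrite addr0; case: sV.
apply/seteqP; split=> [_ [y [z [Ty [Vz ->]]]]|_ [y [z [Vy [Bz ->]]]]].
  case: (s2) => _ [sD _]; apply: sD; last exact: VB.
  apply: contrapT => /(subspace_separation s2)[g [g0]].
  have gP : g *m P = d *: g by apply: V_annihP => v Vv; apply: g0; exact: VB.
  suff ag : annih h tau (g *m P).
    have := mvspan_annih htau Ty ag; rewrite gP dotZl => /eqP.
    by rewrite mulf_eq0 (negbTE d0) /= => /eqP ->; rewrite eqxx.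
  apply/annih_antisym/matrixP => p q.
  (* The brackets of the spanning fields suffice for this inclusion; the other one must handle
     arbitrary tangent fields. *)
  have [b Bb E] := hBrV p q; have := E g.
  rewrite gP dotZl g0; last exact/BB/subset_lspan.
  rewrite mulr0 => E0; rewrite [RHS]mxE [RHS]E0.
  rewrite -[vs p](rowK vs) -[vs q](rowK vs) -/M -row_mul [LHS]mxE [RHS]mxE.
  by apply: eq_bigr => c _; rewrite !mxE.
case: (s1) => _ [sD _]; apply: sD; first exact: VT.
apply: (lspan_min s1 _ Bz) => b Bb.
apply: contrapT => /(subspace_separation s1)[g [g0]].
have gP : g *m P = d *: g by apply: V_annihP => v Vv; apply: g0; exact: VT.
have ag : annih h tau (g *m P).
  by rewrite gP; apply: annih_mvspan => x Tx; rewrite dotZl g0 ?mulr0 //; exact: TT.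
move/annih_antisym: ag => ag.
have [u [u' [Vu [Vu' E]]]] := hBr Bb.
have := E g; rewrite gP dotZl.
have subM x : V x -> exists D, x = D *m M.
  move=> Vx; apply/submxP; move: x Vx; apply: lspan_min.
    split; first by rewrite /= sub0mx.
    split=> [x x' /= hx hx'|r x /= hx]; first exact: addmx_sub.
    exact: scalemx_sub.
  by move=> _ [i _ <-] /=; rewrite -(rowK vs) row_sub.
have [D ->] := subM u Vu; have [D' ->] := subM u' Vu'.
rewrite trmx_mul !mulmxA -[D *m M *m _]mulmxA -[D *m _ *m M^T]mulmxA ag.
rewrite mulmx0 mul0mx mxE => /eqP; rewrite mulf_eq0 (negbTE d0) /= => /eqP ->.
by rewrite eqxx.
Qed.

End Pointwise.

(** * Smooth and C^1 functions *)

Section IsDerive.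
Context {R : realType} {V W : normedModType R}.

Lemma is_deriveP (f : V -> W) x v d : is_derive x v f d <->
  (h^-1 *: (f (h *: v + x) - f x) @[h --> 0^'] --> d).
Proof.
split=> [[dx <-]|H]; first exact: dx.
by apply: DeriveDef; [apply/cvg_ex; exists d | apply/cvg_lim].
Qed.

End IsDerive.

Section IsDeriveLine.
Context {R : realType} {V W : normedModType R}.

(** Restriction to a line gives access to the chain rule and the mean value theorem for one real
    variable. *)
Lemma is_derive_line (f : V -> W) x v (s : R) d :
  is_derive s (1 : R) (fun h : R => f (h *: v + x)) d <-> is_derive (s *: v + x) v f d.
Proof.
rewrite !is_deriveP.
have E : (fun h : R => h^-1 *: (f ((h *: (1 : R) + s) *: v + x) - f (s *: v + x))) =
  (fun h : R => h^-1 *: (f (h *: v + (s *: v + x)) - f (s *: v + x))).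
  by apply/funext => h; rewrite scalerDl addrA [h *: 1]mulr1.
by split=> H; [rewrite -E; exact: H | move: H; rewrite -E; apply].
Qed.

Lemma is_derive_line0 (f : V -> W) x v d :
  is_derive (0 : R) (1 : R) (fun h : R => f (h *: v + x)) d <-> is_derive x v f d.
Proof. by rewrite is_derive_line scale0r add0r. Qed.

End IsDeriveLine.

(** * Flat functions built from exp (-1/t) *)

Section ExpInv.
Context {R : realType}.

(** The classical flat function, with a power of [1/t] in front so that the family is closed under
    differentiation up to linear combinations. *)
Definition expinv (p : nat) (t : R) : R :=
  if 0 < t then t ^- p * expR (- t^-1) else 0.

Lemma expinv_ge0 p t : 0 <= expinv p t.
Proof.
rewrite /expinv; case: ifP => // t0.
by rewrite mulr_ge0 ?expR_ge0 // invr_ge0 exprn_ge0 // ltW.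
Qed.

(** The term of order [p + 2] in the series of [exp (1/t)] gives the constant. Quadratic decay is
    what yields a zero derivative at the origin. *)
Lemma expinv_bound p t : expinv p t <= (p.+2)`!%:R * t ^+ 2.
Proof.
rewrite /expinv; case: ifP => t0; last by rewrite mulr_ge0 // ?sqr_ge0.
have ft : 0 < (p.+2)`!%:R :> R by rewrite ltr0n fact_gt0.
have ti : 0 < t^-1 by rewrite invr_gt0.
have H : t^-1 ^+ p.+2 / (p.+2)`!%:R <= expR t^-1.
  by apply: le_trans (expR_ge1Dxn p.+1 (ltW ti)); rewrite lerDr.
rewrite expRN ler_pdivrMl ?exprn_gt0 //.
rewrite -[leLHS]mul1r ler_pdivrMr ?expR_gt0 //.
apply: le_trans (_ : t ^+ p * ((p.+2)`!%:R * t ^+ 2) * (t^-1 ^+ p.+2 / (p.+2)`!%:R) <= _); last first.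
  by rewrite ler_pM2l // !mulr_gt0 // exprn_gt0.
rewrite exprVn -addn2 exprD; rewrite le_eqVlt; apply/orP; left; apply/eqP.
by field; rewrite !gt_eqF // exprn_gt0.
Qed.

Lemma is_derive_expinv p (t : R) :
  is_derive t (1 : R) (expinv p) (- p%:R * expinv p.+1 t + expinv p.+2 t).
Proof.
have [t0|t0|->] := ltgtP t 0.
- rewrite /expinv [0 < t]ltNge (ltW t0) /= mulr0 addr0.
  apply: (@near_eq_is_derive _ _ _ (cst 0)).
  near=> s; rewrite ifF //; apply/negbTE; rewrite -leNgt; apply: ltW.
  by near: s; exact: lt_nbhsl.
- rewrite /expinv t0.
  apply: (@near_eq_is_derive _ _ _ (fun s : R => s ^- p * expR (- s^-1))).
    near=> s; rewrite ifT //; near: s; exact: lt_nbhsr.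
  have tn0 : t != 0 by rewrite gt_eqF.
  have d1 : is_derive t (1 : R) (fun s : R => - s^-1) (t ^- 2).
    have dV := is_deriveV (f := id) tn0 (is_derive_id t (1 : R)).
    by apply: (is_derive_eq (is_deriveN dV)); rewrite /GRing.scale /= mulr1 opprK.
  have d2 := is_derive1_comp (g := fun s : R => - s^-1) (is_derive_expR (- t^-1)) d1.
  have tp0 : t ^+ p != 0 by rewrite expf_neq0.
  have d3 : is_derive t (1 : R) (fun s : R => s ^- p) (- p%:R * t ^- p.+1).
    have dX : is_derive t (1 : R) (fun s : R => s ^+ p) (p%:R * t ^+ p.-1).
      rewrite (_ : (fun s : R => s ^+ p) = (@id R) ^+ p); last by apply/funext => s; rewrite fctE.
      by apply: (is_derive_eq (is_deriveX p (is_derive_id t (1 : R)))); rewrite /GRing.scale /= mulr1.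
    apply: (is_derive_eq (is_deriveV (f := fun s : R => s ^+ p) tp0 dX)).
    rewrite /GRing.scale /=; case: p tp0 {dX} => [|p] tp0; first by ring.
    rewrite /= !exprS; field.
    by move: tp0; rewrite exprS mulf_eq0 negb_or => /andP[_ ->]; rewrite tn0.
  apply: (is_derive_eq (is_deriveM d3 d2)).
  rewrite /GRing.scale /= !exprS; field.
  by rewrite tp0 tn0.
rewrite /expinv ltxx mulr0 addr0.
apply/is_deriveP/cvgr0Pnorm_le => e e0.
have C0 : 0 < (p.+2)`!%:R :> R by rewrite ltr0n fact_gt0.
near=> h; rewrite scaler1 addr0 -/(expinv p h) -/(expinv p 0) [expinv p 0]/expinv ltxx subr0.
have h0 : h != 0 by near: h; exact: nbhs_dnbhs_neq.
rewrite normrZ normfV ler_pdivrMl ?normr_gt0 // ger0_norm ?expinv_ge0 //.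
apply: le_trans (expinv_bound p h) _; rewrite -real_normK ?num_real // expr2 mulrCA.
rewrite ler_pM2l ?normr_gt0 // -ler_pdivlMl // mulrC.
by near: h; apply: dnbhs0_le; rewrite divr_gt0.
Unshelve. all: by end_near. Qed.

Lemma expinv_continuous p : continuous (expinv p).
Proof.
move=> t; apply: differentiable_continuous; apply/derivable1_diffP.
by case: (is_derive_expinv p t).
Qed.

End ExpInv.

Section SmoothClass.
Context {R : realType} {n : nat}.
Notation vec := 'rV[R]_n.

(** A class closed under partial derivatives that contains the polynomials and the cutoffs. [smooth]
    speaks of all iterated partial derivatives, which this closure settles by induction. *)
Inductive elementary : (vec -> R) -> Prop :=
| elementary_cst c : elementary (fun=> c)
| elementary_coord i : elementary (fun x => x 0 i)
| elementary_expinv p i s a : elementary (fun x => expinv p (s * x 0 i + a))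
| elementary_add f g : elementary f -> elementary g -> elementary (fun x => f x + g x)
| elementary_mul f g : elementary f -> elementary g -> elementary (fun x => f x * g x).

Lemma elementary_prod (I : Type) (r : seq I) (F : I -> vec -> R) :
  (forall i, elementary (F i)) -> elementary (fun x => \prod_(i <- r) F i x).
Proof.
move=> sF; elim: r => [|i r IH].
  by under eq_fun do rewrite big_nil; exact: elementary_cst.
by under eq_fun do rewrite big_cons; exact: elementary_mul.
Qed.

Lemma is_derive_coord (x v : vec) i : is_derive x v (fun y : vec => y 0 i) (v 0 i).
Proof.
apply/is_derive_line0.
have -> : (fun h : R => (h *: v + x) 0 i) = (fun h : R => h * v 0 i + x 0 i).
  by apply/funext => h; rewrite !mxE.
apply/is_deriveP; apply: cvg_near_cst; near=> h.
rewrite addr0 mul0r add0r addrK /GRing.scale /= mulr1 mulrA mulVf ?mul1r //.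
near: h; exact: nbhs_dnbhs_neq.
Unshelve. all: by end_near. Qed.

Lemma is_derive_comp1 (V : normedModType R) (F : R -> R) (g : V -> R) x v dF dg :
  is_derive (g x) (1 : R) F dF -> is_derive x v g dg ->
  is_derive x v (fun y => F (g y)) (dF * dg).
Proof.
move=> hF /is_derive_line0 hg; apply/is_derive_line0.
by apply: (@is_derive1_comp _ F (fun h : R => g (h *: v + x))); rewrite ?scale0r ?add0r.
Qed.

Lemma elementary_derive f : elementary f -> forall j, exists g, elementary g /\
  forall x, is_derive x (ebase R j) f (g x).
Proof.
move=> sf j; elim: sf => {f} [c|i|p i s a|f g sf [f' [sf' df]] sg [g' [sg' dg]]
  |f g sf [f' [sf' df]] sg [g' [sg' dg]]].
- by exists (fun=> 0); split=> [|x]; [exact: elementary_cst | exact: is_derive_cst].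
- exists (fun=> ebase R j 0 i); split=> [|x]; first exact: elementary_cst.
  exact: is_derive_coord.
- exists (fun x => (- p%:R * expinv p.+1 (s * x 0 i + a) +
                   expinv p.+2 (s * x 0 i + a)) * (s * ebase R j 0 i)).
  split=> [|x].
    by repeat (apply: elementary_cst || apply: elementary_expinv || apply: elementary_add || apply: elementary_mul).
  apply: (is_derive_comp1 (g := fun x : vec => s * x 0 i + a)).
    exact: is_derive_expinv.
  have -> : (fun y : vec => s * y 0 i + a) =
      (s \*: (fun y : vec => y 0 i : R)) + (cst a : vec -> R) by [].
  apply: (is_derive_eq (is_deriveD (is_deriveZ s (is_derive_coord x (ebase R j) i)) (is_derive_cst _ _ _))).
  by rewrite addr0.
- exists (fun x => f' x + g' x); split=> [|x]; first exact: elementary_add.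
  exact: (is_deriveD (df x) (dg x)).
- exists (fun x => f x * g' x + g x * f' x); split=> [|x].
    by apply: elementary_add; apply: elementary_mul.
  exact: (is_deriveM (df x) (dg x)).
Qed.

Lemma elementary_continuous f : elementary f -> continuous f.
Proof.
elim=> {f} [c|i|p i s a|f g _ cf _ cg|f g _ cf _ cg].
- exact: cst_continuous.
- exact: coord_continuous.
- move=> x; apply: (@continuous_comp _ _ _ (fun x : vec => s * x 0 i + a) (expinv p)).
    apply: (@continuousD _ _ _ (fun x : vec => s * x 0 i) (cst a)); last exact: cst_continuous.
    apply: (@continuousM _ _ (cst s) (fun x : vec => x 0 i)); first exact: cst_continuous.
    exact: coord_continuous.
  exact: expinv_continuous.
- by move=> x; exact: (@continuousD _ _ _ f g x (cf x) (cg x)).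
- by move=> x; exact: (@continuousM _ _ f g x (cf x) (cg x)).
Qed.

Lemma elementary_partial f j : elementary f -> elementary (partial j f) /\
  forall x, is_derive x (ebase R j) f (partial j f x).
Proof.
move=> /elementary_derive/(_ j)[g [sg dg]].
have -> : partial j f = g by apply/funext => x; rewrite /partial; case: (dg x).
by [].
Qed.

Lemma elementary_smooth f : elementary f -> smooth f.
Proof.
move=> sf s; have : elementary (iter_partial s f).
  by elim: s => //= j s IH; case: (elementary_partial j IH).
move=> h; split; first exact: elementary_continuous.
by move=> j x; case: (elementary_partial j h) => _ /(_ x)[].
Qed.

End SmoothClass.

Section C1Functions.
Context {R : realType} {n : nat}.
Notation vec := 'rV[R]_n.
Notation e_ := (@ebase R n).

Definition C1_fun (U : set vec) (f : vec -> R) : Prop :=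
  forall x, U x -> forall j,
    is_derive x (e_ j) f (partial j f x) /\ {for x, continuous (partial j f)}.

Lemma near_eq_continuous_for (T : topologicalType) (f g : T -> R) x :
  (\near x, f x = g x) -> {for x, continuous f} -> {for x, continuous g}.
Proof.
move=> fg fx; have gx : f x = g x by exact: nbhs_singleton fg.
rewrite /prop_for /continuous_at -gx; apply: cvg_trans fx.
exact: near_eq_cvg.
Qed.

(** The candidates [g j] agree with the partial derivatives on [U] only; openness makes this an
    equality near each point, which is what continuity needs. *)
Lemma C1_fun_intro (U : set vec) f (g : 'I_n -> vec -> R) : open U ->
  (forall x, U x -> forall j, is_derive x (e_ j) f (g j x) /\ {for x, continuous (g j)}) ->
  C1_fun U f.
Proof.
move=> oU H x Ux j; have E y : U y -> g j y = partial j f y.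
  by move=> Uy; have [[_ <-] _] := H y Uy j.
split; first by rewrite -E //; case: (H x Ux j).
apply: (near_eq_continuous_for (f := g j)); last by case: (H x Ux j).
near=> y; apply: E; near: y; exact: open_nbhs_nbhs.
Unshelve. all: by end_near. Qed.

Lemma C1_fun_elementary (U : set vec) f : elementary f -> C1_fun U f.
Proof.
move=> sf x _ j; have [sp dp] := elementary_partial j sf.
by split; [exact: dp | exact: elementary_continuous].
Qed.

Lemma C1_fun_coord (U : set vec) (w : vec -> vec) c : open U -> C1_on U w ->
  C1_fun U (fun x => w x 0 c).
Proof.
move=> oU [dw cw]; apply: (C1_fun_intro (g := fun j x => partial j w x 0 c)) => // x Ux j.
split.
  have dwj := dw x Ux j; apply: DeriveDef; first by move/derivable_mxP : dwj.
  by rewrite /partial derive_mx // mxE.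
apply: (@continuous_comp _ _ _ (partial j w) (fun y : vec => y 0 c)).
  by apply: cw; rewrite inE.
exact: coord_continuous.
Qed.

Lemma rV_norm_ltP (v : vec) r : 0 < r -> (`|v| < r) <-> (forall j, `|v 0 j| < r).
Proof.
move=> r0; rewrite /Num.Def.normr/= mx_normrE; split=> [H j|H].
  by apply: le_lt_trans H; exact: (le_bigmax _ (fun ij : 'I_1 * 'I_n => `|v ij.1 ij.2|) (0, j)).
apply/bigmax_ltP; split=> // -[i j] _ /=; rewrite [i]ord1; exact: H.
Qed.

Lemma rV_norm_leP (v : vec) r : 0 <= r -> (`|v| <= r) <-> (forall j, `|v 0 j| <= r).
Proof.
move=> r0; rewrite /Num.Def.normr/= mx_normrE; split=> [H j|H].
  by apply: le_trans H; exact: (le_bigmax _ (fun ij : 'I_1 * 'I_n => `|v ij.1 ij.2|) (0, j)).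
apply/bigmax_leP; split=> // -[i j] _ /=; rewrite [i]ord1; exact: H.
Qed.

Lemma rV_coord_le (v : vec) j : `|v 0 j| <= `|v|.
Proof. exact: (rV_norm_leP v (normr_ge0 v)).1. Qed.

Lemma rV_nbhs_dist (x : vec) r : 0 < r -> nbhs x [set y | `|y - x| < r].
Proof.
move=> r0; apply/(@nbhs_normP _ _ x); exists r => // y /=.
by rewrite distrC.
Qed.

(** The conditions [|s| <= |t|] and [0 <= s * t] describe the segment from 0 to [t] whatever the
    sign of [t]. *)
Lemma partial_mvt (f : vec -> R) (df : vec -> R) x j (t : R) :
  (forall s, `|s| <= `|t| -> 0 <= s * t ->
     is_derive (s *: e_ j + x) (e_ j) f (df (s *: e_ j + x))) ->
  exists2 s, `|s| <= `|t| /\ 0 <= s * t & f (t *: e_ j + x) - f x = t * df (s *: e_ j + x).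
Proof.
move=> H; pose g (s : R) := f (s *: e_ j + x).
have dg s : `|s| <= `|t| /\ 0 <= s * t -> is_derive s (1 : R) g (df (s *: e_ j + x)).
  by move=> [st s0]; apply/is_derive_line; exact: H.
have gE : f (t *: e_ j + x) - f x = g t - g 0 by rewrite /g scale0r add0r.
have cont a b : (forall s, a <= s <= b -> `|s| <= `|t| /\ 0 <= s * t) -> {within `[a, b], continuous g}.
  move=> hab; apply: derivable_within_continuous => s; rewrite in_itv /= => sab.
  by case: (dg s (hab s sab)).
have der a b : (forall s, a <= s <= b -> `|s| <= `|t| /\ 0 <= s * t) ->
    forall s, s \in `]a, b[%R -> is_derive s (1:R) g (df (s *: e_ j + x)).
  move=> hab s; rewrite in_itv /= => /andP[s1 s2].
  by apply: dg; apply: hab; rewrite !ltW.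
rewrite gE; have [t0|t0] := leP 0 t.
  have hab s : 0 <= s <= t -> `|s| <= `|t| /\ 0 <= s * t.
    by move=> /andP[s0 st]; rewrite !ger0_norm // mulr_ge0.
  have [s] := MVT_segment t0 (der _ _ hab) (cont _ _ hab).
  by rewrite in_itv /= => /hab st ->; exists s; rewrite // subr0 mulrC.
have hab s : t <= s <= 0 -> `|s| <= `|t| /\ 0 <= s * t.
  by move=> /andP[s0 st]; rewrite !ler0_norm ?lerN2 ?(ltW t0) // mulr_le0 ?(ltW t0).
have [s] := MVT_segment (ltW t0) (der _ _ hab) (cont _ _ hab).
rewrite in_itv /= => /hab st E; exists s => //.
by rewrite -opprB E sub0r mulrN opprK mulrC.
Qed.

(** Switch on the coordinates of [h] one after the other; by the mean value theorem each switch
    costs at most [eps] times its size. The sup norm keeps all intermediate points within [r] of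
    [x]. *)
Lemma partial_increment (f : vec -> R) x r eps : 0 < r ->
  (forall y j, `|y - x| < r -> is_derive y (e_ j) f (partial j f y) /\
     `|partial j f y - partial j f x| <= eps) ->
  forall h, `|h| < r ->
  `|f (h + x) - f x - \sum_j h 0 j * partial j f x| <= eps * \sum_j `|h 0 j|.
Proof.
move=> r0 H h hr.
pose pre l : vec := \row_j (if (j < l)%N then h 0 j else 0).
have Hl l : (l <= n)%N -> `|f (pre l + x) - f x - \sum_(j < n | (j < l)%N) h 0 j * partial j f x|
    <= eps * \sum_(j < n | (j < l)%N) `|h 0 j|.
  elim: l => [_|l IH ln].
    rewrite !big_pred0 // mulr0 subr0; suff -> : pre 0%N = 0 by rewrite add0r subrr normr0.
    by apply/rowP => j; rewrite !mxE.
  pose i := Ordinal ln.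
  have preS : pre l.+1 = h 0 i *: e_ i + pre l.
    apply/rowP => j; rewrite !mxE eqxx /=.
    have [->|ji] := eqVneq j i; first by rewrite /= ltnSn ltnn mulr1 addr0.
    by rewrite mulr0 add0r ltnS leq_eqVlt -[_ == l]/(_ == val i) val_eqE (negbTE ji).
  have sumS (F : 'I_n -> R) : \sum_(j < n | (j < l.+1)%N) F j =
      F i + \sum_(j < n | (j < l)%N) F j.
    rewrite (bigD1 i) //=; congr (_ + _); apply: eq_bigl => j.
    by rewrite ltnS [RHS]ltn_neqAle andbC -[j == l :> nat]/(j == val i :> nat) val_eqE.
  rewrite !sumS mulrDr preS -(addrA (h 0 i *: e_ i)).
  have near s : `|s| <= `|h 0 i| -> `|s *: e_ i + (pre l + x) - x| < r.
    move=> sh; rewrite addrA addrK; apply/rV_norm_ltP => // j; rewrite !mxE eqxx /=.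
    have [->|ji] := eqVneq j i.
      by rewrite mulr1 /= ltnn addr0; apply: le_lt_trans sh _; exact: le_lt_trans (rV_coord_le _ _) hr.
    rewrite mulr0 add0r; case: ifP => _; last by rewrite normr0.
    exact: le_lt_trans (rV_coord_le _ _) hr.
  have [|s [sh _] E] := @partial_mvt f (partial i f) (pre l + x) i (h 0 i).
    by move=> s /near/(H _ i)[] ? _ _.
  have := (H _ i (near s sh)).2; set D := partial i f (_ + _) => DE.
  have -> : f (h 0 i *: e_ i + (pre l + x)) - f x - (h 0 i * partial i f x +
     \sum_(j < n | (j < l)%N) h 0 j * partial j f x) = h 0 i * (D - partial i f x) +
     (f (pre l + x) - f x - \sum_(j < n | (j < l)%N) h 0 j * partial j f x).
    by rewrite mulrBr -E; ring.
  apply: le_trans (ler_normD _ _) _; apply: lerD; last exact: (IH (ltnW ln)).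
  by rewrite normrM mulrC ler_wpM2r.
have := Hl n (leqnn n).
rewrite (eq_bigl xpredT) => [|j]; last by rewrite ltn_ord.
rewrite [X in _ <= _ * X](eq_bigl xpredT) => [|j]; last by rewrite ltn_ord.
by suff -> : pre n = h by []; apply/rowP => j; rewrite mxE ltn_ord.
Qed.

Lemma C1_fun_near (U : set vec) f x eps : open U -> U x -> C1_fun U f -> 0 < eps ->
  exists2 r, 0 < r & forall y j, `|y - x| < r -> is_derive y (e_ j) f (partial j f y) /\
     `|partial j f y - partial j f x| <= eps.
Proof.
move=> oU Ux cf e0.
have : \forall y \near x, U y /\ forall j, `|partial j f x - partial j f y| <= eps.
  near=> y; split; first by near: y; exact: open_nbhs_nbhs.
  move=> j; move: j; near: y; apply: filter_forall => j.
  have [_ cj] := cf x Ux j.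
  by move/cvgrPdist_le : cj => /(_ _ e0).
rewrite -nbhs_nearE => /nbhs_normP[r /= r0 H]; exists r => // y j yx.
have [Uy Hy] : U y /\ forall j, `|partial j f x - partial j f y| <= eps.
  by apply: H; rewrite /= distrC.
by split; [case: (cf y Uy j)| rewrite distrC].
Unshelve. all: by end_near. Qed.

Lemma C1_fun_continuous (U : set vec) f x : open U -> C1_fun U f -> U x ->
  {for x, continuous f}.
Proof.
move=> oU cf Ux; have [r r0 H] := C1_fun_near oU Ux cf ltr01.
pose C := 1 + \sum_j `|partial j f x|.
have C0 : 0 < C by rewrite ltr_pwDl // sumr_ge0.
have nC0 : 0 < n.+1%:R * C by rewrite mulr_gt0.
rewrite /prop_for /continuous_at; apply/(@cvgrPdist_le _ _ _ (nbhs x)) => e e0; near=> y.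
have yr : `|y - x| < r by near: y; exact: (@rV_nbhs_dist x).
have := partial_increment r0 H yr; rewrite subrK mul1r => K.
rewrite distrC; apply: le_trans (_ : \sum_(j < n) C * `|y - x| <= _).
  rewrite -[f y - f x](subrK (\sum_j (y - x) 0 j * partial j f x)).
  apply: le_trans (ler_normD _ _) _; rewrite /C.
  under [leRHS]eq_bigr do rewrite mulrDl mul1r.
  rewrite big_split /= lerD //; first by apply: le_trans K _; apply: ler_sum => j _; exact: rV_coord_le.
  apply: le_trans (ler_norm_sum _ _ _) _; apply: ler_sum => j _.
  rewrite normrM mulrC ler_pM ?rV_coord_le //.
  by rewrite (bigD1 j) //= lerDl sumr_ge0.
apply: le_trans (_ : n.+1%:R * C * `|y - x| <= _).
  by rewrite sumr_const card_ord -[X in X <= _]mulr_natl mulrA ler_wpM2r // ler_pM2r // ler_nat.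
rewrite mulrC -ler_pdivlMr // ltW //; near: y.
by apply: (@rV_nbhs_dist x); exact: divr_gt0.
Unshelve. all: by end_near. Qed.

(** [C1_on] provides derivatives along the axes only, whereas [lie] differentiates in the directions
    [w x]; continuity of the partial derivatives bridges the gap. *)
Lemma C1_fun_is_derive (U : set vec) f x v : open U -> C1_fun U f -> U x ->
  is_derive x v f (\sum_j v 0 j * partial j f x).
Proof.
move=> oU cf Ux; apply/is_deriveP/cvgrPdist_le => e e0.
pose C := 1 + \sum_j `|v 0 j|.
have C0 : 0 < C by rewrite ltr_pwDl // sumr_ge0.
have [r r0 H] := C1_fun_near oU Ux cf (divr_gt0 e0 C0).
near=> h; have h0 : h != 0 by near: h; exact: nbhs_dnbhs_neq.
have hr : `|h *: v| < r.
  rewrite normrZ; apply: le_lt_trans (_ : `|h| * (`|v| + 1) < _).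
    by rewrite ler_wpM2l // lerDl.
  rewrite -ltr_pdivlMr ?ltr_wpDl //.
  by near: h; apply: dnbhs0_lt; rewrite divr_gt0 // ltr_wpDl.
have := partial_increment r0 H hr => K.
have hn : 0 < `|h| by rewrite normr_gt0.
rewrite -(ler_pM2l hn) -normrM mulrBr distrC /GRing.scale /= mulVKf //.
apply: le_trans (_ : e / C * \sum_j `|(h *: v) 0 j| <= _).
  move: K; congr (`|_ - _| <= _); rewrite mulr_sumr; apply: eq_bigr => j _.
  by rewrite mxE mulrA.
under eq_bigr do rewrite mxE normrM.
rewrite -mulr_sumr mulrCA ler_pM2l // -mulrA ler_piMr ?(ltW e0) //.
by rewrite mulrC ler_pdivrMr // mul1r /C lerDr.
Unshelve. all: by end_near. Qed.

End C1Functions.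

Section C1Algebra.
Context {R : realType} {n : nat}.
Notation vec := 'rV[R]_n.
Variables (U : set vec) (oU : open U).

Lemma C1_fun_cst c : C1_fun U (fun=> c).
Proof. exact/C1_fun_elementary/elementary_cst. Qed.

Lemma C1_fun_add f g : C1_fun U f -> C1_fun U g -> C1_fun U (fun x => f x + g x).
Proof.
move=> cf cg; apply: (C1_fun_intro (g := fun j x => partial j f x + partial j g x)) => // x Ux j.
have [df pf] := cf x Ux j; have [dg pg] := cg x Ux j; split.
  exact: (is_deriveD df dg).
exact: (@continuousD _ _ _ (partial j f) (partial j g)).
Qed.

Lemma C1_fun_mul f g : C1_fun U f -> C1_fun U g -> C1_fun U (fun x => f x * g x).
Proof.
move=> cf cg; apply: (C1_fun_intro (g := fun j x => f x * partial j g x + g x * partial j f x)) => // x Ux j.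
have [df pf] := cf x Ux j; have [dg pg] := cg x Ux j; split.
  exact: (is_deriveM df dg).
apply: (@continuousD _ _ _ (fun x => f x * partial j g x) (fun x => g x * partial j f x)).
  by apply: (@continuousM _ _ f (partial j g)) => //; exact: C1_fun_continuous cf Ux.
by apply: (@continuousM _ _ g (partial j f)) => //; exact: C1_fun_continuous cg Ux.
Qed.

Lemma C1_fun_opp f : C1_fun U f -> C1_fun U (fun x => - f x).
Proof.
move=> cf; under eq_fun do rewrite -mulN1r; apply: C1_fun_mul => //; exact: C1_fun_cst.
Qed.

Lemma C1_fun_sum (I : Type) (r : seq I) (P : pred I) (F : I -> vec -> R) :
  (forall i, C1_fun U (F i)) -> C1_fun U (fun x => \sum_(i <- r | P i) F i x).
Proof.
move=> cF; elim: r => [|i r IH].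
  by under eq_fun do rewrite big_nil; exact: C1_fun_cst.
under eq_fun do rewrite big_cons; case: (P i); [exact: C1_fun_add | exact: IH].
Qed.

Lemma C1_fun_prod (I : Type) (r : seq I) (P : pred I) (F : I -> vec -> R) :
  (forall i, C1_fun U (F i)) -> C1_fun U (fun x => \prod_(i <- r | P i) F i x).
Proof.
move=> cF; elim: r => [|i r IH].
  by under eq_fun do rewrite big_nil; exact: C1_fun_cst.
under eq_fun do rewrite big_cons; case: (P i); [exact: C1_fun_mul | exact: IH].
Qed.

Lemma C1_fun_det m (M : vec -> 'M[R]_m) : (forall i j, C1_fun U (fun x => M x i j)) ->
  C1_fun U (fun x => \det (M x)).
Proof.
move=> cM; rewrite /determinant; apply: C1_fun_sum => s; apply: C1_fun_mul; first exact: C1_fun_cst.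
by apply: C1_fun_prod => i; exact: cM.
Qed.

Lemma C1_fun_adj m (M : vec -> 'M[R]_m) i j : (forall i j, C1_fun U (fun x => M x i j)) ->
  C1_fun U (fun x => \adj (M x) i j).
Proof.
move=> cM; under eq_fun do rewrite mxE /cofactor.
apply: C1_fun_mul; first exact: C1_fun_cst.
by apply: C1_fun_det => a b; under eq_fun do rewrite !mxE; exact: cM.
Qed.

Lemma C1_fun_mulmx a b c (M : vec -> 'M[R]_(a, b)) (N : vec -> 'M[R]_(b, c)) :
  (forall i j, C1_fun U (fun x => M x i j)) -> (forall i j, C1_fun U (fun x => N x i j)) ->
  forall i j, C1_fun U (fun x => (M x *m N x) i j).
Proof.
move=> cM cN i j; under eq_fun do rewrite mxE.
by apply: C1_fun_sum => l; exact: C1_fun_mul.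
Qed.

Lemma C1_fun_trmx a b (M : vec -> 'M[R]_(a, b)) :
  (forall i j, C1_fun U (fun x => M x i j)) -> forall i j, C1_fun U (fun x => (M x)^T i j).
Proof. by move=> cM i j; under eq_fun do rewrite mxE; exact: cM. Qed.

End C1Algebra.

(** * Compactness and uniform continuity on boxes *)

Section Boxes.
Context {R : realType} {n : nat}.
Notation vec := 'rV[R]_n.

Definition cbox (a b : vec) : set vec := [set x | forall i, a 0 i <= x 0 i <= b 0 i].
Definition obox (a b : vec) : set vec := [set x | forall i, a 0 i < x 0 i < b 0 i].

Lemma cbox_compact a b : compact (cbox a b).
Proof.
have := @rV_compact _ n (fun i => `[a 0 i, b 0 i]%classic : set R) (fun i => @segment_compact _ _ _).
congr compact; apply/seteqP; split=> x /= H i; have := H i; by rewrite in_itv.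
Qed.

Lemma cbox_closed a b : closed (cbox a b).
Proof. exact: compact_closed (@cbox_compact a b). Qed.

Lemma obox_sub a b : obox a b `<=` cbox a b.
Proof. by move=> x H i; case/andP: (H i) => /ltW -> /ltW ->. Qed.

Lemma obox_open a b : open (obox a b).
Proof.
rewrite openE => x Hx; rewrite /interior.
have : \forall y \near x, forall i, a 0 i < (y : vec) 0 i < b 0 i.
  apply: (@filter_forall _ _ (fun i (y : vec) => a 0 i < y 0 i < b 0 i) (nbhs x)) => i; have ci := @coord_continuous R 1 n 0 i x.
  have : nbhs (x 0 i) `]a 0 i, b 0 i[%classic.
    by apply: open_nbhs_nbhs; split; [exact: itv_open | rewrite /= in_itv; exact: Hx].
  by move=> /ci; apply: (@filterS _ (nbhs x)) => y /=; rewrite in_itv.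
by [].
Qed.

Lemma bounded_on_compact (K : set vec) (f : vec -> R) : compact K ->
  (forall x, K x -> {for x, continuous f}) -> exists C : R, 0 < C /\ forall x, K x -> `|f x| <= C.
Proof.
move=> cK cf; have : compact (f @` K).
  apply: continuous_compact => //; apply: continuous_in_subspaceT => x.
  by rewrite inE; exact: cf.
move/compact_bounded => [M [_ HM]]; exists (`|M| + 1); split=> [|x Kx].
  by rewrite ltr_wpDl.
apply: (HM (`|M| + 1)); last by exists x.
by apply: le_lt_trans (ler_norm M) _; rewrite ltrDl.
Qed.

Lemma uniform_on_compact (K : set vec) (f : vec -> R) eps : compact K -> 0 < eps ->
  (forall x, K x -> {for x, continuous f}) ->
  exists2 delta, 0 < delta & forall x y, K x -> `|y - x| < delta -> `|f y - f x| <= eps.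
Proof.
move=> cK e0 cf.
have /compact_near_coveringP/(_ R (0 : R)^'+ (fun d x => forall y, `|y - x| < d -> `|f y - f x| <= eps)) H := cK.
have : \forall d \near (0:R)^'+, K `<=` (fun x => forall y, `|y - x| < d -> `|f y - f x| <= eps).
  apply: H => x Kx.
  have e2 : 0 < eps / 2 by rewrite divr_gt0.
  have /cvgrPdist_le/(_ _ e2) := cf x Kx.
  move=> /nbhs_normP[r /= r0 Hr].
  have r2 : 0 < r / 2 by rewrite divr_gt0.
  exists ([set y | `|y - x| < r / 2], [set d | 0 < d < r / 2]) => /=.
    split; first exact: rV_nbhs_dist.
    near=> d; apply/andP; split; near: d; [exact: nbhs_right_gt | exact: nbhs_right_lt].
  move=> [z d] /= [zx /andP[d0 dr]] y yz.
  have hz : `|f x - f z| <= eps / 2.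
    apply: Hr => /=; rewrite distrC; apply: lt_trans zx _.
    by rewrite ltr_pdivrMr // ltr_pMr // ltr1n.
  have hy : `|f x - f y| <= eps / 2.
    apply: Hr => /=; rewrite distrC -(subrK z y) -addrA.
    apply: le_lt_trans (ler_normD _ _) _; rewrite (splitr r) ltrD //.
    exact: lt_trans yz dr.
  rewrite (splitr eps) -(subrK (f x) (f y)) -addrA.
  by apply: le_trans (ler_normD _ _) _; apply: lerD => //; rewrite distrC.
move=> Hd; near (0 : R)^'+ => d; exists d => // x y Kx.
have : K `<=` (fun x => forall y, `|y - x| < d -> `|f y - f x| <= eps) by near: d.
by move=> /(_ x Kx); exact.
Unshelve. all: by end_near. Qed.

End Boxes.

(** * Bernstein approximation in C^1 *)

Section Bernstein.
Context {R : realType}.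
Implicit Types (m : nat) (phi psi : nat -> R) (x : R).

(* [bern m phi x] is the expectation of [phi S] where [S] is a sum of [m]
   independent Bernoulli variables of parameter [x]. *)
Fixpoint bern m phi x : R :=
  if m is m'.+1 then (1 - x) * bern m' phi x + x * bern m' (phi \o succn) x
  else phi 0%N.

Lemma bernD m phi psi x :
  bern m (fun j => phi j + psi j) x = bern m phi x + bern m psi x.
Proof.
elim: m phi psi => //= m IH phi psi.
by rewrite IH (IH (phi \o succn) (psi \o succn)) !mulrDr addrACA.
Qed.

Lemma bernZ m c phi x : bern m (fun j => c * phi j) x = c * bern m phi x.
Proof.
elim: m phi => //= m IH phi.
by rewrite IH (IH (phi \o succn)) mulrDr mulrCA [c * (x * _)]mulrCA.
Qed.

Lemma bern_cst m c x : bern m (fun=> c) x = c.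
Proof.
elim: m => //= m IH; have -> : (fun=> c) \o succn = (fun=> c) :> (nat -> R) by [].
by rewrite IH -mulrDl subrK mul1r.
Qed.

Lemma ler_bern m phi psi x : 0 <= x <= 1 ->
  (forall j, (j <= m)%N -> phi j <= psi j) -> bern m phi x <= bern m psi x.
Proof.
move=> x01; have [x0 x1] := andP x01; elim: m phi psi => /= [|m IH] phi psi H.
  exact: H.
apply: lerD; apply: ler_wpM2l; rewrite ?subr_ge0 //; apply: IH => j jm; apply: H => //.
exact: leqW.
Qed.

Lemma bern_norm_le m phi c x : 0 <= x <= 1 ->
  (forall j, (j <= m)%N -> `|phi j| <= c) -> `|bern m phi x| <= c.
Proof.
move=> x01 H; rewrite ler_norml; apply/andP; split.
  by rewrite -(bern_cst m (- c) x); apply: ler_bern => // j /H; rewrite ler_norml => /andP[].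
by rewrite -(bern_cst m c x); apply: ler_bern => // j /H; rewrite ler_norml => /andP[].
Qed.

Lemma bernB m phi psi x :
  bern m phi x - bern m psi x = bern m (fun j => phi j - psi j) x.
Proof.
rewrite (bernD m phi (fun j => - psi j)); congr (_ + _).
rewrite -mulN1r -bernZ; congr (bern m _ x); apply/funext => j.
by rewrite mulN1r.
Qed.

(** The offset [y] is kept free because the recursion shifts it by one; at the mean [m x] only the
    variance is left. *)
Lemma bern_variance m x y :
  bern m (fun j => (j%:R - y) ^+ 2) x = m%:R * (x * (1 - x)) + (m%:R * x - y) ^+ 2.
Proof.
elim: m y => [|m IH] y /=; first by ring.
rewrite IH.
have -> : (fun j => (j%:R - y) ^+ 2) \o succn = (fun j : nat => (j%:R - (y - 1)) ^+ 2 : R).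
  by apply/funext => j /=; rewrite -natr1; ring.
by rewrite IH -natr1; ring.
Qed.

(** Chebyshev's argument: nodes far from the mean pay a quadratic penalty, whose expectation is [K]
    times the variance, at most [K m]. *)
Lemma bern_approx m phi x L eps K : 0 <= x <= 1 -> 0 <= K ->
  (forall j, (j <= m)%N -> `|phi j - L| <= eps + K * (j%:R - m%:R * x) ^+ 2) ->
  `|bern m phi x - L| <= eps + K * m%:R.
Proof.
move=> x01 K0 H; have [x0 x1] := andP x01.
have V : bern m (fun j => eps + K * (j%:R - m%:R * x) ^+ 2) x <= eps + K * m%:R.
  rewrite (bernD m (fun=> eps)) bern_cst bernZ bern_variance subrr expr0n addr0.
  rewrite lerD2l ler_wpM2l // ler_piMr // mulr_ile1 ?subr_ge0 //.
  by rewrite gerBl.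
rewrite -[in bern m phi x - L](bern_cst m L x) bernB ler_norml; apply/andP; split.
  rewrite lerNl; apply: le_trans V; rewrite -mulN1r -bernZ.
  apply: ler_bern => // j /H; rewrite ler_norml mulN1r => /andP[+ _].
  by rewrite lerNl.
by apply: le_trans V; apply: ler_bern => // j /H; rewrite ler_norml => /andP[].
Qed.

(** The coefficients may vary with the point, as they will be functions of the other variables.
    Moving the parameter contributes forward differences in degree one less, as for classical
    Bernstein polynomials. *)
Lemma is_derive_bern (V : normedModType R) m (phi dphi : nat -> V -> R) (tau : V -> R)
    (dtau : R) (v x : V) :
  (forall j, is_derive x v (phi j) (dphi j x)) -> is_derive x v tau dtau ->
  is_derive x v (fun y => bern m (phi ^~ y) (tau y))
    (bern m (dphi ^~ x) (tau x) +
     m%:R * bern m.-1 (fun j => phi j.+1 x - phi j x) (tau x) * dtau).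
Proof.
move=> + dt; elim: m phi dphi => [|m IH] phi dphi dp.
  by rewrite mul0r mul0r addr0; exact: dp.
have d1 := IH _ _ dp; have d2 := IH (fun j => phi j.+1) (fun j => dphi j.+1) (fun j => dp j.+1).
have dc : is_derive x v (fun y => 1 - tau y) (- dtau).
  apply: (is_derive_eq (is_deriveB (is_derive_cst (1 : R) x v) dt)).
  by rewrite sub0r.
apply: (is_derive_eq (is_deriveD (is_deriveM dc d1) (is_deriveM dt d2))).
rewrite /GRing.scale /=.
set B := bern m (phi ^~ x) (tau x).
rewrite -[bern m ((phi ^~ x) \o succn) _]/(bern m (fun j => phi j.+1 x) (tau x)).
set B' := bern m (fun j => phi j.+1 x) (tau x).
have EB : bern m (fun j => phi j.+1 x - phi j x) (tau x) = B' - B by rewrite /B' /B bernB.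
case: m {IH d1 d2} @B @B' EB => [|m] B B' EB /=.
  by rewrite /B /B' /=; ring.
set C := bern m (fun j => phi j.+1 x - phi j x) (tau x).
set C' := bern m (fun j => phi j.+2 x - phi j.+1 x) (tau x).
have E : B' = B + ((1 - tau x) * C + tau x * C').
  by rewrite -[LHS](subrK B) -EB addrC.
set D1 := bern m (fun j => dphi j.+1 x) (tau x).
set D2 := bern m ((fun j => dphi j.+1 x) \o succn) (tau x).
by rewrite E -[m.+2%:R]natr1; ring.
Qed.

End Bernstein.

(** * Freezing one coordinate *)

Section CoordSubst.
Context {R : realType} {n : nat}.
Notation vec := 'rV[R]_n.
Notation e_ := (@ebase R n).
Variable i : 'I_n.

(** Written as a point on a line of direction [e_ i], so that changing [s] is a translation
    ([csubst_add]) and the mean value theorem applies. *)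
Definition csubst (s : R) (x : vec) : vec := s *: e_ i + (x - x 0 i *: e_ i).

Lemma csubstE s x j : csubst s x 0 j = if j == i then s else x 0 j.
Proof.
rewrite !mxE eqxx /=; have [->|_] := eqVneq j i; first by rewrite !mulr1 subrr addr0.
by rewrite !mulr0 add0r subr0.
Qed.

Lemma csubst_line s h x : csubst s (h *: e_ i + x) = csubst s x.
Proof.
apply/rowP => j; rewrite !csubstE !mxE.
by case: eqVneq => // ji; rewrite mulr0 add0r.
Qed.

Lemma csubst_line_ne s h x l : l != i ->
  csubst s (h *: e_ l + x) = h *: e_ l + csubst s x.
Proof.
move=> li; apply/rowP => j; rewrite csubstE [in RHS]mxE csubstE !mxE eqxx /=.
by have [->|//] := eqVneq j i; rewrite eq_sym (negbTE li) mulr0 add0r.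
Qed.

Lemma csubst_add s h x : h *: e_ i + csubst s x = csubst (h + s) x.
Proof. by rewrite /csubst addrA scalerDl. Qed.

Lemma csubst_continuous s : continuous (csubst s).
Proof.
move=> x; apply/(@cvgrPdist_le _ _ _ (nbhs x)) => e e0; near=> y.
apply/rV_norm_leP => [|j]; first exact: ltW.
have -> : (csubst s x - csubst s y) 0 j = csubst s x 0 j - csubst s y 0 j.
  by rewrite mxE [X in _ + X]mxE.
rewrite !csubstE; case: eqP => _; first by rewrite subrr normr0 ltW.
have -> : x 0 j - y 0 j = - (y - x) 0 j by rewrite !mxE opprB.
rewrite normrN; apply: le_trans (rV_coord_le _ _) _; rewrite ltW //.
Unshelve. all: by end_near. Qed.

Lemma csubst_cbox s (a b x : vec) : cbox a b x -> a 0 i <= s <= b 0 i -> cbox a b (csubst s x).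
Proof. by move=> bx sab j; rewrite csubstE; case: eqP => // ->. Qed.

Lemma C1_fun_csubst (U : set vec) (g : vec -> R) s : open U -> C1_fun U g ->
  let U' := csubst s @^-1` U in [/\ open U', C1_fun U' (g \o csubst s) &
    forall x l, U' x -> partial l (g \o csubst s) x =
      if l == i then 0 else partial l g (csubst s x)].
Proof.
move=> oU cg U'; have oU' : open U'.
  by apply: open_comp => // x _; exact: csubst_continuous.
have d x l : U' x -> is_derive x (e_ l) (g \o csubst s)
    (if l == i then 0 else partial l g (csubst s x)).
  move=> Ux; apply/is_derive_line0; have [->|li] := eqVneq l i.
    have -> : (fun h : R => (g \o csubst s) (h *: e_ i + x)) = cst (g (csubst s x)).
      by apply/funext => h; rewrite /= csubst_line.
    exact: is_derive_cst.
  have -> : (fun h : R => (g \o csubst s) (h *: e_ l + x)) = (fun h : R => g (h *: e_ l + csubst s x)).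
    by apply/funext => h; rewrite /= csubst_line_ne.
  by apply/is_derive_line0; case: (cg _ Ux l).
split=> //; last by move=> x l Ux; case: (d x l Ux).
apply: (C1_fun_intro (g := fun l x => if l == i then 0 else partial l g (csubst s x))) => // x Ux l.
split; first exact: d.
case: eqP => _; first exact: cst_continuous.
apply: (@continuous_comp _ _ _ (csubst s) (partial l g)); first exact: csubst_continuous.
by case: (cg _ Ux l).
Qed.

End CoordSubst.

Section BernsteinBox.
Context {R : realType} {n : nat}.
Notation vec := 'rV[R]_n.
Notation e_ := (@ebase R n).
Variables (a b : vec) (hab : forall i, a 0 i < b 0 i) (i : 'I_n).
Let ell := b 0 i - a 0 i.
Let ell0 : 0 < ell. Proof. by rewrite subr_gt0. Qed.
Let tau (x : vec) := (x 0 i - a 0 i) / ell.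

Lemma tau01 x : cbox a b x -> 0 <= tau x <= 1.
Proof.
move=> /(_ i)/andP[ax xb]; rewrite /tau ler_pdivrMr // mul1r lerD2r xb andbT.
by apply: divr_ge0; [rewrite subr_ge0 | exact: ltW].
Qed.

(** The nodes may deviate by [ell / m] from the uniform ones, because the derivative of a Bernstein
    polynomial will be compared with partial derivatives at mean value points. *)
Lemma bern_cbox (f : vec -> R) (eps : R) : 0 < eps ->
  (forall x, cbox a b x -> {for x, continuous f}) ->
  exists N, forall m (xi : nat -> R) x, (N <= m)%N -> (0 < m)%N -> cbox a b x ->
   (forall j, (j <= m)%N -> a 0 i <= xi j <= b 0 i /\
      `|xi j - (a 0 i + ell * (j%:R / m%:R))| <= ell / m%:R) ->
   `|bern m (fun j => f (csubst i (xi j) x)) (tau x) - f x| <= eps.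
Proof.
move=> e0 cf; have e2 : 0 < eps / 2 by rewrite divr_gt0.
have [M [M0 HM]] := bounded_on_compact (@cbox_compact R n a b) cf.
have [d d0 Hd] := uniform_on_compact (@cbox_compact R n a b) e2 cf.
(* Far nodes satisfy [d / 2 <= ell / m * |j - m tau|], so the crude bound [2 M] is at most
   [8 M / d^2] times the square of the right-hand side, which is [K / m^2] times the squared
   distance to the mean. *)
pose K := 8 * M * ell ^+ 2 / d ^+ 2.
have K0 : 0 < K by rewrite divr_gt0 ?mulr_gt0 ?exprn_gt0.
(* [N1] makes the deviation [ell / m] at most [d / 2]; [N2] makes the variance term [K / m] at most
   [eps / 2]. *)
pose N1 := Num.bound (2 * ell / d); pose N2 := Num.bound (2 * K / eps).
exists (N1 + N2)%N => m xi x Nm m0 bx Hxi.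
have p1 : 0 < 2 * ell / d by apply: divr_gt0 => //; exact: mulr_gt0.
have p2 : 0 < 2 * K / eps by apply: divr_gt0 => //; exact: mulr_gt0.
have mR : 0 < m%:R :> R by rewrite ltr0n.
have p3 : 0 <= K / m%:R ^+ 2 by apply: divr_ge0; rewrite ?exprn_ge0 // ltW.
have p4 : 0 <= ell / m%:R by apply: divr_ge0; exact: ltW.
have p5 : 0 <= 8 * M / d ^+ 2 by apply: divr_ge0; rewrite ?exprn_ge0 // ?mulr_ge0 // ltW.
have h1 : 2 * ell / d <= m%:R.
  apply: le_trans (ltW (archi_boundP _)) _; first exact: ltW.
  by rewrite ler_nat; apply: leq_trans Nm; exact: leq_addr.
have h2 : 2 * K / eps <= m%:R.
  apply: le_trans (ltW (archi_boundP _)) _; first exact: ltW.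
  by rewrite ler_nat; apply: leq_trans Nm; exact: leq_addl.
have xE : x 0 i = a 0 i + ell * tau x.
  by rewrite /tau mulrCA divff ?gt_eqF // mulr1 subrKC.
apply: le_trans (_ : eps / 2 + K / m%:R ^+ 2 * m%:R <= _); last first.
  rewrite [leRHS](splitr eps) lerD2l.
  have -> : K / m%:R ^+ 2 * m%:R = K / m%:R by field; rewrite gt_eqF.
  rewrite ler_pdivrMr //; have h3 : 2 * K <= m%:R * eps by rewrite -ler_pdivrMr.
  by lra.
apply: bern_approx; first exact: tau01.
  exact: p3.
move=> j jm; have [xij xid] := Hxi j jm.
have by' := csubst_cbox bx xij.
have nE : (csubst i (xi j) x - x) = (xi j - x 0 i) *: e_ i.
  by rewrite /csubst; apply/rowP => l; rewrite !mxE; ring.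
have [lt|ge] := ltP `|xi j - x 0 i| d.
  apply: le_trans (Hd x _ bx _) _; last first.
    by rewrite lerDl mulr_ge0 // sqr_ge0.
  rewrite nE; apply/rV_norm_ltP => // l; rewrite !mxE eqxx /=.
  by case: eqP; rewrite ?mulr1 ?mulr0 ?normr0.
apply: le_trans (_ : 2 * M <= _).
  rewrite mulr2n mulrDl mul1r; apply: le_trans (ler_normB _ _) _.
  by rewrite lerD ?HM.
apply: ler_wpDl; first exact: ltW.
have far : d / 2 <= ell / m%:R * `|j%:R - m%:R * tau x|.
  have -> : ell / m%:R * `|j%:R - m%:R * tau x| = `|a 0 i + ell * (j%:R / m%:R) - x 0 i|.
    rewrite xE -{1}(ger0_norm p4) -normrM; congr (`|_|).
    by field; rewrite gt_eqF.
  have : `|xi j - x 0 i| <= `|xi j - (a 0 i + ell * (j%:R / m%:R))| + `|a 0 i + ell * (j%:R / m%:R) - x 0 i|.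
    by apply: le_trans (ler_normD _ _); rewrite addrA subrK.
  have : ell / m%:R <= d / 2.
    rewrite ler_pdivrMr // -ler_pdivrMl ?divr_gt0 //.
    by have -> : (d / 2)^-1 * ell = 2 * ell / d by field; rewrite gt_eqF.
  by lra.
have : (d / 2) ^+ 2 <= (ell / m%:R * `|j%:R - m%:R * tau x|) ^+ 2.
  by rewrite lerXn2r // nnegrE; [exact/ltW/divr_gt0 | exact: mulr_ge0].
rewrite [leRHS]exprMn real_normK ?num_real // => far2.
have -> : 2 * M = 8 * M / d ^+ 2 * (d / 2) ^+ 2 by field; rewrite gt_eqF.
have -> : K / m%:R ^+ 2 * (j%:R - m%:R * tau x) ^+ 2 =
    8 * M / d ^+ 2 * ((ell / m%:R) ^+ 2 * (j%:R - m%:R * tau x) ^+ 2).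
  by rewrite /K; field; rewrite !gt_eqF.
exact: ler_wpM2l.
Qed.

End BernsteinBox.

Lemma ler_dist_trans (R : realType) (u v w A B : R) :
  `|u - v| <= A -> `|v - w| <= B -> `|u - w| <= A + B.
Proof.
by move=> h1 h2; rewrite -(subrK v u) -addrA; apply: le_trans (ler_normD _ _) _; exact: lerD.
Qed.

(** * Approximation in C^1, one variable at a time *)

Section C1Approx.
Context {R : realType} {n : nat}.
Notation vec := 'rV[R]_n.
Notation e_ := (@ebase R n).
Variables (a b : vec) (hab : forall i, a 0 i < b 0 i).

Lemma elementary_bern m (p : nat -> vec -> R) (tau : vec -> R) :
  (forall j, elementary (p j)) -> elementary tau -> elementary (fun x => bern m (p ^~ x) (tau x)).
Proof.
move=> + st; elim: m p => [|m IH] p sp /=; first exact: sp.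
apply: elementary_add; apply: elementary_mul => //.
- apply: (@elementary_add _ _ (fun=> 1) (fun x => - tau x)); first exact: elementary_cst.
  by under eq_fun do rewrite -mulN1r; apply: elementary_mul => //; exact: elementary_cst.
- exact: IH.
- exact: (IH (fun j => p j.+1)).
Qed.

(** Variable [i] is handled by a Bernstein sum whose coefficients [g (csubst i (node j) x)] no
    longer depend on it. The tolerance [delta] is fixed before the approximations [p] of the
    coefficients, since differentiating along [i] multiplies their errors by the degree. *)
Lemma C1_approx_step (i : 'I_n) (U : set vec) (g : vec -> R) (eps : R) :
  open U -> cbox a b `<=` U -> C1_fun U g -> 0 < eps ->
  exists (node : nat -> R) (delta : R), [/\ 0 < delta, forall j, a 0 i <= node j <= b 0 i &
    forall p : nat -> vec -> R, (forall j, elementary (p j)) ->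
    (forall j x, cbox a b x -> `|p j x - g (csubst i (node j) x)| <= delta /\
      forall l, `|partial l (p j) x - partial l (g \o csubst i (node j)) x| <= delta) ->
    exists q, elementary q /\ forall x, cbox a b x -> `|q x - g x| <= eps /\
      forall l, `|partial l q x - partial l g x| <= eps].
Proof.
move=> oU bU cg e0.
pose ell := b 0 i - a 0 i.
have ell0 : 0 < ell by rewrite subr_gt0.
have e2 : 0 < eps / 2 by rewrite divr_gt0.
have [N HN] := bern_cbox hab i e2 (fun x bx => C1_fun_continuous oU cg (bU x bx)).
have H l := bern_cbox hab i e2 (fun x bx => (cg x (bU x bx) l).2).
have [N' HN'] := choice H.
pose m := (N + \sum_l N' l).+1.
have m0 : 0 < m%:R :> R by rewrite ltr0n.
have mS0 : 0 < m.+1%:R :> R by rewrite ltr0n.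
have Nm : (N <= m.+1)%N by rewrite /m -addnS leqW // leq_addr.
have N'm l : (N' l <= m)%N.
  by rewrite /m leqW // (bigD1 l) //= addnCA leq_addr.
pose tau (x : vec) := (x 0 i - a 0 i) / ell.
(* The minimum keeps every node in the box, even beyond the degree. *)
pose node (j : nat) := a 0 i + ell * ((minn j m.+1)%:R / m.+1%:R).
(* Coefficient errors enter once through their own partial derivatives and, along [i], twice in each
   forward difference, which is scaled by [m.+1 / ell]. *)
pose D := 1 + 2 * (m.+1%:R / ell).
have r0 : 0 < m.+1%:R / ell by exact: divr_gt0.
have D0 : 0 < D by rewrite /D; lra.
pose d := eps / 2 / D.
have d0 : 0 < d by exact: divr_gt0.
have dD : d + 2 * (m.+1%:R / ell) * d = eps / 2.
  by rewrite -{1}[d]mul1r -mulrDl -/D mulrC /d divfK // gt_eqF.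
have dle : d <= eps / 2 by rewrite -dD lerDl; apply: mulr_ge0; [lra | exact: ltW].
have nodeab j : a 0 i <= node j <= b 0 i.
  rewrite /node lerDl mulr_ge0 ?divr_ge0 ?(ltW ell0) ?(ltW mS0) //=.
  rewrite -lerBrDl -/ell ler_piMr ?(ltW ell0) //.
  by rewrite ler_pdivrMr // mul1r ler_nat geq_minr.
have nodeE j : (j <= m.+1)%N -> node j = a 0 i + ell * (j%:R / m.+1%:R).
  by move=> jm; rewrite /node (minn_idPl jm).
have nodeab' j : (j <= m.+1)%N -> a 0 i <= node j <= b 0 i /\
    `|node j - (a 0 i + ell * (j%:R / m.+1%:R))| <= ell / m.+1%:R.
  by move=> jm; split=> //; rewrite nodeE // subrr normr0; apply: divr_ge0; exact: ltW.
exists node, d; split=> // p sp Hp.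
have stau : elementary tau.
  apply: (@elementary_mul _ _ (fun x => x 0 i - a 0 i) (fun=> ell^-1)); last exact: elementary_cst.
  by apply: (@elementary_add _ _ (fun x : vec => x 0 i) (fun=> - a 0 i)); [exact: elementary_coord | exact: elementary_cst].
have dtau x l : is_derive x (e_ l) tau ((l == i)%:R / ell).
  have -> : tau = ell^-1 \*: (fun y : vec => y 0 i : R) + cst (- (a 0 i / ell)).
    by apply/funext => y; rewrite /tau mulrBl mulrC.
  apply: (is_derive_eq (is_deriveD (is_deriveZ ell^-1 (is_derive_coord x (e_ l) i)) (is_derive_cst _ _ _))).
  by rewrite addr0 mxE eqxx /= /GRing.scale /= mulrC eq_sym.
pose q x := bern m.+1 (p ^~ x) (tau x).
have dq x l : partial l q x = bern m.+1 (fun j => partial l (p j) x) (tau x) +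
   m.+1%:R * bern m (fun j => p j.+1 x - p j x) (tau x) * ((l == i)%:R / ell).
  have dp j : is_derive x (e_ l) (p j) (partial l (p j) x) by exact: (elementary_partial l (sp j)).2.
  by have [_] := is_derive_bern m.+1 (dphi := fun j => partial l (p j)) dp (dtau x l).
exists q; split; first exact: elementary_bern.
move=> x bx; have t01 := tau01 hab i bx.
have cU j : U (csubst i (node j) x) by apply: bU; exact: csubst_cbox.
split=> [|l].
  apply: le_trans (_ : d + eps / 2 <= _); last by rewrite [leRHS](splitr eps) lerD2r.
  apply: (ler_dist_trans _ (HN m.+1 node x Nm (ltn0Sn m) bx nodeab')).
  by rewrite bernB; apply: bern_norm_le => // j _; case: (Hp j x bx).
have pE j : partial l (g \o csubst i (node j)) x =
    if l == i then 0 else partial l g (csubst i (node j) x).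
  by have [_ _] := C1_fun_csubst i (node j) oU cg; apply; exact: cU.
rewrite dq; have [li|li] := eqVneq l i; last first.
  rewrite mul0r mulr0 addr0.
  apply: le_trans (_ : d + eps / 2 <= _); last by rewrite [leRHS](splitr eps) lerD2r.
  apply: (ler_dist_trans _ (HN' l m.+1 node x (leqW (N'm l)) (ltn0Sn m) bx nodeab')).
  rewrite bernB; apply: bern_norm_le => // j _; have [_ /(_ l)] := Hp j x bx.
  by rewrite pE (negbTE li).
subst l; rewrite mul1r.
(* Difference quotients of [g] between consecutive nodes of degree [m.+1] are partial derivatives at
   points [xi j]. Since [j / m] lies between [j / m.+1] and [j.+1 / m.+1], these points are
   admissible nodes for degree [m]. *)
have [xi Hxi] : exists xi : nat -> R, forall j, (j <= m)%N ->
    (a 0 i <= xi j <= b 0 i /\ `|xi j - (a 0 i + ell * (j%:R / m%:R))| <= ell / m%:R) /\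
    g (csubst i (node j.+1) x) - g (csubst i (node j) x) =
    ell / m.+1%:R * partial i g (csubst i (xi j) x).
  suff /choice[xi Hxi] : forall j, exists xi : R, (j <= m)%N ->
    (a 0 i <= xi <= b 0 i /\ `|xi - (a 0 i + ell * (j%:R / m%:R))| <= ell / m%:R) /\
    g (csubst i (node j.+1) x) - g (csubst i (node j) x) =
    ell / m.+1%:R * partial i g (csubst i xi x) by exists xi.
  move=> j.
  have [jm|] := leqP j m; last by exists 0.
  pose t := ell / m.+1%:R.
  have t0 : 0 < t by exact: divr_gt0.
  have nodeS : node j.+1 = t + node j.
    have jS : j.+1%:R = j%:R + 1 :> R by rewrite natr1.
    by rewrite (nodeE j.+1) // (nodeE j (leqW jm)) jS /t; ring.
  have st s : `|s| <= `|t| -> 0 <= s * t -> 0 <= s <= t.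
    by rewrite pmulr_lge0 // => + s0; rewrite !ger0_norm ?s0 // ltW.
  have sab s : 0 <= s <= t -> a 0 i <= s + node j <= b 0 i.
    move=> /andP[s0 st']; case/andP: (nodeab j) => na _.
    case/andP: (nodeab j.+1) => _; rewrite nodeS => nb; apply/andP; split.
      exact: ler_wpDl.
    by apply: le_trans nb; rewrite lerD2r.
  have [s s1 s2|s [s1 s2] E] := @partial_mvt _ _ g (partial i g) (csubst i (node j) x) i t.
    rewrite csubst_add; apply: (cg _ _ i).1; apply: bU; apply: csubst_cbox => //.
    by apply: sab; exact: st.
  have s01 := st s s1 s2; exists (s + node j) => _.
  rewrite nodeS -csubst_add E csubst_add; split=> //; split; first exact: sab.
  case/andP: s01 => s0 s1'; rewrite (nodeE j (leqW jm)).
  have j0 : 0 <= j%:R :> R by [].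
  have jm' : j%:R <= m%:R :> R by rewrite ler_nat.
  have mSE : m.+1%:R = m%:R + 1 :> R by rewrite natr1.
  have q1 : ell * (j%:R / m.+1%:R) <= ell * (j%:R / m%:R).
    rewrite ler_pM2l // ler_wpM2l // lef_pV2 // mSE; lra.
  have q2 : ell * (j%:R / m%:R) <= t + ell * (j%:R / m.+1%:R).
    have -> : t + ell * (j%:R / m.+1%:R) = ell * ((1 + j%:R) / m.+1%:R) by rewrite /t; ring.
    rewrite ler_pM2l // ler_pdivrMr // mulrAC ler_pdivlMr // mSE.
    by rewrite mulrDr mulrDl mulr1 mul1r addrC lerD2r.
  have q3 : t <= ell / m%:R by rewrite /t ler_pM2l // lef_pV2 // mSE; lra.
  move: q1 q2 q3; set A := ell * (j%:R / m.+1%:R); set B := ell * (j%:R / m%:R).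
  set C := ell / m%:R => q1 q2 q3; rewrite ler_norml; apply/andP.
  by clearbody t A B C; split; lra.
rewrite (splitr eps) -{1}dD.
have -> : bern m.+1 (fun j => partial i (p j) x) (tau x) +
   m.+1%:R * bern m (fun j => p j.+1 x - p j x) (tau x) / ell - partial i g x =
   bern m.+1 (fun j => partial i (p j) x) (tau x) +
   (bern m (fun j => m.+1%:R / ell * (p j.+1 x - p j x)) (tau x) - partial i g x).
  by rewrite bernZ; ring.
rewrite -[d + _ + _]addrA; apply: le_trans (ler_normD _ _) _; apply: lerD.
  apply: bern_norm_le => // j _; have [_ /(_ i)] := Hp j x bx.
  by rewrite pE eqxx subr0.
apply: (ler_dist_trans _ (HN' i m xi x (N'm i) (ltn0Sn _) bx (fun j jm => (Hxi j jm).1))).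
rewrite bernB; apply: bern_norm_le => // j jm.
have [_ E] := Hxi j jm.
have -> : partial i g (csubst i (xi j) x) =
    m.+1%:R / ell * (g (csubst i (node j.+1) x) - g (csubst i (node j) x)).
  by rewrite E; field; rewrite !gt_eqF.
rewrite -mulrBr normrM gtr0_norm // [2 * _]mulrC -[_ * 2 * d]mulrA ler_pM2l //.
have -> : p j.+1 x - p j x - (g (csubst i (node j.+1) x) - g (csubst i (node j) x)) =
  (p j.+1 x - g (csubst i (node j.+1) x)) - (p j x - g (csubst i (node j) x)) by ring.
rewrite mulrDl mul1r; apply: le_trans (ler_normB _ _) _.
by apply: lerD; [case: (Hp j.+1 x bx) | case: (Hp j x bx)].
Qed.

(** Induction on the number of variables on which [g] depends: freezing one coordinate removes it,
    at the price of replacing [U] by a preimage. *)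
Lemma C1_approx_vars k (U : set vec) (g : vec -> R) (eps : R) : (k <= n)%N ->
  open U -> cbox a b `<=` U -> C1_fun U g ->
  (forall x y : vec, (forall l : 'I_n, (l < k)%N -> x 0 l = y 0 l) -> g x = g y) -> 0 < eps ->
  exists p, elementary p /\ forall x, cbox a b x -> `|p x - g x| <= eps /\
    forall l, `|partial l p x - partial l g x| <= eps.
Proof.
elim: k U g eps => [|k IH] U g eps kn oU bU cg gk e0.
  have -> : g = fun=> g 0 by apply/funext => x; exact: gk.
  exists (fun=> g 0); split; first exact: elementary_cst.
  by move=> x _; split=> [|l]; rewrite subrr normr0 ltW.
pose i : 'I_n := Ordinal kn.
have [node [d [d0 hnode Hstep]]] := C1_approx_step i oU bU cg e0.
have /choice[p Hp] : forall j, exists p, elementary p /\ forall x, cbox a b x ->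
    `|p x - g (csubst i (node j) x)| <= d /\
    forall l, `|partial l p x - partial l (g \o csubst i (node j)) x| <= d.
  move=> j; have [oU' cg' _] := C1_fun_csubst i (node j) oU cg.
  apply: (IH _ (g \o csubst i (node j)) d (ltnW kn) oU' _ cg' _ d0).
    by move=> x bx; apply: bU; exact: csubst_cbox.
  move=> x y xy /=; apply: gk => l; rewrite ltnS leq_eqVlt !csubstE.
  rewrite -[l == k :> nat]/(val l == val i) val_eqE.
  by case: eqP => //= _; exact: xy.
by apply: (Hstep p) => [j|j]; [exact: (Hp j).1 | exact: (Hp j).2].
Qed.

Lemma C1_approx (U : set vec) (g : vec -> R) (eps : R) :
  open U -> cbox a b `<=` U -> C1_fun U g -> 0 < eps ->
  exists p, elementary p /\ forall x, cbox a b x -> `|p x - g x| <= eps /\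
    forall l, `|partial l p x - partial l g x| <= eps.
Proof.
move=> oU bU cg e0; apply: (C1_approx_vars (leqnn n) oU bU cg) => // x y xy.
by congr g; apply/rowP => l; exact: xy.
Qed.

End C1Approx.

(** * Test forms supported in boxes *)

Section BasicForm.
Context {R : realType} {n h : nat}.
Notation vec := 'rV[R]_n.
Notation e_ := (@ebase R n).
Variables (c : 'I_n) (I : {set 'I_n}) (g : vec -> R).
Hypotheses (cI : #|I| = h) (cnI : c \notin I) (sg : elementary g).
Let K := c |: I.
Let s : R := (-1) ^+ index c (enum K).

Let cK : #|K| = h.+1. Proof. by rewrite cardsU1 cnI cI. Qed.

(* the form [g dx_c /\ dx_I] *)
Definition basic_form (x : vec) : mvec R n :=
  [ffun J : {set 'I_n} => if J == K then s * g x else 0].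

Lemma basic_form_test (Om Q : set vec) : compact Q -> Q `<=` Om ->
  (forall x, ~ Q x -> g x = 0) -> test_form Om h.+1 basic_form.
Proof.
move=> cQ QOm g0.
have sub : [set x | basic_form x != 0] `<=` Q.
  move=> x; apply: contraPP => /g0 gx; apply/negP/negPn/eqP/ffunP => J.
  by rewrite !ffunE gx mulr0; case: ifP.
have clQ : closure [set x | basic_form x != 0] `<=` Q.
  by have /closure_id -> := compact_closed (@norm_hausdorff _ _) cQ; exact: closureS.
split=> [x J cJ|].
  by rewrite ffunE; case: eqP => // JK; move: cJ; rewrite JK cK eqxx.
split=> [J|].
  apply: elementary_smooth; under eq_fun do rewrite ffunE.
  by case: (J == K); [apply: elementary_mul => //; exact: elementary_cst | exact: elementary_cst].
split; last exact: subset_trans clQ QOm.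
exact: subclosed_compact (@closed_closure _ _) cQ clQ.
Qed.

Lemma basic_form_pairing (x : vec) (u : mvec R n) :
  pairing h.+1 (basic_form x) u = g x * contr u c I.
Proof.
rewrite /pairing (bigD1 K) ?cK //= big1 => [|J /andP[_ JK]].
  by rewrite ffunE eqxx addr0 /contr (negbTE cnI) -/K -/s mulrAC mulrC.
by rewrite ffunE (negbTE JK) mul0r.
Qed.

(** The signs of [extd] and of coordinate [K] are those of moving [j] and then [c] to the front, so
    they are absorbed by the order of the columns; for [j] in [K] the minor repeats a column. *)
Lemma basic_form_extd (x : vec) (vs : 'I_h.+2 -> vec) :
  pairing h.+2 (extd basic_form x) (wedge vs) =
  \sum_j partial j g x * minor (\matrix_i vs i) (j :: c :: enum I).
Proof.
have dE j J : partial j (fun y => basic_form y J) x = if J == K then s * partial j g x else 0.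
  under eq_fun do rewrite ffunE.
  case: (J == K); last by rewrite /partial derive_cst.
  have [_ /(_ x) dg] := elementary_partial j sg.
  have [_] := is_deriveM (is_derive_cst s x (e_ j)) dg.
  rewrite /GRing.scale /= mulr0 addr0; exact.
rewrite /pairing.
transitivity (\sum_(J : {set 'I_n} | #|J| == h.+2) \sum_(j in J)
   (if J :\ j == K then (-1) ^+ index j (enum J) * (s * partial j g x) else 0) * wedge vs J).
  apply: eq_bigr => J _; rewrite ffunE mulr_suml; apply: eq_bigr => j _.
  by rewrite dE; case: ifP => // _; rewrite mulr0.
rewrite (exchange_big_dep xpredT) //=; apply: eq_bigr => j _.
have [jK|jK] := boolP (j \in K).
  rewrite big1 => [|J /andP[_ jJ]]; last first.
    case: eqP => [E|_]; last by rewrite mul0r.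
    by move: jK; rewrite -E !inE eqxx.
  rewrite minor_not_uniq ?mulr0 //= -?cardE ?cI //.
  by move: jK; rewrite !inE mem_enum => /orP[->|->] //; rewrite orbT.
have cJ : #|j |: K| = h.+2 by rewrite cardsU1 jK cK.
rewrite (bigD1 (j |: K)) /=; last by rewrite cJ eqxx setU11.
rewrite finset.setU1K // eqxx big1 ?addr0 => [|J /andP[/andP[_ jJ] JK]]; last first.
  case: eqP => [E|_]; last by rewrite mul0r.
  by move: JK; rewrite -E finset.setD1K // eqxx.
have -> : minor (\matrix_i vs i) [:: j, c & enum I] = s * minor (\matrix_i vs i) (j :: enum K).
  by rewrite (@minor_insert _ _ _ _ [:: j] c I) ?cI.
rewrite (@minor_insert _ _ _ _ [::] j K) ?cK // wedgeE cJ eqxx /=.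
by ring.
Qed.

End BasicForm.

(** * Cutoffs tending to the indicator of an open box *)

Section Bump.
Context {R : realType} {n : nat}.
Notation vec := 'rV[R]_n.
Variables (a b : vec).

(** Inside the box every factor tends to 1 as [m] grows, outside some factor is exactly 0, and all
    values stay between 0 and 1, as dominated convergence requires. *)
Definition boxbump (m : nat) (x : vec) : R :=
  \prod_i (expinv 0 (m.+1%:R * (x 0 i - a 0 i)) * expinv 0 (m.+1%:R * (b 0 i - x 0 i))).

Lemma elementary_boxbump m : elementary (boxbump m).
Proof.
apply: elementary_prod => i; apply: elementary_mul.
  by under eq_fun do rewrite mulrBr; exact: elementary_expinv.
by under eq_fun do rewrite mulrBr addrC -mulNr; exact: elementary_expinv.
Qed.

Lemma expinv0_le1 (t : R) : expinv 0 t <= 1.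
Proof.
rewrite /expinv; case: ifP => // t0.
by rewrite expr0 invr1 mul1r -expR0 ler_expR oppr_le0 invr_ge0 ltW.
Qed.

Lemma expinv0_le0 (t : R) : t <= 0 -> expinv 0 t = 0.
Proof. by move=> t0; rewrite /expinv ltNge t0. Qed.

Lemma boxbump_ge0 m x : 0 <= boxbump m x.
Proof. by apply: prodr_ge0 => i _; apply: mulr_ge0; exact: expinv_ge0. Qed.

Lemma boxbump_le1 m x : boxbump m x <= 1.
Proof.
apply: prodr_ile1 => i _; apply/andP; split; first by apply: mulr_ge0; exact: expinv_ge0.
by apply: mulr_ile1; rewrite ?expinv_ge0 ?expinv0_le1.
Qed.

Lemma boxbump_out m x : ~ obox a b x -> boxbump m x = 0.
Proof.
move=> /existsNP[i /negP]; rewrite negb_and -!leNgt => H.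
rewrite /boxbump (bigD1 i) //=; suff -> : expinv 0 (m.+1%:R * (x 0 i - a 0 i)) *
    expinv 0 (m.+1%:R * (b 0 i - x 0 i)) = 0 by rewrite mul0r.
case/orP: H => H; [rewrite expinv0_le0 ?mul0r // | rewrite [X in _ * X]expinv0_le0 ?mulr0 //];
  by rewrite pmulr_rle0 // subr_le0.
Qed.

Lemma expinv0_cvg (t : R) : 0 < t -> expinv 0 (m.+1%:R * t) @[m --> \oo] --> (1 : R).
Proof.
move=> t0; under eq_fun => m do rewrite /expinv mulr_gt0 // expr0 invr1 mul1r invfM.
suff : expR (- (m.+1%:R^-1 * t^-1)) @[m --> \oo] --> expR (- (0 * t^-1)) by rewrite mul0r oppr0 expR0.
apply: continuous_cvg; first exact: continuous_expR.
apply: cvgN; apply: cvgM; last exact: cvg_cst.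
exact: cvg_harmonic.
Qed.

Lemma boxbump_cvg x : boxbump m x @[m --> \oo] --> ((x \in obox a b)%:R : R).
Proof.
have [xin|xout] := boolP (x \in obox a b); last first.
  suff -> : boxbump ^~ x = (fun=> 0) by exact: cvg_cst.
  by apply/funext => m; apply: boxbump_out; move: xout; rewrite notin_setE.
have -> : true%:R = \prod_(i <- index_enum 'I_n) 1 :> R by rewrite big1.
have xi i : a 0 i < x 0 i < b 0 i by move/set_mem: xin; exact.
rewrite /boxbump; elim: (index_enum _) => [|i r IH].
  by under eq_fun => m do rewrite big_nil; rewrite big_nil; exact: cvg_cst.
under eq_fun => m do rewrite big_cons; rewrite big_cons -[X in X * _]mulr1.
case/andP: (xi i) => h1 h2; apply: cvgM; last exact: IH.
by apply: cvgM; apply: expinv0_cvg; rewrite subr_gt0.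
Qed.

End Bump.

Section BorelMeasurability.
Context {R : realType} {n : nat}.
Notation vec := 'rV[R]_n.
Notation T := (borel R n).

Lemma borel_open (U : set vec) : open U -> measurable (U : set T).
Proof. by move=> oU; exact: sub_sigma_algebra. Qed.

Lemma borel_closed (Q : set vec) : closed Q -> measurable (Q : set T).
Proof.
move=> cQ; rewrite -(setCK Q); apply: (@measurableC _ T); apply: borel_open.
exact: closed_openC.
Qed.

Lemma borel_continuous (U : set vec) (f : vec -> R) : open U ->
  (forall x, U x -> {for x, continuous f}) -> measurable_fun (U : set T) (f : T -> R).
Proof.
move=> oU cf mU; apply: (measurability _ (measurable_realfun.RGenOInfty.measurableE R)) => //.
move=> /= _ [_ [y ->] <-]; apply: borel_open; rewrite openE => x [Ux fx].
rewrite /interior; have cfx := cf x Ux.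
have : nbhs (f x) `]y, +oo[%classic.
  by apply: open_nbhs_nbhs; split; [exact: interval_open | exact: fx].
move/cfx => fy; apply: (@filterI _ (nbhs x)); last exact: fy.
exact: open_nbhs_nbhs.
Qed.

End BorelMeasurability.

Section RintegralBounds.
Context {d : measure_display} {T : measurableType d} {R : realType}.
Variable nu : {finite_measure set T -> \bar R}.

Lemma bounded_integrable (Q : set T) (f : T -> R) C : measurable Q ->
  measurable_fun Q f -> (forall x, Q x -> `|f x| <= C) -> nu.-integrable Q (EFin \o f).
Proof.
move=> mQ mf fC; apply: (le_integrable mQ (g := EFin \o cst C)).
- exact/measurable_EFinP.
- by move=> x Qx /=; rewrite lee_fin; apply: le_trans (fC x Qx) (ler_norm _).
- exact: finite_measure_integrable_cst.
Qed.

Lemma Rintegral_norm_le (Q : set T) (f : T -> R) C : measurable Q ->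
  nu.-integrable Q (EFin \o f) -> (forall x, Q x -> `|f x| <= C) ->
  `|\int[nu]_(x in Q) f x| <= C * fine (nu Q).
Proof.
move=> mQ fi fC; apply: le_trans (le_normr_Rintegral mQ fi) _.
rewrite -Rintegral_cst //; apply: le_Rintegral => //.
  by apply: (integrable_norm fi).
exact: finite_measure_integrable_cst.
Qed.

Lemma Rintegral_sum (Q : set T) (I : Type) (r : seq I) (F : I -> T -> R) : measurable Q ->
  (forall i, nu.-integrable Q (EFin \o F i)) ->
  nu.-integrable Q (EFin \o (fun x => \sum_(i <- r) F i x)) /\
  \int[nu]_(x in Q) (\sum_(i <- r) F i x) = \sum_(i <- r) \int[nu]_(x in Q) F i x.
Proof.
move=> mQ iF; elim: r => [|i r [IH1 IH2]].
  have -> : (fun x => \sum_(i <- [::]) F i x) = cst 0 by apply/funext => x; rewrite big_nil.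
  split; first exact: finite_measure_integrable_cst.
  by rewrite big_nil Rintegral_cst // mul0r.
have E : (fun x => \sum_(j <- i :: r) F j x) = (fun x => F i x + \sum_(j <- r) F j x).
  by apply/funext => x; rewrite big_cons.
rewrite E big_cons; split.
  exact: (integrableD mQ (iF i) IH1).
by rewrite RintegralD // IH2.
Qed.

End RintegralBounds.

(** * The boundary identity on boxes *)

Section CurrentIdentity.
Context {R : realType} {n h : nat}.
Notation vec := 'rV[R]_n.
Notation T := (borel R n).
Variables (Om : set vec) (oOm : open Om) (vs : 'I_h.+2 -> vec -> vec).
Hypothesis hvs : forall i, C1_on Om (vs i).
Variables (m1 m2 m' : {finite_measure set T -> \bar R}) (tau : vec -> mvec R n).
Hypothesis htaum : forall I, measurable_fun [set: T] (fun x => tau x I).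
Hypothesis htaui : (\int[m']_x (mvnorm (tau x))%:E < +oo)%E.
Hypothesis hbd : forall om : vec -> mvec R n, test_form Om h.+1 om ->
  (\int[m1]_x (pairing h.+2 (extd om x) (wedge (fun i => vs i x)))%:E -
   \int[m2]_x (pairing h.+2 (extd om x) (wedge (fun i => vs i x)))%:E)%E =
  (\int[m']_x (pairing h.+1 (om x) (tau x))%:E)%E.

Definition vminor (j c : 'I_n) (I : {set 'I_n}) (x : vec) : R :=
  minor (\matrix_i vs i x) (j :: c :: enum I).

Lemma C1_fun_vminor j c (I : {set 'I_n}) : #|I| = h -> C1_fun Om (vminor j c I).
Proof.
move=> cI; apply: C1_fun_det => // a b.
under eq_fun => x do rewrite (@colseqE _ _ _ _ _ c) ?mxE //= -?cardE ?cI //.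
exact: C1_fun_coord.
Qed.

Lemma contr_integrable c I : m'.-integrable [set: T] (EFin \o (fun x : T => contr (tau x) c I)).
Proof.
refine (le_integrable (@measurableT _ T) (g := EFin \o (fun x : T => mvnorm (tau x))) _ _ _).
- apply/measurable_EFinP; rewrite /contr; case: (c \in I); first exact: measurable_cst.
  by apply: measurable_funM; [exact: measurable_cst | exact: htaum].
- move=> x _ /=; rewrite lee_fin [leRHS]ger0_norm ?sqrtr_ge0 // /contr.
  case: ifP => _; first by rewrite normr0 sqrtr_ge0.
  rewrite normrM normrX normrN1 expr1n mul1r -sqrtr_sqr ler_sqrt; last first.
    by apply: sumr_ge0 => i _; exact: sqr_ge0.
  by rewrite (bigD1 (c |: I)) //= lerDl; apply: sumr_ge0 => i _; exact: sqr_ge0.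
apply/integrableP; split.
  apply/measurable_EFinP; rewrite /mvnorm.
  apply: (@measurableT_comp _ _ _ _ _ _ (@Num.sqrt R)).
    apply: continuous_measurable_fun; exact: sqrt_continuous.
  apply: measurable_sum => I'; exact: measurable_funX.
apply: le_lt_trans htaui; rewrite le_eqVlt; apply/orP; left; apply/eqP.
by apply: eq_integral => x _ /=; rewrite ger0_norm // sqrtr_ge0.
Qed.

Section OnBox.
Variables (a b : vec).
Let Q : set T := cbox a b.
Hypothesis QOm : cbox a b `<=` Om.

Let mQ : measurable Q. Proof. by apply: borel_closed; exact: cbox_closed. Qed.

Definition cont_on (F : vec -> R) := forall x, Om x -> {for x, continuous F}.

Lemma cont_on_C1_fun F : C1_fun Om F -> cont_on F.
Proof. by move=> cF x Ux; exact: C1_fun_continuous cF Ux. Qed.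

Lemma cont_on_add F G : cont_on F -> cont_on G -> cont_on (fun x => F x + G x).
Proof. by move=> cF cG x Ux; apply: (@continuousD _ _ _ F G); [exact: cF|exact: cG]. Qed.

Lemma cont_on_mul F G : cont_on F -> cont_on G -> cont_on (fun x => F x * G x).
Proof. by move=> cF cG x Ux; apply: (@continuousM _ _ F G); [exact: cF|exact: cG]. Qed.

Lemma cont_on_norm F : cont_on F -> cont_on (fun x => `|F x|).
Proof.
move=> cF x Ux; apply: (@continuous_comp _ _ _ F (@Num.norm _ R)); first exact: cF.
exact: norm_continuous.
Qed.

Lemma cont_on_sum (I : Type) (r : seq I) (F : I -> vec -> R) :
  (forall i, cont_on (F i)) -> cont_on (fun x => \sum_(i <- r) F i x).
Proof.
move=> cF; elim: r => [|i r IH].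
  by under eq_fun do rewrite big_nil; move=> x _; exact: cst_continuous.
under eq_fun do rewrite big_cons; exact: cont_on_add.
Qed.

Lemma cont_on_partial F j : C1_fun Om F -> cont_on (partial j F).
Proof. by move=> cF x Ux; exact: (cF x Ux j).2. Qed.

Lemma cont_on_bounded F : cont_on F -> exists C : R, 0 < C /\ forall x, Q x -> `|F x| <= C.
Proof.
move=> cF; apply: bounded_on_compact; first exact: cbox_compact.
by move=> x /QOm; exact: cF.
Qed.

Lemma cont_on_measurable F : cont_on F -> measurable_fun Q (F : T -> R).
Proof.
move=> cF; apply: (@measurable_funS _ _ _ _ (Om : set T)) => //; first exact: borel_open.
exact: borel_continuous.
Qed.

Lemma cont_on_integrable (nu : {finite_measure set T -> \bar R}) F : cont_on F ->
  nu.-integrable Q (EFin \o F).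
Proof.
move=> cF; have [C [C0 HC]] := cont_on_bounded cF.
refine (@bounded_integrable _ T R nu Q F C mQ (cont_on_measurable cF) _). exact: HC.
Qed.

Definition signed_Rint (F : T -> R) := \int[m1]_(x in Q) F x - \int[m2]_(x in Q) F x.

Lemma signed_Rint_sub F G : cont_on F -> cont_on G -> signed_Rint (fun x => F x - G x) = signed_Rint F - signed_Rint G.
Proof.
move=> cF cG; rewrite /signed_Rint !RintegralB //; try exact: cont_on_integrable.
by rewrite opprD opprK addrACA; congr (_ + _); rewrite opprB addrC.
Qed.

Lemma signed_Rint_sum (I : Type) (r : seq I) (F : I -> vec -> R) : (forall i, cont_on (F i)) ->
  signed_Rint (fun x => \sum_(i <- r) F i x) = \sum_(i <- r) signed_Rint (F i).
Proof.
move=> cF; rewrite /signed_Rint !(Rintegral_sum _ mQ (fun i => cont_on_integrable _ (cF i))).2.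
by rewrite sumrB.
Qed.

Lemma signed_Rint_bound F C : cont_on F -> (forall x, Q x -> `|F x| <= C) ->
  `|signed_Rint F| <= C * (fine (m1 Q) + fine (m2 Q)).
Proof.
move=> cF HC; apply: le_trans (ler_normB _ _) _; rewrite mulrDr.
by apply: lerD; apply: Rintegral_norm_le => //; exact: cont_on_integrable.
Qed.

Lemma signed_Rint_ext F G : (forall x, Q x -> F x = G x) -> signed_Rint F = signed_Rint G.
Proof. by move=> E; congr (_ - _); apply: eq_Rintegral => x /set_mem; exact: E. Qed.

Lemma contr_mul_integrable F c I : cont_on F ->
  m'.-integrable Q (EFin \o (fun x : T => F x * contr (tau x) c I)).
Proof.
move=> cF; have [C [C0 HC]] := cont_on_bounded cF.
have iT : m'.-integrable Q (EFin \o (fun x : T => contr (tau x) c I)).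
  by apply: integrableS (contr_integrable c I).
apply: (le_integrable mQ (g := EFin \o (fun x => C * contr (tau x) c I))).
- apply/measurable_EFinP; apply: measurable_funM; first exact: cont_on_measurable.
  by apply/measurable_EFinP; exact: measurable_int iT.
- move=> x Qx /=; rewrite lee_fin !normrM ler_wpM2r //.
  by apply: le_trans (HC x Qx) (ler_norm _).
exact: (integrableZl mQ C iT).
Qed.

Lemma partial_out (g : vec -> R) j x : (forall x, ~ Q x -> g x = 0) -> ~ Q x -> partial j g x = 0.
Proof.
move=> g0 Qx; have oC : open (~` cbox a b) by apply: closed_openC; exact: cbox_closed.
rewrite /partial -(near_eq_derive (f := cst 0)) ?derive_cst //.
near=> y; apply/esym/g0; near: y; exact: open_nbhs_nbhs.
Unshelve. all: by end_near. Qed.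

Lemma basic_identity c (I : {set 'I_n}) (g : vec -> R) : #|I| = h -> elementary g ->
  (forall x, ~ Q x -> g x = 0) ->
  signed_Rint (fun x => \sum_j partial j g x * vminor j c I x) =
  \int[m']_(x in Q) (g x * contr (tau x) c I).
Proof.
move=> cI sg g0; have [cin|cnI] := boolP (c \in I).
  (* For [c] in [I] there is no basic form, but both sides vanish: the minors repeat a column and
     [contr] is 0 by default. The later sums over all [c] rely on this case. *)
  rewrite (@signed_Rint_ext _ (fun=> 0)) => [|x _]; last first.
    apply: big1 => j _; rewrite /vminor minor_not_uniq ?mulr0 //= -?cardE ?cI //.
    by rewrite mem_enum cin andbF.
  rewrite /signed_Rint !Rintegral_cst // !mul0r subrr; apply/esym.
  under eq_Rintegral do rewrite /contr cin mulr0.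
  by rewrite Rintegral_cst // mul0r.
have okF : cont_on (fun x => \sum_j partial j g x * vminor j c I x).
  apply: cont_on_sum => j; apply: cont_on_mul; last exact/cont_on_C1_fun/C1_fun_vminor.
  exact/cont_on_partial/C1_fun_elementary.
have := hbd (basic_form_test cI cnI sg (@cbox_compact _ _ a b) QOm g0).
under eq_integral do rewrite basic_form_extd //.
under [X in (_ - X)%E = _]eq_integral do rewrite basic_form_extd //.
under [RHS]eq_integral do rewrite basic_form_pairing //.
have restr (nu : {finite_measure set T -> \bar R}) (F : T -> R) :
    (forall x, ~ Q x -> F x = 0) -> nu.-integrable Q (EFin \o F) ->
    (\int[nu]_x (F x)%:E)%E = (\int[nu]_(x in Q) F x)%:E.
  move=> F0 iF; rewrite /Rintegral fineK; last exact: integrable_fin_num.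
  rewrite [RHS]integral_mkcond; apply: eq_integral => x _; rewrite patchE.
  by case: ifPn => // /negP; rewrite inE => /F0 ->.
have F0 x : ~ Q x -> \sum_j partial j g x * vminor j c I x = 0.
  by move=> Qx; apply: big1 => j _; rewrite (partial_out _ g0 Qx) mul0r.
rewrite (restr m1 (fun x => \sum_j partial j g x * vminor j c I x)) //; last exact: cont_on_integrable.
rewrite (restr m2 (fun x => \sum_j partial j g x * vminor j c I x)) //; last exact: cont_on_integrable.
rewrite (restr m' (fun x => g x * contr (tau x) c I)).
- by move=> [].
- by move=> x /g0 ->; rewrite mul0r.
by apply: contr_mul_integrable; exact/cont_on_C1_fun/C1_fun_elementary.
Qed.

Hypothesis hab : forall i, a 0 i < b 0 i.

(** Both sides involve [al] only through its values and first partial derivatives on the box.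
    Replacing it by an elementary C^1 approximation [p], for which [basic_identity] applies to the
    product with [f], changes their difference by at most [eps * K]. *)
Lemma C1_identity c (I : {set 'I_n}) (f al : vec -> R) : #|I| = h -> elementary f ->
  (forall x, ~ Q x -> f x = 0) -> C1_fun Om al ->
  signed_Rint (fun x => \sum_j (partial j f x * al x + f x * partial j al x) * vminor j c I x) =
  \int[m']_(x in Q) (f x * al x * contr (tau x) c I).
Proof.
move=> cI sf f0 cal.
have okD j : cont_on (vminor j c I) by exact/cont_on_C1_fun/C1_fun_vminor.
have okfj j : cont_on (partial j f) by exact/cont_on_partial/C1_fun_elementary.
have okff : cont_on f by exact/cont_on_C1_fun/C1_fun_elementary.
have okal := cont_on_C1_fun cal; have okalj j : cont_on (partial j al) by exact: cont_on_partial cal.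
pose L (u : vec -> R) (du : 'I_n -> vec -> R) (x : vec) :=
  \sum_j (partial j f x * u x + f x * du j x) * vminor j c I x.
have okL u du : cont_on u -> (forall j, cont_on (du j)) -> cont_on (L u du).
  move=> ou od; apply: cont_on_sum => j; apply: cont_on_mul => //.
  by apply: cont_on_add; apply: cont_on_mul.
pose X := signed_Rint (L al (fun j => partial j al)) -
  \int[m']_(x in Q) (f x * al x * contr (tau x) c I).
suff X0 : X = 0 by apply/eqP; rewrite -subr_eq0; exact/eqP.
have okB : cont_on (fun x => \sum_j (`|partial j f x| + `|f x|) * `|vminor j c I x|).
  apply: cont_on_sum => j; apply: cont_on_mul; last exact: cont_on_norm.
  by apply: cont_on_add; exact: cont_on_norm.
have [B [B0 HB]] := cont_on_bounded okB.
pose KT := \int[m']_(x in Q) `|f x * contr (tau x) c I|.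
have ifT := contr_mul_integrable c I okff.
have KT0 : 0 <= KT by apply: Rintegral_ge0 => x _; exact: normr_ge0.
(* [B] bounds the factors of the approximation errors under [m1] and [m2]; [KT] does so for the
   boundary term. *)
pose K := B * (fine (m1 Q) + fine (m2 Q)) + KT.
have K0 : 0 <= K.
  by apply: addr_ge0 => //; apply: mulr_ge0; [exact: ltW | apply: addr_ge0; exact: fine_ge0].
suff HX (eps : R) : 0 < eps -> `|X| <= eps * K.
  apply/eqP; rewrite -normr_le0; apply/ler_addgt0Pr => e e0; rewrite add0r.
  have K1 : 0 < K + 1 by rewrite ltr_wpDl.
  apply: le_trans (HX (e / (K + 1)) _) _; first exact: divr_gt0.
  by rewrite -mulrA ler_piMr ?(ltW e0) // mulrC ler_pdivrMr // mul1r lerDl.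
move=> e0; have [p [sp Hp]] := C1_approx hab oOm QOm cal e0.
have okp : cont_on p by exact/cont_on_C1_fun/C1_fun_elementary.
have okpj j : cont_on (partial j p) by exact/cont_on_partial/C1_fun_elementary.
have fp0 x : ~ Q x -> f x * p x = 0 by move=> Qx; rewrite f0 ?mul0r.
have := basic_identity c cI (elementary_mul sf sp) fp0.
rewrite (@signed_Rint_ext _ (L p (fun j => partial j p))) => [id|x _]; last first.
  apply: eq_bigr => j _; congr (_ * _).
  have [_ /(_ x) df] := elementary_partial j sf; have [_ /(_ x) dp] := elementary_partial j sp.
  by have [_] := is_deriveM df dp; rewrite /GRing.scale /= addrC [p x * _]mulrC; exact.
have -> : X = signed_Rint (fun x => L al (fun j => partial j al) x - L p (fun j => partial j p) x) -
    \int[m']_(x in Q) (f x * al x * contr (tau x) c I - f x * p x * contr (tau x) c I).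
  rewrite signed_Rint_sub; [|exact: okL|exact: okL].
  rewrite RintegralB //; [|exact/contr_mul_integrable/cont_on_mul|exact/contr_mul_integrable/cont_on_mul].
  by rewrite id /X; ring.
rewrite /K mulrDr mulrA; apply: le_trans (ler_normB _ _) _; apply: lerD.
  apply: signed_Rint_bound => [|x Qx].
    move=> x Ux; apply: (@continuousB _ _ _ (L al (fun j => partial j al)) (L p (fun j => partial j p))).
      exact: okL.
    exact: okL.
  have [Hp1 Hp2] := Hp x Qx.
  rewrite /L -sumrB; apply: le_trans (ler_norm_sum _ _ _) _.
  apply: le_trans (_ : eps * (\sum_j (`|partial j f x| + `|f x|) * `|vminor j c I x|) <= _); last first.
    by rewrite ler_pM2l //; apply: le_trans (ler_norm _) (HB x Qx).
  rewrite mulr_sumr; apply: ler_sum => j _; rewrite -mulrBl normrM mulrA ler_wpM2r //.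
  have -> : partial j f x * al x + f x * partial j al x - (partial j f x * p x + f x * partial j p x) =
     - (partial j f x * (p x - al x) + f x * (partial j p x - partial j al x)) by ring.
  rewrite normrN [eps * _]mulrC [leRHS]mulrDl; apply: le_trans (ler_normD _ _) _.
  by rewrite !normrM; apply: lerD; apply: ler_wpM2l => //; exact: Hp2.
have iD : m'.-integrable Q (EFin \o (fun x : T => (f x * al x - f x * p x) * contr (tau x) c I)).
  apply: contr_mul_integrable => x Ux.
  by apply: (@continuousB _ _ _ (fun x => f x * al x) (fun x => f x * p x)); apply: cont_on_mul.
under eq_Rintegral do rewrite -mulrBl.
apply: le_trans (le_normr_Rintegral mQ iD) _.
rewrite -RintegralZl //; last exact: integrable_norm ifT.
apply: le_Rintegral => //.
- exact: integrable_norm iD.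
- exact: (integrableZl mQ eps (integrable_norm ifT)).
move=> x Qx; have [Hp1 _] := Hp x Qx.
rewrite -mulrBr -mulrA [(al x - p x) * _]mulrC mulrA normrM mulrC ler_wpM2r //.
by rewrite distrC.
Qed.

Definition dform (al : 'I_n -> vec -> R) (I : {set 'I_n}) (x : vec) : R :=
  \sum_c \sum_j partial j (al c) x * vminor j c I x.

Definition bform (al : 'I_n -> vec -> R) (I : {set 'I_n}) (x : vec) : R :=
  \sum_c al c x * contr (tau x) c I.

Lemma cont_on_dform al (I : {set 'I_n}) : #|I| = h -> (forall c, C1_fun Om (al c)) -> cont_on (dform al I).
Proof.
move=> cI cal; apply: cont_on_sum => c; apply: cont_on_sum => j; apply: cont_on_mul.
  exact: cont_on_partial (cal c).
exact/cont_on_C1_fun/C1_fun_vminor.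
Qed.

Lemma bform_integrable al (I : {set 'I_n}) : (forall c, C1_fun Om (al c)) ->
  m'.-integrable Q (EFin \o (fun x : T => bform al I x)).
Proof.
move=> cal; apply: (Rintegral_sum _ mQ _).1 => c.
exact/contr_mul_integrable/cont_on_C1_fun/cal.
Qed.

Lemma sum_identity (I : {set 'I_n}) (f : vec -> R) (al : 'I_n -> vec -> R) : #|I| = h ->
  elementary f -> (forall x, ~ Q x -> f x = 0) -> (forall c, C1_fun Om (al c)) ->
  (forall x j, Om x -> \sum_c al c x * vminor j c I x = 0) ->
  signed_Rint (fun x => f x * dform al I x) = \int[m']_(x in Q) (f x * bform al I x).
Proof.
move=> cI sf f0 cal al0.
have cont_on' : cont_on f by exact/cont_on_C1_fun/C1_fun_elementary.
transitivity (\sum_c \int[m']_(x in Q) (f x * al c x * contr (tau x) c I)); last first.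
  rewrite -(Rintegral_sum _ mQ _).2 => [|c]; last first.
    by apply: contr_mul_integrable; apply: cont_on_mul => //; exact/cont_on_C1_fun/cal.
  apply: eq_Rintegral => x _; rewrite mulr_sumr; apply: eq_bigr => c _.
  by rewrite mulrA.
under [RHS]eq_bigr do rewrite -(C1_identity _ cI sf f0 (cal _)).
rewrite -signed_Rint_sum => [|c]; last first.
  apply: cont_on_sum => j; apply: cont_on_mul; last exact/cont_on_C1_fun/C1_fun_vminor.
  apply: cont_on_add; apply: cont_on_mul => //; try exact/cont_on_C1_fun/cal.
    exact/cont_on_partial/C1_fun_elementary.
  exact: cont_on_partial (cal c).
apply: signed_Rint_ext => x Qx; rewrite /dform mulr_sumr.
(* The added sum collects the derivatives of [f]; it is zero because [al] contracts [v] to zero. *)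
transitivity (\sum_c (f x * (\sum_j partial j (al c) x * vminor j c I x)) +
   \sum_j partial j f x * \sum_c al c x * vminor j c I x).
  rewrite [X in _ = _ + X]big1 ?addr0 // => j _; rewrite al0 ?mulr0 //; exact: QOm.
under [X in _ + X = _]eq_bigr do rewrite mulr_sumr.
rewrite [X in _ + X = _]exchange_big -big_split; apply: eq_bigr => c _ /=.
rewrite mulr_sumr -big_split; apply: eq_bigr => j _ /=.
by ring.
Qed.

Lemma boxbump_limit (nu : {finite_measure set T -> \bar R}) (F : T -> R) :
  nu.-integrable Q (EFin \o F) ->
  (\int[nu]_(x in Q) (boxbump a b m x * F x)) @[m --> \oo] --> \int[nu]_(x in obox a b) F x.
Proof.
move=> iF.
have mF : measurable_fun Q F by apply/measurable_EFinP; exact: measurable_int iF.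
have mO : measurable (obox a b : set T) by apply: borel_open; exact: obox_open.
have iO : nu.-integrable (obox a b : set T) (EFin \o F).
  by apply: integrableS iF => //; exact: obox_sub.
have mb m : measurable_fun Q (fun x : T => boxbump a b m x).
  by apply: cont_on_measurable; exact/cont_on_C1_fun/C1_fun_elementary/elementary_boxbump.
have okb m : cont_on (boxbump a b m) by exact/cont_on_C1_fun/C1_fun_elementary/elementary_boxbump.
have ib m : nu.-integrable Q (EFin \o (fun x : T => boxbump a b m x * F x)).
  apply: (le_integrable mQ (g := EFin \o F)) => //.
    apply/measurable_EFinP; exact: measurable_funM.
  move=> x Qx /=; rewrite lee_fin normrM ler_piMl // ger0_norm ?boxbump_ge0 //.
  exact: boxbump_le1.
pose G (x : T) : R := (x \in obox a b)%:R * F x.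
have EG : (\int[nu]_(x in obox a b) (F x)%:E)%E = (\int[nu]_(x in Q) (G x)%:E)%E.
  rewrite -(setIidr (@obox_sub _ _ a b)) integral_mkcondr; apply: eq_integral => x _.
  by rewrite patchE /G; case: ifP => _; rewrite ?mul1r ?mul0r.
have mG : measurable_fun Q G.
  apply: measurable_funM => //.
  suff -> : (fun x : T => (x \in obox a b)%:R : R) = \1_(obox a b : set T) by exact: measurable_indic.
  by apply/funext => x; rewrite indicE.
have [||||iG _ H] := @dominated_convergence _ T R nu Q mQ
  (fun m => EFin \o (fun x => boxbump a b m x * F x)) (EFin \o G) (EFin \o (fun x => `|F x|))
  (fun m => measurable_int _ (ib m)).
- exact/measurable_EFinP.
- apply: aeW => x Qx; apply: cvg_EFin; first by apply: nearW.
  by apply: cvgM; [exact: boxbump_cvg | exact: cvg_cst].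
- exact: integrable_norm iF.
- apply: aeW => x m Qx /=; rewrite lee_fin normrM ler_piMl // ger0_norm ?boxbump_ge0 //.
  exact: boxbump_le1.
have E2 : (\int[nu]_(x in Q) (EFin \o G) x)%E = (\int[nu]_(x in obox a b) F x)%:E.
  by rewrite /Rintegral EG fineK //; exact: integrable_fin_num.
rewrite E2 in H; exact: (fine_cvg H).
Qed.

Lemma box_identity_nondeg (I : {set 'I_n}) (al : 'I_n -> vec -> R) : #|I| = h ->
  (forall c, C1_fun Om (al c)) ->
  (forall x j, Om x -> \sum_c al c x * vminor j c I x = 0) ->
  \int[m1]_(x in obox a b) dform al I x - \int[m2]_(x in obox a b) dform al I x =
  \int[m']_(x in obox a b) bform al I x.
Proof.
move=> cI cal al0; have okd := cont_on_dform cI cal.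
have h1 := boxbump_limit (cont_on_integrable m1 okd).
have h2 := boxbump_limit (cont_on_integrable m2 okd).
have h3 := boxbump_limit (bform_integrable I cal).
have E : (fun m => \int[m']_(x in Q) (boxbump a b m x * bform al I x)) =
    (fun m => \int[m1]_(x in Q) (boxbump a b m x * dform al I x)) -
    (fun m => \int[m2]_(x in Q) (boxbump a b m x * dform al I x)).
  apply/funext => m; rewrite -sum_identity //; first exact: elementary_boxbump.
  by move=> x Qx; apply: boxbump_out => /obox_sub.
by rewrite E in h3; apply: (cvg_unique _ (cvgB h1 h2) h3).
Qed.

End OnBox.

(** Approximation needs boxes with nonempty interior, but intersections of boxes can degenerate;
    then the open box is empty. *)
Lemma box_identity a b (I : {set 'I_n}) (al : 'I_n -> vec -> R) :
  cbox a b `<=` Om -> #|I| = h -> (forall c, C1_fun Om (al c)) ->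
  (forall x j, Om x -> \sum_c al c x * vminor j c I x = 0) ->
  \int[m1]_(x in obox a b) dform al I x - \int[m2]_(x in obox a b) dform al I x =
  \int[m']_(x in obox a b) bform al I x.
Proof.
move=> QOm cI cal al0; have [hab|/existsNP[i /negP ab]] := pselect (forall i, a 0 i < b 0 i).
  exact: box_identity_nondeg.
have -> : obox a b = set0.
  rewrite -subset0 => x /(_ i) /andP[ax xb]; move: ab; rewrite -leNgt leNgt.
  by rewrite (lt_trans ax xb).
by rewrite !Rintegral_set0 subrr.
Qed.

End CurrentIdentity.

(** * From boxes to Borel sets and almost everywhere statements *)

Section BoxesGenerate.
Context {R : realType} {n : nat}.
Notation vec := 'rV[R]_n.
Notation T := (borel R n).

(** Pairs of rational corners are coded by integers. [P] keeps the codes whose closed box stays in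
    [U], because the identity on an open box is proved on the closed one. *)
Lemma open_bigcup_boxes (U : set vec) : open U ->
  exists (P : set nat) (a b : nat -> vec), (forall k, P k -> cbox (a k) (b k) `<=` U) /\
    U = \bigcup_(k in P) obox (a k) (b k).
Proof.
move=> oU; pose f (v : 'rV[rat]_n) : vec := map_mx ratr v.
pose q (k : nat) : 'rV[rat]_n * 'rV[rat]_n := odflt (0, 0) (unpickle k).
exists [set k | cbox (f (q k).1) (f (q k).2) `<=` U], (fun k => f (q k).1), (fun k => f (q k).2).
split=> //; apply/seteqP; split=> [x Ux|x [k /= kU /obox_sub]]; last exact: kU.
have : nbhs x U by exact: open_nbhs_nbhs.
move=> /nbhs_normP[r /= r0 Hr].
have /choice[qa Hqa] : forall i, exists p : rat, x 0 i - r < ratr p < x 0 i.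
  move=> i; have [|p] := @rat_in_itvoo R (x 0 i - r) (x 0 i); first by rewrite ltrBlDr ltrDl.
  by rewrite in_itv => /= Hp; exists p.
have /choice[qb Hqb] : forall i, exists p : rat, x 0 i < ratr p < x 0 i + r.
  move=> i; have [|p] := @rat_in_itvoo R (x 0 i) (x 0 i + r); first by rewrite ltrDl.
  by rewrite in_itv => /= Hp; exists p.
pose va : 'rV[rat]_n := \row_i qa i; pose vb : 'rV[rat]_n := \row_i qb i.
have qE : q (pickle (va, vb)) = (va, vb) by rewrite /q pickleK.
exists (pickle (va, vb)) => /=; rewrite qE /=.
  move=> y Hy; apply: Hr => /=; apply/rV_norm_ltP => // i.
  rewrite !mxE; have := Hy i; rewrite !mxE => /andP[h1 h2].
  have /andP[h3 _] := Hqa i; have /andP[_ h4] := Hqb i.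
  by rewrite ltr_norml; apply/andP; split; lra.
move=> i; rewrite !mxE; have /andP[_ ->] := Hqa i; by have /andP[-> _] := Hqb i.
Qed.

Definition boxes : set (set T) := [set B | exists a b, B = obox a b].

Lemma measurable_boxes : @measurable _ T = <<s boxes >>.
Proof.
apply/seteqP; split.
  apply: smallest_sub; first exact: smallest_sigma_algebra.
  move=> U /open_bigcup_boxes[P [a [b [_ ->]]]].
  apply: (@bigcup_measurable _ (g_sigma_algebraType boxes)) => k _.
  by apply: sub_sigma_algebra; exists (a k), (b k).
apply: smallest_sub; first exact: smallest_sigma_algebra.
move=> _ [a [b ->]]; apply: sub_sigma_algebra; exact: obox_open.
Qed.

Lemma oboxI (a b a' b' : vec) : obox a b `&` obox a' b' =
  obox (\row_i Num.max (a 0 i) (a' 0 i)) (\row_i Num.min (b 0 i) (b' 0 i)).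
Proof.
apply/seteqP; split=> [x [h1 h2] i|x H]; last split=> i.
- rewrite !mxE gt_max lt_min; have /andP[-> ->] := h1 i; exact: h2.
- by have := H i; rewrite !mxE gt_max lt_min => /andP[/andP[-> _] /andP[-> _]].
- by have := H i; rewrite !mxE gt_max lt_min => /andP[/andP[_ ->] /andP[_ ->]].
Qed.

(** Dynkin's argument. The whole space is in general not a box, so its charge is a separate
    assumption, used for complements. *)
Lemma charge_boxes_eq0 (kappa : {charge set T -> \bar R}) :
  kappa setT = 0%E -> (forall a b, kappa (obox a b) = 0%E) ->
  forall B, measurable B -> kappa B = 0%E.
Proof.
move=> kT kB B; rewrite measurable_boxes; move: B.
apply: (@dynkin_induction _ T boxes (fun B => kappa B = 0%E)) => //.
- exact: measurable_boxes.
- by move=> _ _ [a [b ->]] [a' [b' ->]]; rewrite oboxI; eexists; eexists.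
- by move=> _ [a [b ->]].
- by move=> S mS S0; rewrite -setTD chargeD // setTI kT S0 sube0.
move=> F mF tF F0.
have := @charge_semi_sigma_additive _ _ _ kappa F mF tF (bigcupT_measurable _ mF).
move=> /cvg_lim <- //; under eq_fun do rewrite big1 //.
exact: lim_cst.
Qed.

End BoxesGenerate.

(** * Proportional densities from equal integrals *)

Section Proportional.
Context {d : measure_display} {T : measurableType d} {R : realType}.
Variables (m1 m' : {finite_measure set T -> \bar R}) (D : set T) (mD : measurable D).
Variables (J : finType) (f g : J -> T -> R).
Hypothesis m'ac : forall B, B `<=` D -> measurable B -> m1 B = 0%E -> m' B = 0%E.
Hypothesis fi : forall i, m1.-integrable D (EFin \o f i).
Hypothesis gi : forall i, m'.-integrable D (EFin \o g i).
Hypothesis fg : forall i E, E `<=` D -> measurable E ->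
  (\int[m1]_(x in E) (f i x)%:E)%E = (\int[m']_(x in E) (g i x)%:E)%E.

Let D_fin : (m' D < +oo)%E.
Proof. by rewrite -ge0_fin_numE // fin_num_measure. Qed.

Let nu : {finite_measure set T -> \bar R} := mfrestr mD D_fin.

Let nu_eq E : E `<=` D -> nu E = m' E.
Proof. by move=> ED; rewrite /nu /= /mfrestr /mrestr setIidl. Qed.

Let nu_int E (F : T -> \bar R) : E `<=` D -> measurable E ->
  (\int[nu]_(x in E) F x)%E = (\int[m']_(x in E) F x)%E.
Proof.
move=> ED mE; apply: eq_measure_integral => A mA AE.
by apply: nu_eq; exact: subset_trans ED.
Qed.

Let numu : nu `<< m1.
Proof.
apply/null_content_dominatesP => A mA A0.
have E : nu A = m' (A `&` D) by [].
rewrite E; apply: m'ac; [exact: subIsetr | exact: measurableI | ].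
by apply/eqP; rewrite eq_le measure_ge0 andbT -A0 le_measure // inE //; exact: measurableI.
Qed.

Let numu' : charge_of_finite_measure nu `<< m1.
Proof. exact: numu. Qed.

Let phi := Radon_Nikodym (charge_of_finite_measure nu) m1.

(** With [phi] the density of [m'] on [D] with respect to [m1], equal integrals give
    [f i = g i * phi] almost everywhere. The zero set of [phi] has [m']-measure the integral of
    [phi] over it, hence 0, and elsewhere [t] is the inverse of [phi]. As [J] is finite, one null
    set serves every [i]. *)
Lemma ae_proportional :
  m'.-negligible [set x | D x /\ ~ exists2 t, t != 0 & forall i, g i x = t * f i x].
Proof.
have nui i E : E `<=` D -> measurable E -> nu.-integrable E (EFin \o g i).
  move=> ED mE; have /integrableP[m b] : m'.-integrable E (EFin \o g i).
    exact: integrableS (gi i).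
  by apply/integrableP; split => //; rewrite nu_int.
have mphi : measurable_fun [set: T] phi.
  by apply: measurable_int; apply: Radon_Nikodym_integrable; exact: numu.
have ae i : ae_eq m1 D (EFin \o f i) (fun x => ((g i x)%:E * phi x)%E).
  apply: integral_ae_eq => //.
    apply: emeasurable_funM; last exact: measurable_funTS.
    exact: measurable_int (gi i).
  move=> E ED mE; rewrite (@Radon_Nikodym_change_of_variables _ T R nu m1 numu (EFin \o g i) E mE).
    by rewrite nu_int // -fg.
  exact: nui.
have negl (N : set T) : measurable N -> m1 N = 0%E -> m'.-negligible (D `&` N).
  move=> mN N0; exists (D `&` N); split=> //; first exact: measurableI.
  apply: m'ac; [exact: subIsetl | exact: measurableI|].
  by apply/eqP; rewrite eq_le measure_ge0 andbT -N0 le_measure // inE //; exact: measurableI.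
pose Z := D `&` (phi @^-1` [set 0%E]).
have mZ : measurable Z.
  rewrite /Z -[_ @^-1` _]setTI; apply: measurableI => //.
  by apply: mphi => //; exact: emeasurable_set1.
have Z0 : m' Z = 0%E.
  rewrite -nu_eq; last exact: subIsetl.
  rewrite -[LHS]/(charge_of_finite_measure nu Z).
  rewrite (Radon_Nikodym_integral numu') // -/phi.
  by apply: integral0_eq => x [_].
have /choice[N HN] : forall i, exists N : set T, [/\ measurable N, m1 N = 0%E &
    forall x, D x -> ~ N x -> (f i x)%:E = ((g i x)%:E * phi x)%E].
  move=> i; have [N [mN N0 sub]] := ae i; exists N; split=> // x Dx Nx.
  by apply: contrapT => H; apply: Nx; apply: sub => /= /(_ Dx).
pose F (k : nat) : set T := if unpickle k is Some i then D `&` N i else Z.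
have HF : m'.-negligible (\bigcup_k F k `|` Z).
  apply: negligibleU; last by exists Z; split.
  apply: negligible_bigcup => k; rewrite /F; case: (unpickle k) => [i|]; last by exists Z; split.
  by have [mN N0 _] := HN i; exact: negl.
apply: negligibleS HF => x [Dx nx].
have [Zx|Zx] := pselect (Z x); [by right | left].
apply: contrapT => nF; apply: nx.
have phix : phi x \is a fin_num by exact: (Radon_Nikodym_fin_num x numu').
have p0 : fine (phi x) != 0.
  by apply/eqP => p0; apply: Zx; split => //=; rewrite -[phi x]fineK // p0.
exists (fine (phi x))^-1 => [|i]; first by rewrite invr_eq0.
have [_ _ /(_ x Dx)] := HN i => H; have /H : ~ N i x.
  by move=> Nx; apply: nF; exists (pickle i) => //; rewrite /F pickleK.
rewrite -[phi x]fineK // -EFinM => -[->].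
by rewrite mulrC mulfK.
Qed.

End Proportional.

Section SetIdentity.
Context {R : realType} {n : nat}.
Notation vec := 'rV[R]_n.
Notation T := (borel R n).
Variables (m1 m2 m' : {finite_measure set T -> \bar R}) (a b : vec) (f g : T -> R).
Let O : set T := obox a b.
Hypothesis f1 : m1.-integrable O (EFin \o f).
Hypothesis f2 : m2.-integrable O (EFin \o f).
Hypothesis g' : m'.-integrable O (EFin \o g).
Hypothesis fg : forall a' b', cbox a' b' `<=` cbox a b ->
  \int[m1]_(x in obox a' b') f x - \int[m2]_(x in obox a' b') f x =
  \int[m']_(x in obox a' b') g x.

Let mO : measurable O.
Proof. by apply: borel_open; exact: obox_open. Qed.

Lemma set_identity E : E `<=` O -> measurable E ->
  (\int[m1]_(x in E) (f x)%:E - \int[m2]_(x in E) (f x)%:E)%E =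
  (\int[m']_(x in E) (g x)%:E)%E.
Proof.
have i1 := (integrable_mkcond (EFin \o f) mO).1 f1.
have i2 := (integrable_mkcond (EFin \o f) mO).1 f2.
have i3 := (integrable_mkcond (EFin \o g) mO).1 g'.
(* The difference of both sides is one charge carried by [O]. Its value at a box, or at the whole
   space, is its value at a box inside [O], by stability under intersection. *)
pose kappa : {charge set T -> \bar R} :=
  cadd (cadd (induced_charge i1) (copp (induced_charge i2))) (copp (induced_charge i3)).
have ind (nu : {finite_measure set T -> \bar R}) (F : T -> R) B :
   (\int[nu]_(x in B) ((EFin \o F) \_ O) x)%E = (\int[nu]_(x in B `&` O) (F x)%:E)%E.
  by rewrite integral_mkcondr.
have kE B : kappa B = (\int[m1]_(x in B `&` O) (f x)%:E - \int[m2]_(x in B `&` O) (f x)%:E -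
    \int[m']_(x in B `&` O) (g x)%:E)%E.
  by rewrite -!ind.
have fin (nu : {finite_measure set T -> \bar R}) (F : T -> R) B : measurable B ->
    nu.-integrable O (EFin \o F) -> B `<=` O -> (\int[nu]_(x in B) (F x)%:E)%E \is a fin_num.
  by move=> mB iF BO; apply: integrable_fin_num => //; exact: integrableS iF.
have k0 B a' b' : B `&` O = obox a' b' -> cbox a' b' `<=` cbox a b -> kappa B = 0%E.
  move=> BO ab'; have mB' : measurable (obox a' b' : set T) by apply: borel_open; exact: obox_open.
  have sB : (obox a' b' : set T) `<=` O by rewrite -BO; exact: subIsetr.
  rewrite kE BO; have := fg ab'; rewrite /Rintegral.
  rewrite -(fineK (fin m1 f _ mB' f1 sB)) -(fineK (fin m2 f _ mB' f2 sB)) -(fineK (fin m' g _ mB' g' sB)) /=.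
  by rewrite -!EFinB => ->; rewrite subrr.
have kT : kappa setT = 0%E by apply: (k0 _ a b) => //; rewrite setTI.
have kB a' b' : kappa (obox a' b') = 0%E.
  apply: k0; first exact: oboxI.
  move=> x Hx i; have := Hx i; rewrite !mxE ge_max le_min.
  by move=> /andP[/andP[_ ->] /andP[_ ->]].
move=> EO mE; have := charge_boxes_eq0 kT kB mE; rewrite kE setIidl //.
rewrite -(fineK (fin m1 f _ mE f1 EO)) -(fineK (fin m2 f _ mE f2 EO)) -(fineK (fin m' g _ mE g' EO)).
by rewrite -!EFinB => -[/eqP]; rewrite subr_eq0 => /eqP ->.
Qed.

End SetIdentity.

(** * Forms annihilating the distribution *)

Section Gram.
Context {R : realFieldType} {k n : nat}.

(** If [K M M^T = 0], the rows of [K M] have zero Euclidean norm, so [K M = 0] and freeness gives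
    [K = 0]. *)
Lemma gram_unit (M : 'M[R]_(k, n)) : row_free M -> M *m M^T \in unitmx.
Proof.
move=> fM; rewrite -row_free_unit -kermx_eq0; set K := kermx _.
have KG : K *m M *m (K *m M)^T = 0.
  by rewrite trmx_mul !mulmxA -(mulmxA K) mulmx_ker mul0mx.
have KM : K *m M = 0.
  move: KG; set A := K *m M; clearbody A => KG.
  apply/matrixP => i j; rewrite [RHS]mxE; apply/eqP; rewrite -sqrf_eq0.
  move/matrixP/(_ i i): KG; rewrite [LHS]mxE [RHS]mxE => /eqP.
  rewrite psumr_eq0 => [/allP/(_ j)|l _]; last by rewrite [A^T _ _]mxE -expr2 sqr_ge0.
  by rewrite mem_index_enum => /(_ isT) /=; rewrite [A^T _ _]mxE -expr2.
by rewrite -(mulmx_free_eq0 _ fM) KM.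
Qed.

(* [det (M M^T)] times the orthogonal projection onto the kernel of [M] *)
Definition coproj (M : 'M[R]_(k, n)) : 'M[R]_n :=
  (\det (M *m M^T))%:M - M^T *m \adj (M *m M^T) *m M.

Lemma coproj_annih (M : 'M[R]_(k, n)) : M *m (coproj M)^T = 0.
Proof.
rewrite /coproj raddfB /= tr_scalar_mx mulmxBr mul_mx_scalar !trmx_mul trmxK.
have -> : (\adj (M *m M^T))^T = \adj (M *m M^T).
  by rewrite trmx_adj trmx_mul trmxK.
by rewrite !mulmxA mul_mx_adj mul_scalar_mx subrr.
Qed.

End Gram.

Section TangentForms.
Context {R : realType} {n h : nat}.
Notation vec := 'rV[R]_n.
Notation e_ := (@ebase R n).
Variables (Om : set vec) (oOm : open Om) (vs : 'I_h.+2 -> vec -> vec).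
Hypothesis hvs : forall i, C1_on Om (vs i).
Let M (x : vec) := \matrix_i vs i x.
Let P (x : vec) := coproj (M x).
Let V (x : vec) := lspan [set vs i x | i in [set: 'I_h.+2]].

(** With the adjugate in place of the inverse, the entries are polynomials in those of [M], so no
    division occurs. *)
Lemma C1_fun_coproj a c : C1_fun Om (fun x => P x a c).
Proof.
have cM i j : C1_fun Om (fun x => M x i j).
  by under eq_fun do rewrite mxE; exact: C1_fun_coord.
have cMT := C1_fun_trmx cM; have cG := C1_fun_mulmx oOm cM cMT.
under eq_fun do rewrite [P _ _ _]mxE [X in X + _]mxE [X in _ + X]mxE.
apply: C1_fun_add => //.
  case: (a == c); last exact: C1_fun_cst.
  by under eq_fun do rewrite mulr1n; exact: C1_fun_det.
apply: C1_fun_opp => //; apply: C1_fun_mulmx => //; apply: C1_fun_mulmx => // i j.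
exact: C1_fun_adj.
Qed.

(** Minors are linear in the column [c] with coefficients free of [c], so [coproj_annih] kills the
    sum. *)
Lemma coproj_vminor a j (I : {set 'I_n}) x : #|I| = h ->
  \sum_c P x a c * vminor vs j c I x = 0.
Proof.
move=> cI; have sI : size (j :: enum I) = h.+1 by rewrite /= -cardE cI.
have [kappa E] := minor_col1 (M x) sI.
transitivity (- \sum_i kappa i * (M x *m (P x)^T) i a); last first.
  by rewrite big1 ?oppr0 // => i _; rewrite coproj_annih mxE mulr0.
rewrite -sumrN; under [RHS]eq_bigr do rewrite mxE mulr_sumr -sumrN.
rewrite exchange_big /=; apply: eq_bigr => c _.
rewrite /vminor (@minor_swap _ _ _ _ [::]) /= -?cardE ?cI // E mulrN mulr_sumr -sumrN.
by apply: eq_bigr => i _; rewrite [X in _ = - (_ * (_ * X))]mxE; ring.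
Qed.

(** Near [x] the pairing of [g *m P] with the tangent field [w] is identically zero; differentiating
    it along [v] trades the derivative of [w] for derivatives of [P], and only the value [w x]
    remains. *)
Lemma tangent_derive (w : vec -> vec) (g v : vec) x : Om x -> C1_on Om w ->
  (forall y, Om y -> V y (w y)) ->
  dot (g *m P x) ('D_v w x) =
  - \sum_c \sum_j v 0 j * (\sum_a g 0 a * partial j (fun y => P y a c) x) * w x 0 c.
Proof.
move=> Ox cw wV.
have cal c : C1_fun Om (fun y => (g *m P y) 0 c).
  under eq_fun do rewrite mxE; apply: C1_fun_sum => // a.
  by apply: C1_fun_mul => //; [exact: C1_fun_cst | exact: C1_fun_coproj].
have cwc c : C1_fun Om (fun y => w y 0 c) by exact: C1_fun_coord.
have dal c j : partial j (fun y => (g *m P y) 0 c) x =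
    \sum_a g 0 a * partial j (fun y => P y a c) x.
  have -> : (fun y => (g *m P y) 0 c) = \sum_a (fun y => g 0 a * P y a c).
    by apply/funext => y; rewrite mxE fct_sumE.
  have H := @is_derive_sum _ _ _ n (fun a y => g 0 a * P y a c) x (e_ j) (fun a => g 0 a * partial j (fun y => P y a c) x).
  have [|_] // := H _ => a.
  exact: (is_deriveZ (g 0 a) (C1_fun_coproj a c Ox j).1).
have dw c := C1_fun_is_derive v oOm (cwc c) Ox.
have dwx : derivable w x v.
  by apply/derivable_mxP => i c; rewrite [i]ord1; case: (dw c).
have dwE c : 'D_v w x 0 c = 'D_v (fun y => w y 0 c) x by rewrite derive_mx // mxE.
pose F c (y : vec) := (g *m P y) 0 c * w y 0 c.
have dF c : is_derive x v (F c) ((g *m P x) 0 c * 'D_v w x 0 c +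
    w x 0 c * \sum_j v 0 j * partial j (fun y => (g *m P y) 0 c) x).
  rewrite dwE; have dal' := C1_fun_is_derive v oOm (cal c) Ox.
  have dw' : is_derive x v (fun y => w y 0 c) ('D_v (fun y => w y 0 c) x).
    by apply: DeriveDef => //; case: (dw c).
  exact: (is_deriveM dal' dw').
have dS := is_derive_sum dF.
have S0 : 'D_v (\sum_c F c) x = 0.
  rewrite -(derive_cst (0 : R) v x); apply: near_eq_derive; near=> y.
  rewrite fct_sumE; have Oy : Om y by near: y; exact: open_nbhs_nbhs.
  exact: (P_annihV (coproj_annih (M y)) g (wV y Oy)).
have [_] := dS; rewrite S0 big_split /= => /esym/eqP; rewrite addr_eq0 => /eqP E.
rewrite /dot E; congr (- _); apply: eq_bigr => c _; rewrite mulr_sumr; apply: eq_bigr => j _.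
by rewrite dal mulrC.
Unshelve. all: by end_near. Qed.

(** Subtract [tangent_derive] for the two fields. With the sign convention of [lie], opposite to the
    usual bracket, the exterior derivative of [g *m P] on the pair of fields comes out with sign
    plus. *)
Lemma tangent_lie (w w' : vec -> vec) (g : vec) x : Om x ->
  C1_on Om w -> (forall y, Om y -> V y (w y)) ->
  C1_on Om w' -> (forall y, Om y -> V y (w' y)) ->
  let B := \sum_a g 0 a *: (\matrix_(j, c) partial j (fun y => P y a c) x) in
  dot (g *m P x) (lie w w' x) = (w x *m (B - B^T) *m (w' x)^T) 0 0.
Proof.
move=> Ox cw wV cw' wV' B.
have BE j c : B j c = \sum_a g 0 a * partial j (fun y => P y a c) x.
  by rewrite summxE; apply: eq_bigr => a _; rewrite !mxE.
rewrite /lie dotDr -scaleN1r dotZr !tangent_derive // mulN1r opprK.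
have E1 (u u' : vec) : (u *m B *m u'^T) 0 0 =
    \sum_c \sum_j u 0 j * (\sum_a g 0 a * partial j (fun y => P y a c) x) * u' 0 c.
  rewrite mxE; apply: eq_bigr => c _; rewrite [_^T _ _]mxE mxE mulr_suml.
  by apply: eq_bigr => j _; rewrite BE.
have -> : (w x *m (B - B^T) *m (w' x)^T) 0 0 =
    (w x *m B *m (w' x)^T) 0 0 - (w' x *m B *m (w x)^T) 0 0.
  rewrite mulmxBr mulmxBl [LHS]mxE; congr (_ + _); rewrite mxE; congr (- _).
  have -> : w x *m B^T *m (w' x)^T = (w' x *m B *m (w x)^T)^T.
    by rewrite !trmx_mul trmxK mulmxA.
  by rewrite [LHS]mxE.
by rewrite !E1 addrC.
Qed.

End TangentForms.

(** * Almost everywhere statements on boxes and on [Om] *)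

Section Core.
Context {R : realType} {n h : nat}.
Notation vec := 'rV[R]_n.
Notation T := (borel R n).
Variables (Om : set vec) (oOm : open Om) (vs : 'I_h.+2 -> vec -> vec).
Hypothesis hvs : forall i, C1_on Om (vs i).
Hypothesis hfree : forall x, Om x -> row_free (\matrix_i vs i x).
Variables (m1 m2 m' : {finite_measure set T -> \bar R}) (tau : vec -> mvec R n).
Hypothesis htau : forall x, is_hvec h.+1 (tau x).
Hypothesis htaum : forall I, measurable_fun [set: T] (fun x => tau x I).
Hypothesis htaui : (\int[m']_x (mvnorm (tau x))%:E < +oo)%E.
Hypothesis hbd : forall om : vec -> mvec R n, test_form Om h.+1 om ->
  (\int[m1]_x (pairing h.+2 (extd om x) (wedge (fun i => vs i x)))%:E -
   \int[m2]_x (pairing h.+2 (extd om x) (wedge (fun i => vs i x)))%:E)%E =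
  (\int[m']_x (pairing h.+1 (om x) (tau x))%:E)%E.
Variables (Pos A : set T) (mPos : measurable Pos) (mA : measurable A).
Hypotheses (m1Pos : m1 (~` Pos) = 0%E) (m2Pos : m2 Pos = 0%E).
Hypotheses (m1A : m1 A = 0%E) (m2A : m2 A = 0%E).
Hypothesis hac : forall B, measurable B -> m1 B = 0%E -> m2 B = 0%E -> m' (B `\` A) = 0%E.

Let M (x : vec) := \matrix_i vs i x.
Let P (x : vec) := coproj (M x).
Let V (x : vec) := lspan [set vs i x | i in [set: 'I_h.+2]].
Let J : finType := ('I_n * {set 'I_n})%type.
(** The guard lets [i] range over the whole finite type [J]: a set of the wrong cardinality gives 0
    for [f] and [g] alike. *)
Let f (i : J) (x : T) : R :=
  if #|i.2| == h then dform vs (fun c y => P y i.1 c) i.2 x else 0.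
Let g (i : J) (x : T) : R :=
  if #|i.2| == h then bform tau (fun c y => P y i.1 c) i.2 x else 0.

Lemma sub_null (nu : {finite_measure set T -> \bar R}) B C :
  measurable B -> measurable C -> B `<=` C -> nu C = 0%E -> nu B = 0%E.
Proof.
move=> mB mC BC C0; apply/eqP; rewrite eq_le measure_ge0 andbT -C0.
by rewrite le_measure // inE.
Qed.

Section OneBox.
Variables (a b : vec) (QOm : cbox a b `<=` Om).
Let O : set T := obox a b.

Let mO : measurable O. Proof. by apply: borel_open; exact: obox_open. Qed.
Let mQ : measurable (cbox a b : set T). Proof. by apply: borel_closed; exact: cbox_closed. Qed.

Let fint (nu : {finite_measure set T -> \bar R}) i : nu.-integrable O (EFin \o f i).
Proof.
rewrite /f; case: eqP => [cI|_]; last exact: finite_measure_integrable_cst.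
apply: (integrableS mQ mO); first exact: obox_sub.
apply: (cont_on_integrable oOm) => //; apply: cont_on_dform => // c.
exact: C1_fun_coproj.
Qed.

Let gint i : m'.-integrable O (EFin \o g i).
Proof.
rewrite /g; case: eqP => [cI|_]; last exact: finite_measure_integrable_cst.
apply: (integrableS mQ mO); first exact: obox_sub.
apply: (bform_integrable oOm htaum htaui) => // c.
exact: C1_fun_coproj.
Qed.

Let fgE i E : E `<=` O -> measurable E ->
  (\int[m1]_(x in E) (f i x)%:E - \int[m2]_(x in E) (f i x)%:E)%E =
  (\int[m']_(x in E) (g i x)%:E)%E.
Proof.
apply: set_identity => //.
move=> a' b' ab; rewrite /f /g; case: eqP => [cI|_]; last first.
  have mo : measurable (obox a' b' : set T) by apply: borel_open; exact: obox_open.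
  by rewrite !Rintegral_cst // !mul0r subrr.
apply: (box_identity oOm hvs htaum htaui hbd) => //.
- exact: subset_trans ab QOm.
- by move=> c; exact: C1_fun_coproj.
by move=> x j _; exact: coproj_vminor.
Qed.

Let fmeas E i : E `<=` O -> measurable E -> measurable_fun E (EFin \o f i).
Proof. by move=> EO mE; apply: measurable_int; exact: integrableS (fint m1 i). Qed.

(** Neither [m1] nor [m2] charges [A], so [g i] has zero integral over every Borel subset of [A] in
    the box. *)
Lemma singular_box : m'.-negligible [set x | (A `&` O) x /\ ~ forall i, g i x = 0].
Proof.
have mAO : measurable (A `&` O) by exact: measurableI.
have null (nu : {finite_measure set T -> \bar R}) i E : nu A = 0%E -> E `<=` A `&` O ->
    measurable E -> (\int[nu]_(x in E) (f i x)%:E)%E = 0%E.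
  move=> nA EA mE; apply: null_set_integral => //.
    by apply: fmeas => //; exact: subset_trans EA (@subIsetr _ _ _).
  by apply: (sub_null mE mA) => //; exact: subset_trans EA (@subIsetl _ _ _).
have ae i : ae_eq m' (A `&` O) (EFin \o g i) (cst 0%E).
  apply: integral_ae_eq => //.
    by apply: integrableS (gint i).
  move=> E EA mE; rewrite integral0 -fgE //; last exact: subset_trans EA (@subIsetr _ _ _).
  by rewrite !null // sube0.
have /choice[N HN] : forall i, exists N : set T, [/\ measurable N, m' N = 0%E &
    forall x, (A `&` O) x -> ~ N x -> g i x = 0].
  move=> i; have [N [mN N0 sub]] := ae i; exists N; split=> // x Dx Nx.
  by apply: contrapT => H; apply: Nx; apply: sub => /= /(_ Dx) -[].
pose F (k : nat) : set T := if unpickle k is Some i then N i else set0.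
have HF : m'.-negligible (\bigcup_k F k).
  apply: negligible_bigcup => k; rewrite /F; case: (unpickle k) => [i|].
    by have [mN N0 _] := HN i; exists (N i); split.
  exact: negligible_set0.
apply: negligibleS HF => x [Dx nx]; apply: contrapT => nF; apply: nx => i.
have [_ _ ->] // := HN i.
by move=> Nx; apply: nF; exists (pickle i) => //; rewrite /F pickleK.
Qed.

(** On [Pos] only [m1] acts; off [Pos] only [m2], with a minus sign that is moved into [t]. On each
    piece [hac] reduces to absolute continuity with respect to a single measure. *)
Lemma ac_box : m'.-negligible [set x | (O `\` A) x /\
  ~ exists2 t, t != 0 & forall i, g i x = t * f i x].
Proof.
pose D1 := (O `&` Pos) `\` A; pose D2 := (O `\` Pos) `\` A.
have mD1 : measurable D1 by apply: measurableD => //; exact: measurableI.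
have mD2 : measurable D2 by apply: measurableD => //; exact: measurableD.
have D1O : D1 `<=` O by move=> x [[]].
have D2O : D2 `<=` O by move=> x [[]].
have h1 : m'.-negligible [set x | D1 x /\ ~ exists2 t, t != 0 & forall i, g i x = t * f i x].
  apply: (@ae_proportional _ T R m1 m' D1 mD1 J f g).
  - move=> B BD mB B0; rewrite -(@setDidl _ B A); last first.
      by apply/disjoints_subset => x /BD [].
    apply: hac => //; apply: (sub_null mB mPos) => // x /BD [[]] //.
  - by move=> i; apply: integrableS (fint m1 i).
  - by move=> i; apply: integrableS (gint i).
  move=> i E ED mE; rewrite -fgE //; last exact: subset_trans ED D1O.
  rewrite [X in (_ - X)%E](_ : _ = 0%E) ?sube0 //.
  apply: null_set_integral => //.
    by apply: fmeas => //; exact: subset_trans ED D1O.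
  by apply: (sub_null mE mPos) => // x /ED [[]].
have h2 : m'.-negligible [set x | D2 x /\ ~ exists2 t, t != 0 & forall i, g i x = t * - f i x].
  apply: (@ae_proportional _ T R m2 m' D2 mD2 J (fun i x => - f i x) g).
  - move=> B BD mB B0; rewrite -(@setDidl _ B A); last first.
      by apply/disjoints_subset => x /BD [].
    apply: hac => //; apply: (sub_null mB (measurableC mPos)) => // x /BD [[]] //.
  - by move=> i; apply: integrableS (integrableN (fint m2 i)).
  - by move=> i; apply: integrableS (gint i).
  move=> i E ED mE; rewrite -fgE //; last exact: subset_trans ED D2O.
  rewrite [X in (X - _)%E](_ : _ = 0%E) ?add0e.
    have iE : m2.-integrable E (EFin \o f i).
      by apply: integrableS (fint m2 i) => //; exact: subset_trans ED D2O.
    rewrite -mulN1e -integralZl //; apply: eq_integral => x _.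
    by rewrite /= mulN1e EFinN.
  apply: null_set_integral => //.
    by apply: fmeas => //; exact: subset_trans ED D2O.
  by apply: (sub_null mE (measurableC mPos)) => // x /ED [[]].
apply: negligibleS (negligibleU h1 h2) => x [[Ox nA] nx].
have [Px|Px] := pselect (Pos x); [left|right]; split=> //.
move=> [t t0 E]; apply: nx; exists (- t) => [|i]; first by rewrite oppr_eq0.
by rewrite E mulrN mulNr.
Qed.

End OneBox.

Let gram_det_neq0 x : Om x -> \det (M x *m (M x)^T) != 0.
Proof. by move=> Ox; rewrite -unitfE -unitmxE; apply: gram_unit; exact: hfree. Qed.

Lemma singular_span : m'.-negligible [set x | A x /\ Om x /\ ~ mvspan h.+1 (tau x) `<=` V x].
Proof.
have [K [a [b [QOm OmE]]]] := open_bigcup_boxes oOm.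
(* Exceptional sets of countably many boxes are united; codes outside the cover contribute the empty
   set. *)
pose F k : set T := if pselect (K k) is left Kk then
  [set x | (A `&` obox (a k) (b k)) x /\ ~ forall i, g i x = 0] else set0.
have HF : m'.-negligible (\bigcup_k F k).
  apply: negligible_bigcup => k; rewrite /F; case: pselect => [Kk|_]; last exact: negligible_set0.
  exact: singular_box (QOm k Kk).
apply: negligibleS HF => x [Ax [Ox nx]].
have [k Kk xk] : (\bigcup_(k in K) obox (a k) (b k)) x by rewrite -OmE.
exists k => //; rewrite /F; case: pselect => // _; split=> // g0; apply: nx.
apply: (mvspan_sub_V (P := P x) (htau x) (gram_det_neq0 Ox) erefl) => r I cI.
by have := g0 (r, I); rewrite /g /= cI eqxx.
Qed.

Lemma ac_span : m'.-negligible [set x | ~ A x /\ Om x /\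
  ~ sumset (mvspan h.+1 (tau x)) (V x) = Vhat Om V x].
Proof.
have [K [a [b [QOm OmE]]]] := open_bigcup_boxes oOm.
pose F k : set T := if pselect (K k) is left Kk then
  [set x | (obox (a k) (b k) `\` A) x /\
     ~ exists2 t, t != 0 & forall i, g i x = t * f i x] else set0.
have HF : m'.-negligible (\bigcup_k F k).
  apply: negligible_bigcup => k; rewrite /F; case: pselect => [Kk|_]; last exact: negligible_set0.
  exact: ac_box (QOm k Kk).
apply: negligibleS HF => x [Ax [Ox nx]].
have [k Kk xk] : (\bigcup_(k in K) obox (a k) (b k)) x by rewrite -OmE.
exists k => //; rewrite /F; case: pselect => // _; split=> // -[t t0 gf]; apply: nx.
pose A' (r : 'I_n) : 'M[R]_n := \matrix_(j, c) partial j (fun y => P y r c) x.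
have Vv p y : V y (vs p y) by apply: subset_lspan; exists p.
apply: (mvspan_V_eq (P := P x) (A := A') (t := t) (hfree Ox) (htau x) (gram_det_neq0 Ox) erefl) => //.
- move=> z [w [w' [[cw wV] [[cw' wV'] ->]]]]; exists (w x), (w' x).
  split; first exact: wV.
  split; first exact: wV'.
  by move=> u; exact: (tangent_lie oOm hvs u Ox cw wV cw' wV').
- move=> p q; exists (lie (vs p) (vs q) x).
    by exists (vs p), (vs q); do !split => //.
  by move=> u; exact: (tangent_lie oOm hvs u Ox (hvs p) (fun y _ => Vv p y) (hvs q) (fun y _ => Vv q y)).
move=> r I cI; have := gf (r, I); rewrite /g /f /= cI eqxx /bform /dform => ->.
congr (_ * _); rewrite exchange_big /=; apply: eq_bigr => j _; apply: eq_bigr => c _.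
by rewrite mxE.
Qed.

End Core.

Theorem theorem3p3 (R : realType) (n k : nat) (hk2 : (2 <= k)%N) (hkn : (k < n)%N)
  (Om : set 'rV[R]_n) (hOm : open Om)
  (vs : 'I_k -> 'rV[R]_n -> 'rV[R]_n)
  (hvsC1 : forall i, C1_on Om (vs i))
  (hvsfree : forall x, Om x -> row_free (\matrix_(i < k) vs i x))
  (mu : {charge set borel R n -> \bar R})
  (mu' : {finite_measure set borel R n -> \bar R})
  (tau' : 'rV[R]_n -> mvec R n)
  (* T = v mu, v = v_1 /\ ... /\ v_k, is a k-current on Om of finite mass *)
  (hmuOm : charge_tv mu (~` Om) = 0%E)
  (hmassT : (\int[charge_tv mu]_x
               (mvnorm (wedge (fun i => vs i x)))%:E < +oo)%E)
  (* dT = tau' mu', mu' finite positive, of finite mass *)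
  (hmu'Om : mu' (~` Om) = 0%E)
  (htau'deg : forall x, is_hvec k.-1 (tau' x))
  (htau'meas : forall I, measurable_fun [set: borel R n] (fun x => tau' x I))
  (hmassdT : (\int[mu']_x (mvnorm (tau' x))%:E < +oo)%E)
  (hbd : forall om : 'rV[R]_n -> mvec R n, test_form Om k.-1 om ->
     signed_integral mu
       (fun x => pairing k (extd om x) (wedge (fun i => vs i x))) =
     (\int[mu']_x (pairing k.-1 (om x) (tau' x))%:E)%E)
  (* Lebesgue decomposition of mu' w.r.t. |mu| *)
  (mua mus : {measure set borel R n -> \bar R})
  (hdec : forall A, measurable A -> mu' A = (mua A + mus A)%E)
  (hac : mua `<< charge_tv mu)
  (hsing : msingular mus (charge_tv mu)) :
  let V := fun x => lspan [set vs i x | i in [set: 'I_k]] in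
  {ae mus, forall x, Om x -> mvspan k.-1 (tau' x) `<=` V x} /\
  {ae mua, forall x, Om x -> sumset (mvspan k.-1 (tau' x)) (V x) = Vhat Om V x}.
Proof.
move: k hk2 hkn vs hvsC1 hvsfree hmassT htau'deg hbd.
(* With [k = h.+2] the degree [k.-1] computes to [h.+1], and [h] is the size of [I]. *)
move=> [|[|h]] // _ _ vs hvsC1 hvsfree _ htau'deg hbd V.
pose H := projT2 (cid (projT2 (cid (Hahn_decomposition mu)))).
pose m1 : {finite_measure set borel R n -> \bar R} := jordan_pos H.
pose m2 : {finite_measure set borel R n -> \bar R} := jordan_neg H.
have tvE B : charge_tv mu B = (m1 B + m2 B)%E by [].
have tv0 B : charge_tv mu B = 0%E -> m1 B = 0%E /\ m2 B = 0%E.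
  by move=> /eqP; rewrite tvE padde_eq0 // => /andP[/eqP -> /eqP ->].
set Pos := projT1 (cid (Hahn_decomposition mu)) in H m1 m2 tvE tv0 *.
have [[mPos _] [mNeg _] PN PN0] := H.
have m1Pos : m1 (~` Pos) = 0%E.
  have -> : m1 (~` Pos) = crestr0 mu mPos (~` Pos) by []; rewrite /crestr0 mem_set; last exact: measurableC.
  by rewrite /crestr setICl charge0.
have m2Pos : m2 Pos = 0%E.
  have -> : m2 Pos = ((-1)%:E * crestr0 mu mNeg Pos)%E by [].
  by rewrite /crestr0 mem_set // /crestr PN0 charge0 mule0.
(* [A] is null for [|mu|], hence for [mua], and carries [mus]: the two conclusions are decided on
   [A] and off [A] respectively. *)
have [A [mA [tvA musA]]] := hsing.
have [m1A m2A] := tv0 A tvA.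
(* Off [A] the measure [mu'] reduces to [mua] and inherits its absolute continuity. *)
have hac' B : measurable B -> m1 B = 0%E -> m2 B = 0%E -> mu' (B `\` A) = 0%E.
  move=> mB B1 B2; have mBA : measurable (B `\` A) by exact: measurableD.
  have le0 (nu : {measure set borel R n -> \bar R}) C C' : measurable C -> measurable C' -> C `<=` C' -> nu C' = 0%E -> nu C = 0%E.
    move=> mC mC' CC C0; apply/eqP; rewrite eq_le measure_ge0 andbT -C0.
    by rewrite le_measure // inE.
  have mus0 : mus (B `\` A) = 0%E.
    have mAC : measurable (~` A) by exact: measurableC.
    by apply: (le0 mus _ (~` A)) => // x [].
  have mi0 (nu : {measure set borel R n -> \bar R}) : nu B = 0%E -> nu (B `\` A) = 0%E.
    by apply: (le0 nu) => //; exact: subDsetl.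
  rewrite hdec // mus0 adde0.
  move/null_content_dominatesP: hac => hac; apply: hac => //.
  rewrite -[LHS]/(m1 (B `\` A) + m2 (B `\` A))%E.
  by rewrite (mi0 m1) // (mi0 m2) // adde0.
have mua_le (N : set (borel R n)) : measurable N -> mu' N = 0%E -> mua N = 0%E /\ mus N = 0%E.
  by move=> mN; rewrite hdec // => /eqP; rewrite padde_eq0 // => /andP[/eqP -> /eqP ->].
have muaA : mua A = 0%E by move/null_content_dominatesP: hac; exact.
split.
  have [N [mN N0 sub]] := singular_span hOm hvsC1 hvsfree htau'deg htau'meas hmassdT hbd mA m1A m2A.
  exists (N `|` ~` A); split.
  - by apply: measurableU => //; exact: measurableC.
  - by apply: null_set_setU => //; [exact: measurableC | exact: (mua_le N mN N0).2].
  move=> x /= /not_implyP[Ox nx]; have [Ax|] := pselect (A x); last by right.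
  by left; apply: sub.
have [N [mN N0 sub]] := ac_span hOm hvsC1 hvsfree htau'deg htau'meas hmassdT hbd mPos mA m1Pos m2Pos hac'.
exists (N `|` A); split.
- exact: measurableU.
- by apply: null_set_setU => //; exact: (mua_le N mN N0).1.
move=> x /= /not_implyP[Ox nx]; have [Ax|Ax] := pselect (A x); first by right.
by left; apply: sub.
Qed.
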